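(* Let $n\ge 2$, $R>0$, and let $f:B_R\to\mathbb{C}$ be in $C^\infty(B_R)$, with Laplace-Fourier coefficients $f_{k,l}$ and associated functions $p_{k,l}$ given by $p_{k,l}(r^2)=r^{-k}f_{k,l}(r)$ ($k\in\mathbb{N}_0$, $l=1,\dots,a_k$). Then $f$ has a holomorphic extension to the Lie ball $\widehat{B_R}$ if and only if both of the following hold: (a) for all $k\in\mathbb{N}_0$, $l=1,\dots,a_k$, the Laplace-Fourier coefficient $f_{k,l}$ is (i.e. extends to) a holomorphic function on the disc $\mathbb{D}_R=\{\zeta\in\mathbb{C}:|\zeta|<R\}$; and (b) for any $0<\tau<\rho<R$ there exists a constant $C_{\rho,\tau}>0$ such that for all $k\in\mathbb{N}_0$, $l=1,\dots,a_k$, $$|p_{k,l}(\zeta)|\le C_{\rho,\tau}\,\frac{1}{\rho^k}\quad\text{for all }\zeta\in\mathbb{C}\text{ with }|\zeta|\le\tau^2 .$$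
   Context: $B_R=\{x\in\mathbb{R}^n:|x|<R\}$ with $|\cdot|$ the Euclidean norm; $\mathbb{S}^{n-1}$ is the unit sphere with surface measure $d\theta$. $C^\infty(B_R)$ is the set of infinitely differentiable functions $B_R\to\mathbb{C}$. For each $k\in\mathbb{N}_0$, $a_k$ is the dimension of the space of harmonic homogeneous polynomials of degree $k$ on $\mathbb{R}^n$, and $Y_{k,l}$, $l=1,\dots,a_k$, is a fixed basis of this space that is orthonormal with respect to $\langle f,g\rangle=\int_{\mathbb{S}^{n-1}}f(\theta)\overline{g(\theta)}\,d\theta$. The Laplace-Fourier coefficients of $f\in C^\infty(B_R)$ are $f_{k,l}(r)=\int_{\mathbb{S}^{n-1}}f(r\theta)\overline{Y_{k,l}(\theta)}\,d\theta$ for $0\le r<R$. It is known that $f_{k,l}$ is infinitely differentiable on $[0,R)$, vanishes at $0$ together with its derivatives of order up to $k-1$, and that $r^{-k}f_{k,l}(r)$ depends only on $r^2$, so there is a unique $p_{k,l}\in C^\infty[0,R^2)$ with $p_{k,l}(r^2)=r^{-k}f_{k,l}(r)$. When $f_{k,l}$ extends holomorphically to $\mathbb{D}_R$, $p_{k,l}$ extends holomorphically to $\mathbb{D}_{R^2}=\{\zeta\in\mathbb{C}:|\zeta|<R^2\}$ via $p_{k,l}(\zeta^2)=\zeta^{-k}f_{k,l}(\zeta)$; these extensions are denoted by the same symbols. For $z=(z_1,\dots,z_n)\in\mathbb{C}^n$ put $|z|^2=|z_1|^2+\dots+|z_n|^2$ and $q(z)=z_1^2+\dots+z_n^2$. The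 Lie ball is $$\widehat{B_R}=\{z\in\mathbb{C}^n:|z|^2+\sqrt{|z|^4-|q(z)|^2}<R^2\},$$ a domain in $\mathbb{C}^n$ containing $B_R$. A holomorphic extension of $f$ to $\widehat{B_R}$ is a holomorphic function on $\widehat{B_R}$ whose restriction to $B_R$ is $f$. *)

(* Defs.v *)
From HB Require Import structures.
From mathcomp Require Import all_boot all_order all_algebra.
From mathcomp Require Import complex.
From mathcomp Require Import all_classical all_reals all_analysis.
From mathcomp Require mpoly.
(* The notations of mpoly clash with those of MathComp-Analysis. *)
Import -(notations) mpoly.

Set Implicit Arguments.
Unset Strict Implicit.
Unset Printing Implicit Defensive.

Import Order.TTheory GRing.Theory Num.Theory.
Import numFieldNormedType.Exports.

Local Open Scope classical_set_scope.
Local Open Scope ring_scope.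
Local Open Scope complex_scope.

Notation cabs := (@Normc.normc _).

Definition complexify (R : realType) (n : nat) (x : 'rV[R]_n) : 'rV[R[i]]_n :=
  map_mx (fun a : R => a%:C) x.

(* The library norm on 'rV_n is the sup norm, hence this one. *)
Definition enorm (R : realType) (n : nat) (x : 'rV[R]_n) : R :=
  Num.sqrt (\sum_i x ord0 i ^+ 2).

Definition eball (R : realType) (n : nat) (r : R) : set 'rV[R]_n :=
  [set x | enorm x < r].
Arguments eball {R} n r.

Definition disc (R : realType) (r : R) : set R[i] := [set z | cabs z < r].

Definition hnorm (R : realType) (n : nat) (z : 'rV[R[i]]_n) : R :=
  Num.sqrt (\sum_i cabs (z ord0 i) ^+ 2).

Definition qform (R : realType) (n : nat) (z : 'rV[R[i]]_n) : R[i] :=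
  \sum_i z ord0 i ^+ 2.

Definition lie_ball (R : realType) (n : nat) (r : R) : set 'rV[R[i]]_n :=
  [set z | hnorm z ^+ 2 + Num.sqrt (hnorm z ^+ 4 - cabs (qform z) ^+ 2)
           < r ^+ 2].
Arguments lie_ball {R} n r.

(* Used with K := R[i] only, where differentiability is C-linear (Frechet). It
   is stated for an abstract field because the topology on matrices is inferred
   from a numFieldType variable, not from the concrete type R[i]. *)
Definition holomorphic_mv (K : numFieldType) (n : nat) (U : set 'rV[K]_n)
    (F : 'rV[K]_n -> K) : Prop :=
  forall z, U z -> differentiable (F : 'rV[K]_n -> K^o) z.

Definition holomorphic (K : numFieldType) (U : set K) (g : K -> K) : Prop :=
  forall z, U z -> derivable (g : K^o -> K^o) z 1.

Definition has_holo_ext (R : realType) (n : nat) (r : R)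
    (f : 'rV[R]_n -> R[i]) : Prop :=
  exists F : 'rV[R[i]]_n -> R[i],
    holomorphic_mv (lie_ball n r) F /\
    (forall x, eball n r x -> F (complexify x) = f x).

Fixpoint diff_upto (R : realType) (n m : nat) (U : set 'rV[R]_n)
    (g : 'rV[R]_n -> R) : Prop :=
  if m is m'.+1 then
    (forall x, U x -> differentiable (g : 'rV[R]_n -> R^o) x) /\
    (forall i : 'I_n,
       diff_upto m' U (fun x => 'D_(delta_mx ord0 i) (g : 'rV[R]_n -> R^o) x))
  else True.

(* For open U. R[i] is not a normed module over R in the library, so smoothness
   is expressed on the real and imaginary parts. *)
Definition smooth_on (R : realType) (n : nat) (U : set 'rV[R]_n)
    (f : 'rV[R]_n -> R[i]) : Prop :=
  forall m, diff_upto m U (fun x => complex.Re (f x)) /\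
            diff_upto m U (fun x => complex.Im (f x)).

(* Surface integral over the unit sphere of R^n, in spherical coordinates:
   the unit sphere of R^(m+2) is parametrized by (t, w) |-> (cos t, sin t * w),
   t in [0, pi], w in the unit sphere of R^(m+1), with surface element
   (sin t)^m dt dw; on the sphere {1, -1} of R^1 it is the counting measure. *)
Fixpoint sphere_int (R : realType) (n : nat) : ('rV[R]_n -> R) -> R :=
  match n return ('rV[R]_n -> R) -> R with
  | 0 => fun _ => 0
  | n'.+1 =>
    match n' return (('rV[R]_n' -> R) -> R) -> ('rV[R]_n'.+1 -> R) -> R with
    | 0 => fun _ h => h (const_mx 1) + h (const_mx (- 1))
    | m.+1 => fun int_m h =>
        Rintegral lebesgue_measure `[0, pi]
          (fun t => sin t ^+ m *
             int_m (fun w : 'rV[R]_m.+1 =>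
               h (row_mx (const_mx (cos t) : 'rV[R]_1) (sin t *: w))))
    end (@sphere_int R n')
  end.

Definition sphere_intC (R : realType) (n : nat) (h : 'rV[R]_n -> R[i]) : R[i] :=
  sphere_int (fun w => complex.Re (h w)) +i*
  sphere_int (fun w => complex.Im (h w)).

Definition mpoly_at (R : realType) (n : nat) (P : mpoly n R[i])
    (x : 'rV[R]_n) : R[i] :=
  meval (fun i => (x ord0 i)%:C) P.

Definition harmonic_homog (R : realType) (n k : nat) (P : mpoly n R[i]) :
    Prop :=
  P \is ishomog1 k (@mdeg n) /\
  \sum_(i < n) mderiv i (mderiv i P) = 0.

Definition sphere_dot (R : realType) (n : nat) (P Q : mpoly n R[i]) :
    R[i] :=
  sphere_intC (fun w => mpoly_at P w * (mpoly_at Q w)^*).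

(* Y is a basis of the space of harmonic homogeneous polynomials of degree k,
   so that d is the dimension of that space, and it is orthonormal. *)
Definition orthonormal_harmonic_basis (R : realType) (n k d : nat)
    (Y : 'I_d -> mpoly n R[i]) : Prop :=
  [/\ forall l, harmonic_homog k (Y l),
      forall P, harmonic_homog k P ->
        exists! c : {ffun 'I_d -> R[i]}, P = \sum_l c l *: Y l
    & forall l l', sphere_dot (Y l) (Y l') = (l == l')%:R].

Definition lf_coef (R : realType) (n : nat) (f : 'rV[R]_n -> R[i])
    (Q : mpoly n R[i]) (r : R) : R[i] :=
  sphere_intC (fun w => f (r *: w) * (mpoly_at Q w)^*).

Definition coef_ext (R : realType) (r0 : R) (phi : R -> R[i]) (g : R[i] -> R[i])
    : Prop :=
  holomorphic (disc r0) g /\ (forall r, 0 <= r < r0 -> g r%:C = phi r).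

(* p is the holomorphic extension to the disc of radius r0^2 of the function
   given on the reals by p(r^2) = r^(-k) phi(r); it is unique on that disc. *)
Definition radial_ext (R : realType) (r0 : R) (k : nat) (phi : R -> R[i])
    (p : R[i] -> R[i]) : Prop :=
  holomorphic (disc (r0 ^+ 2)) p /\
  (forall r, 0 < r < r0 -> p (r ^+ 2)%:C = (r ^- k)%:C * phi r).

(* Main.v *)
(* Write [f_kl(r) = sum_j c_klj r^j].  By comparison with the Taylor polynomials of
   [f] at 0, [c_klj] vanishes unless [j - k] is even and nonnegative, and the
   coefficients of [p_kl] are the [c_kl(k+2m)]; by Cauchy's estimates, (a) and (b)
   together say that for every [tau < R] the numbers [c_klj tau^j] are bounded
   uniformly in [k], [l] and [j].

   If [F] is a holomorphic extension of [f], then for a unit vector [w] the function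
   [z |-> F (z w)] is holomorphic on the disc of radius [R], as [z w] lies in the Lie
   ball.  Its Taylor coefficients are [O(tau^-j)] uniformly in [w], and [c_klj] is
   their inner product with [Y_kl].

   Conversely, let [G_j] be the sum of the [c_klj q^((j-k)/2) Y_kl].  A homogeneous
   polynomial of degree [j] bounded by [M] on the unit sphere is bounded by
   [(j + 1) M L^j] on C^n, where [L] is the Lie norm, because in the coordinates
   [s a + t conj(a)] with [L = max(|s|, |t|)] its coefficients are Fourier
   coefficients of its values on a real circle.  The same device gives a
   Bernstein-type estimate, hence polynomial bounds in [k] for the sums
   [sum_l |Y_kl|].  So [sum_j G_j] converges locally uniformly on the Lie ball to a
   holomorphic function.  On each real sphere it has the same Laplace-Fourier
   coefficients as [f], and it equals [f] because the restrictions of harmonic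
   polynomials are complete. *)
From HB Require Import structures.
From mathcomp Require Import all_boot all_order all_algebra.
From mathcomp Require Import complex.
From mathcomp Require Import all_classical all_reals all_analysis.
From mathcomp Require mpoly.
From mathcomp Require Import ring lra zify.
Require Import Defs.
Import -(notations) mpoly.
Set Implicit Arguments.
Unset Strict Implicit.
Unset Printing Implicit Defensive.
Import Order.TTheory GRing.Theory Num.Theory.
Import numFieldNormedType.Exports.
Local Open Scope classical_set_scope.
Local Open Scope ring_scope.
Local Open Scope complex_scope.


(** * Complex numbers and geometrically convergent series *)

(** Two devices recur. Every integral, including the circle integrals of one complex variable, is a
    [sphere_int]: the unit circle is the sphere of R^2 seen through [zof]. And one concentration
    argument replaces approximation theorems: on the sphere the kernel [(1 + sdot w th) / 2] has its
    maximum 1 at [w = th], so a continuous function orthogonal to all its powers vanishes at [th].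
    On the circle these powers are trigonometric polynomials, which turns equality of Fourier
    coefficients into the Taylor expansion; on higher spheres they are polynomials, which yields the
    completeness of the spherical harmonics. The kernel argument and the sup bounds for the [Y_kl]
    both rest on a lower bound, polynomial in the radius, for integrals over small caps. Limits are
    handled through series dominated by [M * x ^+ j] with [x < 1]. The strict inequalities between
    radii leave room: a factor polynomial in [j] or [k] is absorbed by a slightly larger radius, so
    no exponent has to be sharp. *)

Section Complex.
Variable R : realType.
Implicit Types (z w : R[i]) (x : R).

Lemma cabsE z : `|z| = (cabs z)%:C. Proof. by rewrite normc_def; case: z. Qed.
Lemma cabs_ge0 z : 0 <= cabs z. Proof. by rewrite -ler0c -cabsE. Qed.
Lemma cabsD z w : cabs (z + w) <= cabs z + cabs w.
Proof. exact: (@le_normcD R z w). Qed.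
Lemma cabsM z w : cabs (z * w) = cabs z * cabs w. Proof. exact: Normc.normcM. Qed.
Lemma cabsN z : cabs (- z) = cabs z. Proof. exact: (@normcN R z). Qed.
Lemma cabsV z : cabs z^-1 = (cabs z)^-1. Proof. exact: Normc.normcV. Qed.
Lemma cabs0 : cabs (0 : R[i]) = 0. Proof. exact: Normc.normc0. Qed.
Lemma cabs1 : cabs (1 : R[i]) = 1. Proof. exact: Normc.normc1. Qed.
Lemma cabsB z w : cabs (z - w) = cabs (w - z). Proof. by rewrite -cabsN opprB. Qed.
Lemma cabs_eq0 z : (cabs z == 0) = (z == 0).
Proof. by apply/eqP/eqP => [/Normc.eq0_normc//|->]; rewrite cabs0. Qed.
Lemma cabs_gt0 z : (0 < cabs z) = (z != 0).
Proof. by rewrite lt0r cabs_ge0 andbT cabs_eq0. Qed.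
Lemma cabsX z n : cabs (z ^+ n) = cabs z ^+ n.
Proof. by elim: n => [|n IH]; rewrite ?expr0 ?cabs1// !exprS cabsM IH. Qed.
Lemma cabsR x : cabs x%:C = `|x|.
Proof. by rewrite /= expr0n /= addr0 sqrtr_sqr. Qed.
Lemma cabsJ z : cabs z^* = cabs z.
Proof. by case: z => a b /=; rewrite sqrrN. Qed.
Lemma cabsMn z n : cabs (z *+ n) = cabs z *+ n.
Proof. by rewrite -mulr_natl cabsM -(rmorph_nat (real_complex R)) cabsR ger0_norm// mulr_natl. Qed.
Lemma cabs_sqr z : cabs z ^+ 2 = complex.Re z ^+ 2 + complex.Im z ^+ 2.
Proof. by case: z => a b /=; rewrite sqr_sqrtr // addr_ge0 ?sqr_ge0. Qed.
Lemma mulcJE z : z * z^* = (cabs z ^+ 2)%:C.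
Proof. by rewrite cabs_sqr; case: z => a b; simpc; rewrite -!expr2; congr Complex; ring. Qed.
Lemma Re_le_cabs z : `|complex.Re z| <= cabs z.
Proof. by rewrite -(ler_pXn2r (n:=2)) ?nnegrE ?cabs_ge0// cabs_sqr real_normK ?num_real// lerDl sqr_ge0. Qed.
Lemma Im_le_cabs z : `|complex.Im z| <= cabs z.
Proof. by rewrite -(ler_pXn2r (n:=2)) ?nnegrE ?cabs_ge0// cabs_sqr real_normK ?num_real// lerDr sqr_ge0. Qed.
Lemma cabs_le_ReIm z : cabs z <= `|complex.Re z| + `|complex.Im z|.
Proof.
rewrite -(ler_pXn2r (n:=2)) ?nnegrE ?cabs_ge0 ?addr_ge0//.
rewrite cabs_sqr sqrrD !real_normK ?num_real// lerD2r lerDl.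
by rewrite mulrn_wge0// mulr_ge0.
Qed.
Lemma cabs_sum (I : Type) (r : seq I) (P : pred I) (F : I -> R[i]) :
  cabs (\sum_(i <- r | P i) F i) <= \sum_(i <- r | P i) cabs (F i).
Proof.
elim/big_rec2: _ => [|i y1 y2 _ H]; first by rewrite cabs0.
by apply: (le_trans (cabsD _ _)); rewrite lerD2l.
Qed.
Lemma cabs_distD z w : cabs z - cabs w <= cabs (z - w).
Proof. by rewrite lerBlDr -{1}(subrK w z) cabsD. Qed.
Lemma cReD z w : complex.Re (z + w) = complex.Re z + complex.Re w.
Proof. by case: z w => [a b] [c d]. Qed.
Lemma cImD z w : complex.Im (z + w) = complex.Im z + complex.Im w.
Proof. by case: z w => [a b] [c d]. Qed.
Lemma cReN z : complex.Re (- z) = - complex.Re z. Proof. by case: z. Qed.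
Lemma cImN z : complex.Im (- z) = - complex.Im z. Proof. by case: z. Qed.
Lemma cReM z w : complex.Re (z * w) =
  complex.Re z * complex.Re w - complex.Im z * complex.Im w.
Proof. by case: z w => [a b] [c d]. Qed.
Lemma cImM z w : complex.Im (z * w) =
  complex.Re z * complex.Im w + complex.Im z * complex.Re w.
Proof. by case: z w => [a b] [c d]. Qed.
Lemma cReJ z : complex.Re z^* = complex.Re z. Proof. by case: z. Qed.
Lemma cImJ z : complex.Im z^* = - complex.Im z. Proof. by case: z. Qed.
Lemma cRe_sum (I : Type) (r : seq I) (P : pred I) (F : I -> R[i]) :
  complex.Re (\sum_(i <- r | P i) F i) = \sum_(i <- r | P i) complex.Re (F i).
Proof. by elim/big_rec2: _ => // i y1 y2 _ <-; rewrite cReD. Qed.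
Lemma cIm_sum (I : Type) (r : seq I) (P : pred I) (F : I -> R[i]) :
  complex.Im (\sum_(i <- r | P i) F i) = \sum_(i <- r | P i) complex.Im (F i).
Proof. by elim/big_rec2: _ => // i y1 y2 _ <-; rewrite cImD. Qed.
Lemma ceqP z w : complex.Re z = complex.Re w -> complex.Im z = complex.Im w -> z = w.
Proof. by case: z w => [a b] [c d] /= -> ->. Qed.

End Complex.

Section Ccts.
Variables (R : realType) (T : topologicalType).
Implicit Types (f g : T -> R[i]) (t : T).

(** Continuity is imposed on the two real parts because [sphere_intC] integrates them separately;
    [cctsP] gives the equivalent form with the modulus. *)
Definition ccts f t := {for t, continuous (fun s => complex.Re (f s) : R)} /\
  {for t, continuous (fun s => complex.Im (f s) : R)}.

Lemma cctsP f t :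
  ccts f t <-> (forall e : R, 0 < e -> \forall s \near t, cabs (f s - f t) < e).
Proof.
split=> [[h1 h2] e e0|H]; last split.
- have e2 : 0 < e / 2 by rewrite divr_gt0.
  move/cvgrPdistC_lt : h1 => /(_ _ e2) h1.
  move/cvgrPdistC_lt : h2 => /(_ _ e2) h2.
  near=> s; apply: (le_lt_trans (cabs_le_ReIm _)).
  rewrite cReD cImD cReN cImN [e]splitr ltrD//.
  + by near: s; exact: h1.
  + by near: s; exact: h2.
- apply/cvgrPdistC_lt => e e0; have := H e e0; apply: filterS => s; apply: le_lt_trans.
  by rewrite -cReN -cReD Re_le_cabs.
- apply/cvgrPdistC_lt => e e0; have := H e e0; apply: filterS => s; apply: le_lt_trans.
  by rewrite -cImN -cImD Im_le_cabs.
Unshelve. all: by end_near. Qed.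

Lemma ccts_cst (c : R[i]) t : ccts (fun=> c) t.
Proof. by split; exact: cvg_cst. Qed.
Lemma cctsD f g t : ccts f t -> ccts g t -> ccts (fun s => f s + g s) t.
Proof.
move=> [f1 f2] [g1 g2]; split.
- under [X in {for _, continuous X}]eq_fun do rewrite cReD. exact: cvgD.
- under [X in {for _, continuous X}]eq_fun do rewrite cImD. exact: cvgD.
Qed.
Lemma cctsN f t : ccts f t -> ccts (fun s => - f s) t.
Proof.
move=> [f1 f2]; split.
- under [X in {for _, continuous X}]eq_fun do rewrite cReN. exact: cvgN.
- under [X in {for _, continuous X}]eq_fun do rewrite cImN. exact: cvgN.
Qed.
Lemma cctsM f g t : ccts f t -> ccts g t -> ccts (fun s => f s * g s) t.
Proof.
move=> [f1 f2] [g1 g2]; split.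
- under [X in {for _, continuous X}]eq_fun do rewrite cReM.
  by apply: cvgB; exact: cvgM.
- under [X in {for _, continuous X}]eq_fun do rewrite cImM.
  by apply: cvgD; exact: cvgM.
Qed.
Lemma cctsJ f t : ccts f t -> ccts (fun s => (f s)^*) t.
Proof.
move=> [f1 f2]; split.
- by under [X in {for _, continuous X}]eq_fun do rewrite cReJ.
- under [X in {for _, continuous X}]eq_fun do rewrite cImJ. exact: cvgN.
Qed.
Lemma cctsX f n t : ccts f t -> ccts (fun s => f s ^+ n) t.
Proof.
move=> h; elim: n => [|n IH]; first exact: ccts_cst.
by under [X in ccts X]eq_fun do rewrite exprS; exact: cctsM.
Qed.
Lemma ccts_sum (I : Type) (r : seq I) (F : I -> T -> R[i]) t :
  (forall i, ccts (F i) t) -> ccts (fun s => \sum_(i <- r) F i s) t.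
Proof.
move=> H; elim: r => [|i r IH].
  by under [X in ccts X]eq_fun do rewrite big_nil; exact: ccts_cst.
by under [X in ccts X]eq_fun do rewrite big_cons; exact: cctsD.
Qed.
Lemma ccts_real (f : T -> R) t : {for t, continuous f} -> ccts (fun s => (f s)%:C) t.
Proof. by move=> h; split => //=; exact: cvg_cst. Qed.
Lemma ccts_cabs f t : ccts f t -> {for t, continuous (fun s => cabs (f s))}.
Proof.
move=> /cctsP h; apply/cvgrPdistC_lt => e e0; have := h e e0; apply: filterS => s; apply: le_lt_trans.
rewrite ler_norml cabs_distD andbT lerNl opprB.
by rewrite (cabsB (f s)) cabs_distD.
Qed.
Lemma ccts_unif f t : (forall e : R, 0 < e -> exists g, ccts g t /\
  \forall s \near t, cabs (f s - g s) <= e) -> ccts f t.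
Proof.
move=> H; apply/cctsP => e e0; have e3 : 0 < e / 4 by rewrite divr_gt0.
have [g [/cctsP gt fg]] := H _ e3.
have fgt := nbhs_singleton fg.
near=> s; rewrite (_ : f s - f t = (f s - g s) + (g s - g t) + (g t - f t)); last by ring.
apply: (le_lt_trans (cabsD _ _)); rewrite (cabsB (g t)).
apply: (@le_lt_trans _ _ (e/4 + e/4 + e/4)); last by lra.
apply: lerD => //; apply: (le_trans (cabsD _ _)); apply: lerD.
  by near: s.
by apply/ltW; near: s; exact: gt.
Unshelve. all: by end_near. Qed.
End Ccts.

Lemma ccts_comp (R : realType) (U T : topologicalType) (phi : U -> T) (f : T -> R[i]) u :
  {for u, continuous phi} -> ccts f (phi u) -> ccts (f \o phi) u.
Proof.
by move=> h [f1 f2]; split; [exact: (continuous_comp h f1)|exact: (continuous_comp h f2)].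
Qed.

Section Gsum.
Variable R : realType.
Implicit Types (u v : nat -> R[i]) (M x : R).

(** Defined for every sequence, with the default value of [limn] when a part diverges; under a
    geometric bound its value is controlled by [gsumP]. *)
Definition gsum u : R[i] :=
  limn (series (fun j => complex.Re (u j))) +i* limn (series (fun j => complex.Im (u j))).

Lemma geo_tail u M x m p : 0 <= x -> x < 1 -> (forall j, cabs (u j) <= M * x ^+ j) ->
  (m <= p)%N -> cabs (\sum_(j < p) u j - \sum_(j < m) u j) <= M * x ^+ m / (1 - x).
Proof.
move=> x0 x1 H /subnK <-; set q := (p - m)%N.
have M0 : 0 <= M by have := H 0; rewrite expr0 mulr1; apply: le_trans; exact: cabs_ge0.
have x1' : 0 < 1 - x by rewrite subr_gt0.
have -> : \sum_(j < q + m) u j - \sum_(j < m) u j = \sum_(j < q) u (m + j)%N.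
  by rewrite addnC big_split_ord /= addrAC subrr add0r.
apply: (le_trans (cabs_sum _ _ _)).
apply: (@le_trans _ _ (\sum_(j < q) M * x ^+ m * x ^+ j)).
  by apply: ler_sum => j _; rewrite -mulrA -exprD.
rewrite -mulr_sumr ler_wpM2l ?mulr_ge0 ?exprn_ge0//.
rewrite -[leRHS]mul1r ler_pdivlMr// mulrC -[1 - x]opprB mulNr -subrX1 opprB.
by rewrite gerBl exprn_ge0.
Qed.

Lemma gsumP u M x m : 0 <= x -> x < 1 -> (forall j, cabs (u j) <= M * x ^+ j) ->
  cabs (gsum u - \sum_(j < m) u j) <= M * x ^+ m / (1 - x).
Proof.
move=> x0 x1 H.
have M0 : 0 <= M by have := H 0; rewrite expr0 mulr1; apply: le_trans; exact: cabs_ge0.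
have key (v : nat -> R) : (forall j, `|v j| <= M * x ^+ j) -> cvgn (series v).
  move=> Hv; apply: normed_cvg; apply: (@series_le_cvg _ _ (geometric M x)) => //.
  - by move=> n /=; exact: normr_ge0.
  - by move=> n; rewrite /= mulr_ge0// exprn_ge0.
  - by apply: is_cvg_geometric_series; rewrite ger0_norm.
have c1 : cvgn (series (fun j => complex.Re (u j))).
  by apply: key => j; apply: le_trans (H j); exact: Re_le_cabs.
have c2 : cvgn (series (fun j => complex.Im (u j))).
  by apply: key => j; apply: le_trans (H j); exact: Im_le_cabs.
apply/ler_addgt0Pr => e e0.
have e2 : 0 < e / 2 by rewrite divr_gt0.
have [N1 _ H1] : \forall n \near \oo, `|limn (series (fun j => complex.Re (u j))) - series (fun j => complex.Re (u j)) n| < e / 2.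
  by move/cvgrPdist_lt : c1; apply.
have [N2 _ H2] : \forall n \near \oo, `|limn (series (fun j => complex.Im (u j))) - series (fun j => complex.Im (u j)) n| < e / 2.
  by move/cvgrPdist_lt : c2; apply.
set p := maxn m (maxn N1 N2).
have p1 : (N1 <= p)%N by rewrite /p !leq_max leqnn orbT.
have p2 : (N2 <= p)%N by rewrite /p !leq_max leqnn !orbT.
have p3 : (m <= p)%N by rewrite /p !leq_max leqnn.
rewrite (_ : _ - _ = (\sum_(j < p) u j - \sum_(j < m) u j) + (gsum u - \sum_(j < p) u j)); last by ring.
apply: (le_trans (cabsD _ _)); apply: lerD; first exact: geo_tail.
apply: (le_trans (cabs_le_ReIm _)); rewrite cReD cImD cReN cImN cRe_sum cIm_sum.
have := H1 _ p1; have := H2 _ p2; rewrite /series /= !big_mkord => h2 h1.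
by rewrite [e]splitr lerD// ltW.
Qed.

(** [gsumP] bounds one half of the distance and the hypothesis the other. Later identities between
    sums are proved by exhibiting an explicit [N]. *)
Lemma gsum_unique u M x s : 0 <= x -> x < 1 -> (forall j, cabs (u j) <= M * x ^+ j) ->
  (forall e : R, 0 < e -> exists N, forall m, (N <= m)%N -> cabs (s - \sum_(j < m) u j) <= e) ->
  s = gsum u.
Proof.
move=> x0 x1 H Hs; apply/eqP; rewrite -subr_eq0 -cabs_eq0 eq_le cabs_ge0 andbT.
apply/ler_addgt0Pr => e e0; rewrite add0r.
have e2 : 0 < e / 2 by rewrite divr_gt0.
have [N HN] := Hs _ e2.
have : M * x ^+ m / (1 - x) @[m --> \oo] --> (0 : R).
  rewrite -[X in _ --> X](mul0r (1 - x)^-1); apply: cvgM; last exact: cvg_cst.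
  by apply: cvg_geometric; rewrite ger0_norm.
move=> /cvgrPdist_le /(_ _ e2) [N1 _ H1].
set m := maxn N N1.
rewrite (_ : _ - _ = (s - \sum_(j < m) u j) - (gsum u - \sum_(j < m) u j)); last by ring.
apply: (le_trans (cabsD _ _)); rewrite cabsN [e]splitr; apply: lerD.
  by apply: HN; rewrite leq_maxl.
apply: (le_trans (gsumP m x0 x1 H)).
by have := H1 m (leq_maxr _ _); rewrite sub0r normrN; apply: le_trans; exact: ler_norm.
Qed.

Lemma gsum_le u M x : 0 <= x -> x < 1 -> (forall j, cabs (u j) <= M * x ^+ j) ->
  cabs (gsum u) <= M / (1 - x).
Proof. by move=> x0 x1 H; have := gsumP 0 x0 x1 H; rewrite big_ord0 subr0 mulr1. Qed.

Lemma gsum_eq u v : (forall j, u j = v j) -> gsum u = gsum v.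
Proof. by move=> /funext ->. Qed.

End Gsum.


(** * Integration over the unit sphere *)

Lemma cvg_rV (U T : topologicalType) n (phi : U -> 'rV[T]_n) u :
  (forall i, {for u, continuous (fun s => phi s ord0 i)}) -> {for u, continuous phi}.
Proof.
move=> H A [P PA sub]; rewrite /nbhs /=.
have : \forall s \near u, forall i, P ord0 i (phi s ord0 i).
  by apply: filter_forall => i; exact: (H i _ (PA ord0 i)).
by apply: filterS => s Hs; apply: sub => i j; rewrite ord1.
Qed.

Section Rint.
Variable R : realType.
Implicit Types (f g : R -> R) (a b c : R).

Definition rint a b f : R := Rintegral lebesgue_measure `[a, b] f.
Definition cts_on a b f := forall t, a <= t <= b -> {for t, continuous f}.

Lemma cts_on_integrable a b f : cts_on a b f ->
  lebesgue_measure.-integrable `[a, b] (EFin \o f).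
Proof.
move=> H; apply: continuous_compact_integrable; first exact: segment_compact.
apply: continuous_in_subspaceT => t; rewrite inE /= in_itv /= => tab; exact: H.
Qed.

Lemma rintD a b f g : cts_on a b f -> cts_on a b g ->
  rint a b (fun t => f t + g t) = rint a b f + rint a b g.
Proof. by move=> hf hg; rewrite /rint RintegralD//; exact: cts_on_integrable. Qed.
Lemma rintB a b f g : cts_on a b f -> cts_on a b g ->
  rint a b (fun t => f t - g t) = rint a b f - rint a b g.
Proof. by move=> hf hg; rewrite /rint RintegralB//; exact: cts_on_integrable. Qed.
Lemma rintZ a b f c : cts_on a b f -> rint a b (fun t => c * f t) = c * rint a b f.
Proof. by move=> hf; rewrite /rint RintegralZl//; exact: cts_on_integrable. Qed.
Lemma rint_le a b f g : cts_on a b f -> cts_on a b g ->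
  (forall t, a <= t <= b -> f t <= g t) -> rint a b f <= rint a b g.
Proof.
move=> hf hg H; apply: le_Rintegral; [by []|exact: cts_on_integrable|exact: cts_on_integrable|].
by move=> t /=; rewrite in_itv /=; exact: H.
Qed.
Lemma eq_rint a b f g : (forall t, a <= t <= b -> f t = g t) -> rint a b f = rint a b g.
Proof.
move=> H; apply: eq_Rintegral => t; rewrite inE /= in_itv /=; exact: H.
Qed.
Lemma rint_cst a b c : a <= b -> rint a b (fun=> c) = c * (b - a).
Proof.
move=> ab; rewrite /rint Rintegral_cst//= lebesgue_measure_itv /= lte_fin.
by move: ab; rewrite le_eqVlt => /predU1P[->|->//]; rewrite ltxx /= subrr.
Qed.
Lemma rint_split a c b f : a <= c -> c <= b -> cts_on a b f ->
  rint a b f = rint a c f + rint c b f.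
Proof.
move=> ac cb hf; have := @Rintegral_itvB R f (BLeft a) (BRight b) c (cts_on_integrable hf).
rewrite !bnd_simp => /(_ ac cb); rewrite Rintegral_itv_obnd_cbnd; last first.
  apply: (integrableS _ _ _ (cts_on_integrable hf)) => //.
  by apply: subset_itvr; rewrite bnd_simp.
by rewrite /rint => <-; ring.
Qed.
Lemma rint0 a b : rint a b (fun=> 0) = 0.
Proof. by rewrite /rint Rintegral_cst// mul0r. Qed.
Lemma rint_ge0 a b f : (forall t, a <= t <= b -> 0 <= f t) -> 0 <= rint a b f.
Proof. by move=> H; apply: Rintegral_ge0 => t /=; rewrite in_itv /=; exact: H. Qed.
Lemma rint_FTC a b (F : R -> R) f : a < b -> cts_on a b f ->
  (forall t, is_derive t (1 : R) F (f t)) -> rint a b f = F b - F a.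
Proof.
move=> ab hf dF; rewrite /rint /Rintegral.
have cF t : {for t, continuous F}.
  by apply: differentiable_continuous; apply/derivable1_diffP; exact: (@ex_derive _ _ _ _ _ _ _ (dF t)).
rewrite (@continuous_FTC2 _ f F)//=.
- apply: continuous_in_subspaceT => t; rewrite inE /= in_itv /= => tab; exact: hf.
- split.
  + by move=> t _; exact: (@ex_derive _ _ _ _ _ _ _ (dF t)).
  + by apply: cvg_at_right_filter; exact: cF.
  + by apply: cvg_at_left_filter; exact: cF.
- by move=> t _; rewrite derive1E; exact: (@derive_val _ _ _ _ _ _ _ (dF t)).
Qed.
End Rint.

Section Sphere.
Variable R : realType.

Definition sph n : set 'rV[R]_n := [set w | enorm w = 1].
(** Continuity in the ambient space at the points of the sphere, not continuity of the restriction;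
    a function controlled only on the sphere is therefore composed with the projection [nrm]. *)
Definition scont n (h : 'rV[R]_n -> R) := forall w, sph w -> {for w, continuous h}.
Definition slice m (t : R) (w : 'rV[R]_m.+1) : 'rV[R]_(m.+2) :=
  row_mx (const_mx (cos t) : 'rV[R]_1) (sin t *: w).

Lemma sphere_intS m (h : 'rV[R]_m.+2 -> R) : sphere_int h =
  rint 0 pi (fun t => sin t ^+ m * sphere_int (fun w => h (slice t w))).
Proof. by []. Qed.

Lemma slice0 m t (w : 'rV[R]_m.+1) : slice t w ord0 ord0 = cos t.
Proof.
rewrite /slice mxE; case: splitP => j /= Hj; first by rewrite mxE.
by [].
Qed.
Lemma sliceS m t (w : 'rV[R]_m.+1) i : slice t w ord0 (lift ord0 i) = sin t * w ord0 i.
Proof.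
rewrite /slice mxE; case: splitP => j /=.
  by rewrite (ord1 j).
by rewrite /bump /= => -[] /val_inj <-; rewrite mxE.
Qed.

Lemma enorm_sq n (w : 'rV[R]_n) : enorm w ^+ 2 = \sum_i w ord0 i ^+ 2.
Proof. by rewrite /enorm sqr_sqrtr// sumr_ge0// => i _; exact: sqr_ge0. Qed.
Lemma enorm_ge0 n (w : 'rV[R]_n) : 0 <= enorm w. Proof. exact: sqrtr_ge0. Qed.
Lemma sphE n (w : 'rV[R]_n) : sph w <-> \sum_i w ord0 i ^+ 2 = 1.
Proof.
rewrite -enorm_sq /sph /=; split=> [->|/eqP]; first by rewrite expr1n.
by rewrite sqrp_eq1 ?enorm_ge0// => /eqP.
Qed.
Lemma sph_slice m t (w : 'rV[R]_m.+1) : sph w -> sph (slice t w).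
Proof.
move=> /sphE H; apply/sphE; rewrite big_ord_recl slice0.
under eq_bigr do rewrite sliceS exprMn.
by rewrite -mulr_sumr H mulr1 cos2Dsin2.
Qed.
Lemma sph_coord n (w : 'rV[R]_n) i : sph w -> `|w ord0 i| <= 1.
Proof.
move=> /sphE; rewrite (bigD1 i) //= => H.
rewrite -(ler_pXn2r (n:=2)) ?nnegrE// real_normK ?num_real// expr1n -H lerDl.
by apply: sumr_ge0 => j _; exact: sqr_ge0.
Qed.

Lemma cont_coord n (i : 'I_n) (w : 'rV[R]_n) : {for w, continuous (fun v : 'rV[R]_n => v ord0 i)}.
Proof. exact: (@coord_continuous R 1 n ord0 i w). Qed.

Lemma cont_fst (T U V : topologicalType) (f : T -> V) (p : T * U) :
  {for p.1, continuous f} -> {for p, continuous (fun q : T * U => f q.1)}.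
Proof. by move=> h; apply: (@continuous_comp _ _ _ fst f) => //; exact: cvg_fst. Qed.
Lemma cont_snd (T U V : topologicalType) (f : U -> V) (p : T * U) :
  {for p.2, continuous f} -> {for p, continuous (fun q : T * U => f q.2)}.
Proof. by move=> h; apply: (@continuous_comp _ _ _ snd f) => //; exact: cvg_snd. Qed.
Lemma cont_cst (T : topologicalType) (c : R) (t : T) : {for t, continuous (fun _ : T => c)}.
Proof. exact: cvg_cst. Qed.
Arguments cont_cst {T} c t.
Lemma contM (T : topologicalType) (f g : T -> R) (t : T) :
  {for t, continuous f} -> {for t, continuous g} -> {for t, continuous (fun s => f s * g s)}.
Proof. exact: cvgM. Qed.
Lemma contD (T : topologicalType) (f g : T -> R) (t : T) :
  {for t, continuous f} -> {for t, continuous g} -> {for t, continuous (fun s => f s + g s)}.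
Proof. exact: cvgD. Qed.
Lemma contX (T : topologicalType) (f : T -> R) n (t : T) :
  {for t, continuous f} -> {for t, continuous (fun s => f s ^+ n)}.
Proof.
move=> h; elim: n => [|n IH]; first exact: cvg_cst.
rewrite (_ : (fun s => _) = (fun s => f s * f s ^+ n)); last by apply/funext => s; rewrite exprS.
exact: (contM h IH).
Qed.
Lemma cont_sum (T : topologicalType) (I : Type) (r : seq I) (F : I -> T -> R) (t : T) :
  (forall i, {for t, continuous (F i)}) -> {for t, continuous (fun s => \sum_(i <- r) F i s)}.
Proof.
move=> h; elim: r => [|i r IH].
  by under [X in {for _, continuous X}]eq_fun do rewrite big_nil; exact: cvg_cst.
by under [X in {for _, continuous X}]eq_fun do rewrite big_cons; exact: contD.
Qed.

Lemma slice_cont m (p : R * 'rV[R]_m.+1) : {for p, continuous (fun q => slice q.1 q.2)}.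
Proof.
apply: cvg_rV => i; case: (unliftP ord0 i) => [j ->|->].
- under [X in {for _, continuous X}]eq_fun do rewrite sliceS.
  apply: contM; first by apply: cont_fst; exact: continuous_sin.
  by apply: (@cont_snd _ _ _ (fun v : 'rV[R]_m.+1 => v ord0 j)); exact: cont_coord.
- under [X in {for _, continuous X}]eq_fun do rewrite slice0.
  by apply: cont_fst; exact: continuous_cos.
Qed.

Lemma sph_compact n : compact (@sph n).
Proof.
apply: (subclosed_compact _ (@rV_compact R n (fun=> `[-1, 1]%classic) _)).
- rewrite (_ : @sph n = (fun w : 'rV[R]_n => \sum_i w ord0 i ^+ 2) @^-1` [set 1]); last first.
    by apply/seteqP; split => w /sphE.
  apply: preimage_closed; last exact: closed_eq.
  by move=> w _; apply: cont_sum => i; apply: contX; exact: cont_coord.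
- by move=> i; exact: segment_compact.
- by move=> w Hw i /=; rewrite in_itv /= -ler_norml; exact: sph_coord.
Qed.

Lemma cont_pair2 (T U : topologicalType) (H : T -> U -> R) t w :
  {for (t, w), continuous (fun p => H p.1 p.2)} -> {for w, continuous (H t)}.
Proof.
move=> h; apply: (@continuous_comp _ _ _ (fun v : U => (t, v)) (fun p => H p.1 p.2)) => //.
by apply: cvg_pair => //=; exact: cvg_cst.
Qed.

(** The tube lemma: compactness of the sphere makes continuity in the parameter uniform in [w]. *)
Lemma sph_tube (T : topologicalType) n (H : T -> 'rV[R]_n -> R) (t0 : T) :
  (forall w, sph w -> {for (t0, w), continuous (fun p => H p.1 p.2)}) ->
  forall e, 0 < e -> \forall t \near t0, forall w, sph w -> `|H t w - H t0 w| < e.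
Proof.
move=> Hc e e0; have /compact_near_coveringP K := @sph_compact n.
apply: (K T (nbhs t0) (fun t w => `|H t w - H t0 w| < e)) => w Hw.
have e2 : 0 < e / 2 by rewrite divr_gt0.
have /cvgrPdistC_lt /(_ _ e2) h := Hc w Hw.
have /cvgrPdistC_lt /(_ _ e2) h2 := cont_pair2 (Hc w Hw).
case: h => [[A B] [/= hA hB] AB].
exists (B `&` [set w' | `|H t0 w' - H t0 w| < e / 2], A) => /=.
  by split => //; exact: filterI.
move=> [w' t] /= [[Bw' h'] At].
have -> : H t w' - H t0 w' = (H t w' - H t0 w) - (H t0 w' - H t0 w) by ring.
apply: (le_lt_trans (ler_normB _ _)); rewrite [e]splitr ltrD//.
exact: (AB (t, w')).
Qed.

(** Linearity and monotonicity go through one induction on the dimension: to integrate over the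
    angle, the inner integral must be continuous in [t], and that uses both properties one dimension
    lower. *)
Lemma sphere_int_props n :
  (forall c h1 h2, @scont n.+1 h1 -> scont h2 ->
     sphere_int (fun w => c * h1 w + h2 w) = c * sphere_int h1 + sphere_int h2) /\
  (forall h1 h2, @scont n.+1 h1 -> scont h2 -> (forall w, sph w -> h1 w <= h2 w) ->
     sphere_int h1 <= sphere_int h2).
Proof.
have scZD m c h1 h2 : @scont m h1 -> scont h2 -> scont (fun w => c * h1 w + h2 w).
  move=> s1 s2 w Hw.
  exact: (contD (contM (cont_cst c w) (s1 w Hw)) (s2 w Hw)).
elim: n => [|m [IHl IHm]].
  split=> [c h1 h2 s1 s2|h1 h2 s1 s2 H] /=; first by ring.
  have S1 (x : R) : x ^+ 2 = 1 -> sph (const_mx x : 'rV[R]_1).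
    by move=> hx; apply/sphE; rewrite big_ord1 mxE.
  by apply: lerD; apply: H; apply: S1; ring.
(* Comparison with the constants [c] and [- c], whose integrals are multiples of that of 1 by
   linearity. *)
have IH0 (c : R) h : @scont m.+1 h -> (forall w, sph w -> `|h w| <= c) ->
    `|sphere_int h| <= c * @sphere_int R m.+1 (fun=> 1 : R).
  move=> hc Hb; have scst (x : R) : @scont m.+1 (fun=> x) by move=> w _; exact: cont_cst.
  have I0 : @sphere_int R m.+1 (fun=> 0) = 0.
    have := IHl (-1) _ _ (scst 0) (scst 0).
    by rewrite (_ : (fun _ => _) = fun=> 0) ?mulN1r ?addNr//; apply/funext => w; rewrite mulr0 addr0.
  have Ic (x : R) : @sphere_int R m.+1 (fun=> x) = x * @sphere_int R m.+1 (fun=> 1 : R).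
    rewrite -[RHS]addr0 -[X in _ + X]I0 -IHl; [|exact: scst|exact: scst].
    by congr sphere_int; apply/funext => w; rewrite mulr1 addr0.
  rewrite ler_norml -mulNr -!Ic; apply/andP; split; apply: IHm => // w /Hb; rewrite ler_norml => /andP[]//.
(* [sph_tube] makes the slices at nearby angles uniformly close, and [IH0] turns this into closeness
   of the integrals. *)
have icont (h : 'rV[R]_m.+2 -> R) : scont h -> forall t,
    {for t, continuous (fun t => sphere_int (fun w => h (slice t w)))} /\ scont (fun w => h (slice t w)).
  move=> hs t.
  have hc s w : sph w -> {for (s, w), continuous (fun p => h (slice p.1 p.2))}.
    move=> Hw; apply: (@continuous_comp _ _ _ (fun p => slice p.1 p.2) h); first exact: slice_cont.
    by apply: hs; exact: sph_slice.
  have hsl s : scont (fun w => h (slice s w)) by move=> w Hw; exact: (@cont_pair2 _ _ (fun s w => h (slice s w)) s w (hc s w Hw)).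
  split=> //.
  apply/cvgrPdistC_le => e e0.
  set w0 := @sphere_int R m.+1 (fun=> 1 : R).
  have e2 : 0 < e / (1 + `|w0|) by rewrite divr_gt0// ltr_wpDr.
  have := @sph_tube _ _ (fun s w => h (slice s w)) t (hc t) _ e2.
  apply: filterS => s Hs.
  have -> : sphere_int (fun w => h (slice s w)) - sphere_int (fun w => h (slice t w)) =
    sphere_int (fun w => (-1) * h (slice t w) + h (slice s w)) by rewrite IHl//; ring.
  apply: (@le_trans _ _ (e / (1 + `|w0|) * w0)).
    apply: IH0; first exact: scZD.
    by move=> w Hw; rewrite mulN1r addrC ltW// Hs.
  rewrite mulrAC ler_pdivrMr ?ltr_wpDr// ler_pM2l//.
  by apply: (le_trans (ler_norm _)); rewrite lerDr.
have icont2 (h : 'rV[R]_m.+2 -> R) : scont h ->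
    cts_on 0 pi (fun t => sin t ^+ m * sphere_int (fun w => h (slice t w))).
  move=> hs t _; apply: contM; first by apply: contX; exact: continuous_sin.
  by have [] := icont h hs t.
split=> [c h1 h2 s1 s2|h1 h2 s1 s2 H]; rewrite !sphere_intS.
- rewrite -rintZ; last exact: icont2.
  rewrite -rintD; [|by move=> t ht; apply: contM; [exact: cont_cst|exact: icont2]|exact: icont2].
  apply: eq_rint => t _; rewrite IHl; [|exact: (icont h1 s1 t).2|exact: (icont h2 s2 t).2].
  by ring.
- apply: rint_le; [exact: icont2|exact: icont2|] => t ht.
  rewrite ler_wpM2l ?exprn_ge0 ?sin_ge0_pi//; apply: IHm; [exact: (icont h1 s1 t).2|exact: (icont h2 s2 t).2|].
  by move=> w Hw; apply: H; exact: sph_slice.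
Qed.

Lemma sphere_intL n c h1 h2 : @scont n.+1 h1 -> scont h2 ->
  sphere_int (fun w => c * h1 w + h2 w) = c * sphere_int h1 + sphere_int h2.
Proof. exact: (sphere_int_props n).1. Qed.
Lemma sphere_int_le n h1 h2 : @scont n.+1 h1 -> scont h2 ->
  (forall w, sph w -> h1 w <= h2 w) -> sphere_int h1 <= sphere_int h2.
Proof. exact: (sphere_int_props n).2. Qed.
Lemma eq_sphere_int n (h1 h2 : 'rV[R]_n -> R) : (forall w, sph w -> h1 w = h2 w) ->
  sphere_int h1 = sphere_int h2.
Proof.
case: n h1 h2 => // n; elim: n => [|m IH] h1 h2 H.
  have S1 (x : R) : x ^+ 2 = 1 -> sph (const_mx x : 'rV[R]_1).
    by move=> hx; apply/sphE; rewrite big_ord1 mxE.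
  by congr (_ + _); apply: H; apply: S1; ring.
rewrite !sphere_intS; apply: eq_rint => t _; congr (_ * _); apply: IH => w Hw.
by apply: H; exact: sph_slice.
Qed.
Definition sarea n : R := @sphere_int R n (fun=> 1).

Lemma scont_cst n (c : R) : @scont n (fun=> c). Proof. by move=> w _; exact: cont_cst. Qed.
Lemma scontD n h1 h2 : @scont n h1 -> scont h2 -> scont (fun w => h1 w + h2 w).
Proof. by move=> s1 s2 w Hw; apply: contD; [exact: s1|exact: s2]. Qed.
Lemma scontM n h1 h2 : @scont n h1 -> scont h2 -> scont (fun w => h1 w * h2 w).
Proof. by move=> s1 s2 w Hw; apply: contM; [exact: s1|exact: s2]. Qed.
Lemma scontZ n c h : @scont n h -> scont (fun w => c * h w).
Proof. by move=> s1; apply: scontM => //; exact: scont_cst. Qed.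

Lemma sphere_int0 n : @sphere_int R n.+1 (fun=> 0) = 0.
Proof.
have E := sphere_intL (-1) (@scont_cst n.+1 0) (@scont_cst n.+1 0).
transitivity (@sphere_int R n.+1 (fun=> -1 * 0 + 0)).
  by apply: eq_sphere_int => w _; ring.
by rewrite E; ring.
Qed.
Lemma sphere_intZ n c h : @scont n.+1 h -> sphere_int (fun w => c * h w) = c * sphere_int h.
Proof.
move=> hs; have := sphere_intL c hs (@scont_cst n.+1 0); rewrite sphere_int0 addr0 => <-.
by apply: eq_sphere_int => w _; rewrite addr0.
Qed.
Lemma sphere_intD n h1 h2 : @scont n.+1 h1 -> scont h2 ->
  sphere_int (fun w => h1 w + h2 w) = sphere_int h1 + sphere_int h2.
Proof.
move=> s1 s2; have := sphere_intL 1 s1 s2; rewrite mul1r => <-.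
by apply: eq_sphere_int => w _; rewrite mul1r.
Qed.
Lemma sphere_int_cst n c : @sphere_int R n.+1 (fun=> c) = c * sarea n.+1.
Proof.
rewrite -sphere_intZ; last exact: scont_cst.
by apply: eq_sphere_int => w _; rewrite mulr1.
Qed.
Lemma sphere_int_bound n c h : @scont n.+1 h -> (forall w, sph w -> `|h w| <= c) ->
  `|sphere_int h| <= c * sarea n.+1.
Proof.
move=> hs H; rewrite ler_norml -mulNr -!sphere_int_cst; apply/andP; split;
  apply: sphere_int_le => //; try exact: scont_cst; by move=> w /H; rewrite ler_norml => /andP[].
Qed.
Lemma sphere_int_ge0 n h : @scont n.+1 h -> (forall w, sph w -> 0 <= h w) -> 0 <= sphere_int h.
Proof. by move=> hs H; rewrite -(sphere_int0 n); apply: sphere_int_le => //; exact: scont_cst. Qed.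
Lemma sarea_ge0 n : 0 <= sarea n.+1.
Proof. by apply: sphere_int_ge0 => // ; exact: scont_cst. Qed.

Lemma sphere_int_param (T : topologicalType) n (H : T -> 'rV[R]_n.+1 -> R) (t0 : T) :
  (forall w, sph w -> {for (t0, w), continuous (fun p => H p.1 p.2)}) ->
  (\forall t \near t0, scont (H t)) -> {for t0, continuous (fun t => sphere_int (H t))}.
Proof.
move=> hc hs; have hs0 : scont (H t0) := nbhs_singleton hs.
apply/cvgrPdistC_le => e e0.
have e2 : 0 < e / (1 + sarea n.+1) by rewrite divr_gt0// ltr_wpDr// sarea_ge0.
near=> t.
have st : scont (H t) by near: t.
have -> : sphere_int (H t) - sphere_int (H t0) =
    sphere_int (fun w => (-1) * H t0 w + H t w) by rewrite sphere_intL//; ring.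
apply: (@le_trans _ _ (e / (1 + sarea n.+1) * sarea n.+1)).
  apply: sphere_int_bound; first by apply: scontD => //; exact: scontZ.
  move=> w Hw; rewrite mulN1r addrC ltW//.
  by move: w Hw; near: t; exact: sph_tube.
rewrite mulrAC ler_pdivrMr ?ltr_wpDr ?sarea_ge0// ler_pM2l//.
by rewrite lerDr.
Unshelve. all: by end_near. Qed.

Lemma sin_lip (x y : R) : `|sin x - sin y| <= `|x - y|.
Proof.
wlog xy : x y / y <= x => [H|].
  by case: (leP y x) => [/H//|/ltW/H]; rewrite distrC [in X in _ <= X]distrC.
have [c _ ->] := @MVT_segment R sin cos y x xy (fun z _ => is_derive_sin z) (continuous_subspaceT (@continuous_sin R)).
by rewrite normrM ler_piMl// cos_max.
Qed.
Lemma cos_lip (x y : R) : `|cos x - cos y| <= `|x - y|.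
Proof. by rewrite -!sinDpihalf; apply: (le_trans (sin_lip _ _)); rewrite opprD addrACA subrr addr0. Qed.
Lemma sin_ge_lin (s : R) : 0 <= s <= 1 -> cos 1 * s <= sin s.
Proof.
move=> /andP[s0 s1].
have [c] := @MVT_segment R sin cos 0 s s0 (fun z _ => is_derive_sin z) (continuous_subspaceT (@continuous_sin R)).
rewrite in_itv/= sin0 !subr0 => /andP[c0 cs] ->; apply: ler_wpM2r => //.
have p2 := @pi_ge2 R.
rewrite leNgt ltr_cos ?in_itv/= -?leNgt ?c0/=.
- exact: le_trans s1.
- by apply/andP; split; lra.
- by lra.
Qed.
Lemma sin_ge_sym (d s : R) : 0 <= d -> d <= s -> s <= pi - d -> sin d <= sin s.
Proof.
move=> d0 ds sd; have p2 := @pi_ge2 R.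
have mono (u v : R) : 0 <= u -> u <= v -> v <= pi / 2 -> sin u <= sin v.
  move=> u0 uv v2; rewrite leNgt ltr_sin ?in_itv/= -?leNgt//; apply/andP; split; lra.
have [s2|s2] := leP s (pi / 2); first exact: mono.
have -> : sin s = sin (pi - s) by rewrite sinB sinpi cospi; ring.
by apply: mono => //; lra.
Qed.

Lemma sph_inhabited n : exists w : 'rV[R]_n.+1, sph w.
Proof.
exists (delta_mx 0 0); apply/sphE; rewrite (bigD1 ord0)//= mxE !eqxx expr1n big1 ?addr0//.
by move=> i /negbTE i0; rewrite mxE i0 expr0n.
Qed.

(** The angle is the arc cosine of the first coordinate; at the two poles [sin t] vanishes and any
    [w] will do. *)
Lemma sph_slice_ex m (th : 'rV[R]_m.+2) : sph th ->
  exists t w, [/\ 0 <= t, t <= pi, sph w & th = slice t (w : 'rV[R]_m.+1)].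
Proof.
move=> Hth; have /sphE := Hth; rewrite big_ord_recl => Hs.
have := sph_coord ord0 Hth; rewrite ler_norml => Ha.
set a := th ord0 ord0 in Hs Ha.
have t0 := acos_ge0 Ha; have tp := acos_lepi Ha.
set t := acos a; have ct : cos t = a by rewrite /t acosK// in_itv.
have st : sin t ^+ 2 = \sum_i th ord0 (lift ord0 i) ^+ 2.
  by rewrite sin2cos2 ct -Hs; ring.
exists t; have [s0|s0] := eqVneq (sin t) 0.
  have [w Hw] := sph_inhabited m; exists w; split => //.
  apply/rowP => i; case: (unliftP ord0 i) => [j ->|->]; last by rewrite slice0.
  rewrite sliceS s0 mul0r; apply/eqP; rewrite -sqrf_eq0; apply/eqP.
  move: st; rewrite s0 expr0n /= => /esym/eqP; rewrite psumr_eq0.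
    by move=> /allP/(_ j); rewrite mem_index_enum => /(_ isT)/eqP.
  by move=> k _; exact: sqr_ge0.
exists (\row_i (th ord0 (lift ord0 i) / sin t)); split => //.
  apply/sphE; under eq_bigr do rewrite mxE exprMn exprVn.
  by rewrite -mulr_suml -st divff// sqrf_eq0.
apply/rowP => i; case: (unliftP ord0 i) => [j ->|->]; last by rewrite slice0.
by rewrite sliceS mxE mulrC divfK.
Qed.

Lemma slice_scont m (h : 'rV[R]_m.+2 -> R) t : scont h -> scont (fun w => h (slice t w)).
Proof.
move=> hs w Hw; apply: (@cont_pair2 _ _ (fun s w => h (slice s w)) t w).
apply: (@continuous_comp _ _ _ (fun p => slice p.1 p.2) h); first exact: slice_cont.
by apply: hs; exact: sph_slice.
Qed.
Lemma slice_int_cts m (h : 'rV[R]_m.+2 -> R) a b : scont h ->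
  cts_on a b (fun t => sin t ^+ m * sphere_int (fun w => h (slice t w))).
Proof.
move=> hs t _; apply: contM; first by apply: contX; exact: continuous_sin.
apply: (@sphere_int_param _ _ (fun s w => h (slice s w))).
  move=> w Hw; apply: (@continuous_comp _ _ _ (fun p => slice p.1 p.2) h); first exact: slice_cont.
  by apply: hs; exact: sph_slice.
near=> s; exact: slice_scont.
Unshelve. all: by end_near. Qed.

Lemma sphere_int_cap n : exists (K : R) (e : nat), 0 < K /\
  forall (th : 'rV[R]_n.+1) d h c, sph th -> 0 < d -> d <= 1 -> scont h ->
  (forall w, sph w -> 0 <= h w) -> 0 <= c ->
  (forall w, sph w -> (forall i, `|w ord0 i - th ord0 i| <= d) -> c <= h w) ->
  c * K * d ^+ e <= sphere_int h.
Proof.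
elim: n => [|m [K [e [K0 IH]]]].
  exists 1, 0%N; split=> // th d h c Hth d0 d1 hs h0 c0 H; rewrite expr0 !mulr1 /=.
  have S1 (x : R) : x ^+ 2 = 1 -> sph (const_mx x : 'rV[R]_1).
    by move=> hx; apply/sphE; rewrite big_ord1 mxE.
  have h1 := h0 _ (S1 1 (expr1n _ _)).
  have h2 : 0 <= h (const_mx (-1)) by apply: h0; apply: S1; ring.
  have /sphE := Hth; rewrite big_ord1 => /eqP; rewrite sqrf_eq1 => /orP[] /eqP th1.
  - apply: (@le_trans _ _ (h (const_mx 1))); last by rewrite lerDl.
    by apply: H; [apply: S1; ring|move=> i; rewrite (_ : i = ord0) ?ord1// mxE th1 subrr normr0 ltW].
  - apply: (@le_trans _ _ (h (const_mx (-1)))); last by rewrite lerDr.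
    by apply: H; [apply: S1; ring|move=> i; rewrite (_ : i = ord0) ?ord1// mxE th1 subrr normr0 ltW].
have k0 := @cos1_gt0 R; set k := cos 1 in k0.
(* The factors come from the radius [d / 2] in the induction hypothesis, from
   [sin s >= cos 1 * (d / 4)] on the chosen angles, and from the length [d / 4] of their
   interval. *)
exists (K * 2^-1 ^+ e * (k / 4) ^+ m * 4^-1), (e + m + 1)%N; split.
  by rewrite !mulr_gt0// ?exprn_gt0// ?divr_gt0.
move=> th d h c Hth d0 d1 hs h0 c0 H.
have [t0 [w0 [t00 t0p Hw0 thE]]] := sph_slice_ex Hth.
have p2 := @pi_ge2 R.
set D := d / 2.
(* The interval lies on the side of [t0] towards [pi / 2], so it stays at distance [D / 2] from 0
   and [pi], where the weight [sin s ^+ m] can vanish. *)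
have [s1 [s2 [s10 s2p s12 Hs]]] : exists s1 s2, [/\ 0 <= s1, s2 <= pi, s2 - s1 = D / 2 &
    forall s, s1 <= s <= s2 -> `|s - t0| <= D /\ (D / 2 <= s <= pi - D / 2)].
  have [t2|t2] := leP t0 (pi / 2).
    exists (t0 + D / 2), (t0 + D); split; rewrite /D; try lra.
    by move=> s /andP[h1 h2]; split; [rewrite ler_norml; apply/andP; split; lra|apply/andP; split; lra].
  exists (t0 - D), (t0 - D / 2); split; rewrite /D; try lra.
  by move=> s /andP[h1 h2]; split; [rewrite ler_norml; apply/andP; split; lra|apply/andP; split; lra].
have s1s2 : s1 <= s2 by rewrite /D in s12; lra.
have d20 : 0 < d / 2 by lra.
have C0 : 0 <= c * K * (d / 2) ^+ e by rewrite !mulr_ge0 ?exprn_ge0// ltW.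
have lowI s : s1 <= s <= s2 -> c * K * (d / 2) ^+ e <= sphere_int (fun w => h (slice s w)).
  move=> /Hs[hs1 hs2]; apply: (IH w0) => //; [lra|exact: slice_scont| |].
    by move=> w Hw; apply: h0; exact: sph_slice.
  move=> w Hw Hd; apply: H; first exact: sph_slice.
  move=> i; rewrite thE; case: (unliftP ord0 i) => [j ->|->].
    rewrite !sliceS (_ : _ - _ = (sin s - sin t0) * w ord0 j + sin t0 * (w ord0 j - w0 ord0 j)); last by ring.
    apply: (le_trans (ler_normD _ _)); rewrite !normrM.
    (* Half of [d] pays for the change of angle and half for the change of [w]. *)
    have -> : d = D * 1 + 1 * (d / 2) by rewrite /D; field.
    apply: lerD; apply: ler_pM => //; [|exact: sph_coord|exact: sin_max].
    exact: le_trans (sin_lip _ _) hs1.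
  rewrite !slice0; apply: (le_trans (cos_lip _ _)); apply: (le_trans hs1).
  by rewrite /D; lra.
rewrite sphere_intS; set f := (fun t => _).
have cf a b : cts_on a b f by exact: slice_int_cts.
have f0 t : 0 <= t <= pi -> 0 <= f t.
  move=> ht; rewrite /f mulr_ge0// ?exprn_ge0 ?sin_ge0_pi//; apply: sphere_int_ge0; first exact: slice_scont.
  by move=> w Hw; apply: h0; exact: sph_slice.
rewrite (@rint_split _ 0 s1)//; last by lra.
rewrite (@rint_split _ s1 s2)//.
have r1 : 0 <= rint 0 s1 f by apply: rint_ge0 => t /andP[? ?]; apply: f0; apply/andP; split; lra.
have r2 : 0 <= rint s2 pi f by apply: rint_ge0 => t /andP[? ?]; apply: f0; apply/andP; split; lra.
apply: (@le_trans _ _ (rint s1 s2 f)); last by lra.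
have -> : c * (K * 2^-1 ^+ e * (k / 4) ^+ m * 4^-1) * d ^+ (e + m + 1) =
   ((k * (D / 2)) ^+ m * (c * K * (d / 2) ^+ e)) * (s2 - s1).
  have -> : k * (D / 2) = k / 4 * d by rewrite /D; field.
  by rewrite s12 /D [(k / 4 * d) ^+ m]exprMn [(d / 2) ^+ e]exprMn !exprD expr1; field.
rewrite -rint_cst//; apply: rint_le => //; first by move=> t _; exact: cont_cst.
move=> s hs'; have [h1 h2] := Hs _ hs'; rewrite /f.
apply: ler_pM => //; last exact: lowI.
  by rewrite exprn_ge0// mulr_ge0 ?ltW// /D; lra.
apply: lerXn2r; rewrite ?nnegrE.
- by rewrite mulr_ge0 ?ltW// /D; lra.
- by apply: sin_ge0_pi; move: h2 => /andP[]; rewrite /D => *; apply/andP; split; lra.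
- apply: le_trans (sin_ge_lin _) _; first by rewrite /D; lra.
  by move: h2 => /andP[]; rewrite /D => *; apply: sin_ge_sym => //; lra.
Qed.
End Sphere.


(** * Peaking kernels and complex-valued integrands *)

Lemma geo_small (R : realType) (x e : R) : 0 <= x -> x < 1 -> 0 < e ->
  exists N : nat, forall m, (N <= m)%N -> x ^+ m < e.
Proof.
move=> x0 x1 e0; have : x ^+ n @[n --> \oo] --> (0 : R) by apply: cvg_expr; rewrite ger0_norm.
move=> /cvgrPdist_lt /(_ _ e0) [N _ H]; exists N => m Nm.
by have := H m Nm; rewrite sub0r normrN; apply: le_lt_trans; exact: ler_norm.
Qed.

Section Peak.
Variable R : realType.

Definition sdot n (u v : 'rV[R]_n) : R := \sum_i u ord0 i * v ord0 i.

Lemma sdot_cont n (v w : 'rV[R]_n) : {for w, continuous (fun u => sdot u v)}.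
Proof.
apply: cont_sum => i; apply: contM; last exact: cont_cst.
exact: cont_coord.
Qed.
(** Expanding the square shows how the peaking kernel decays with the distance from its peak. *)
Lemma sdot_sph n (u v : 'rV[R]_n) : sph u -> sph v ->
  (1 + sdot u v) / 2 = 1 - (\sum_i (u ord0 i - v ord0 i) ^+ 2) / 4.
Proof.
move=> /sphE hu /sphE hv.
have -> : \sum_i (u ord0 i - v ord0 i) ^+ 2 =
    \sum_i u ord0 i ^+ 2 - 2 * sdot u v + \sum_i v ord0 i ^+ 2.
  rewrite /sdot mulr_sumr -sumrB -big_split /=; apply: eq_bigr => i _; ring.
by rewrite hu hv; field.
Qed.

Lemma rV_near n (w : 'rV[R]_n) (P : 'rV[R]_n -> Prop) : (\forall v \near w, P v) ->
  exists d : R, 0 < d /\ d <= 1 /\ forall v : 'rV[R]_n, (forall i, `|v ord0 i - w ord0 i| <= d) -> P v.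
Proof.
move=> /nbhs_ballP [e /= e0 H].
exists (Num.min 1 (e / 2)); split; first by rewrite lt_min ltr01 divr_gt0.
split=> [|v Hv]; first by rewrite ge_min lexx.
apply: H; split => // i j; rewrite ord1 /ball /= distrC.
by apply: (le_lt_trans (Hv j)); rewrite gt_min; apply/orP; right; rewrite ltr_pdivrMr// ltr_pMr// ltr1n.
Qed.

Lemma sph_max n (h : 'rV[R]_n.+1 -> R) : scont h ->
  exists2 th, sph th & forall w, sph w -> h w <= h th.
Proof.
move=> hs; have [w0 Hw0] := sph_inhabited R n.
have [|c Hc Hmax] := @compact_EVT_max _ R h (@sph R n.+1) (ex_intro _ _ Hw0) (@sph_compact R n.+1).
  by apply: continuous_in_subspaceT => w; rewrite inE => Hw; exact: hs.
by exists c; [rewrite inE in Hc|move=> w Hw; apply: Hmax; rewrite inE].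
Qed.

(* The powers of the kernel concentrate at [th], so a sign of [h th] would show in the integrals. *)
Lemma peak n (h : 'rV[R]_n.+1 -> R) (th : 'rV[R]_n.+1) : scont h -> sph th ->
  (forall N, sphere_int (fun w => h w * ((1 + sdot w th) / 2) ^+ N) = 0) -> h th = 0.
Proof.
move=> hs Hth H0.
suff key g : scont g -> (forall N, sphere_int (fun w => g w * ((1 + sdot w th) / 2) ^+ N) = 0) -> ~ 0 < g th.
  case: (ltgtP (h th) 0) => // [hn|hp]; last by case: (key h).
  case: (key (fun w => -1 * h w)).
  - exact: scontZ.
  - move=> N; rewrite -[RHS](mulr0 (-1)) -(H0 N) -sphere_intZ.
      by apply: eq_sphere_int => w _; rewrite mulrA.
    apply: scontM => // w Hw; apply: contX; apply: contM; last exact: cont_cst.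
    by apply: contD; [exact: cont_cst|exact: sdot_cont].
  - by rewrite mulN1r oppr_gt0.
move=> {}hs {}H0 gth.
have kc : scont (fun w => (1 + sdot w th) / 2).
  move=> w Hw; apply: contM; last exact: cont_cst.
  by apply: contD; [exact: cont_cst|exact: sdot_cont].
set k := (fun w => _) in kc.
have e0 : 0 < g th / 2 by rewrite divr_gt0.
set e := g th / 2 in e0.
have /cvgrPdistC_lt /(_ _ e0) /rV_near [d [d0 [d1 Hd]]] := hs _ Hth.
have gd (w : 'rV[R]_n.+1) : (forall i, `|w ord0 i - th ord0 i| <= d) -> e <= g w.
  move=> /Hd; rewrite ltr_norml => /andP[h1 _].
  by apply: ltW; move: h1; rewrite /e; lra.
have [B [B0 HB]] : exists B, 0 <= B /\ forall w, sph w -> `|g w| <= B.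
  have ga : scont (fun w => `|g w|).
    by move=> w Hw; apply: (@continuous_comp _ _ _ g (fun x => `|x|)); [exact: hs|exact: norm_continuous].
  by have [c Hc Hmax] := sph_max ga; exists `|g c|.
have kE w : sph w -> k w = 1 - (\sum_i (w ord0 i - th ord0 i) ^+ 2) / 4.
  by move=> Hw; rewrite /k sdot_sph.
have kpos w : sph w -> 0 <= k w.
  move=> Hw; rewrite /k divr_ge0//.
  have : 0 <= \sum_i (w ord0 i + th ord0 i) ^+ 2 by apply: sumr_ge0 => i _; exact: sqr_ge0.
  have -> : \sum_i (w ord0 i + th ord0 i) ^+ 2 =
      \sum_i w ord0 i ^+ 2 + 2 * sdot w th + \sum_i th ord0 i ^+ 2.
    rewrite /sdot mulr_sumr -!big_split /=; apply: eq_bigr => i _; ring.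
  have /sphE -> := Hth; have /sphE -> := Hw.
  by lra.
(* [q] bounds the kernel from above off the box of half-width [d], and [q'] bounds it from below on
   the box of half-width [d']; the contradiction will come from [q < q']. *)
set q := 1 - d ^+ 2 / 4; set q' := 1 - d ^+ 2 / 16.
have dd : d ^+ 2 <= 1 by rewrite expr_le1// ltW.
have dd0 : 0 < d ^+ 2 by rewrite exprn_gt0.
have q0 : 0 < q by rewrite /q; lra.
have qq : q < q' by rewrite /q /q'; lra.
have kout (w : 'rV[R]_n.+1) : sph w -> ~ (forall i, `|w ord0 i - th ord0 i| <= d) -> k w <= q.
  move=> Hw /existsNP [i /negP]; rewrite -ltNge => hi.
  rewrite kE// /q lerD2l lerN2 ler_wpM2r ?invr_ge0//.
  rewrite (bigD1 i)//=; apply: (@le_trans _ _ ((w ord0 i - th ord0 i) ^+ 2)).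
    by rewrite -[leRHS]real_normK ?num_real// lerXn2r ?nnegrE// ltW.
  by rewrite lerDl; apply: sumr_ge0 => j _; exact: sqr_ge0.
(* With this width the [n.+1] squared coordinates sum to at most [d ^+ 2 / 4], so the kernel is at
   least [q']. *)
set d' := d / (2 * n.+1%:R).
have n1 : (1 : R) <= n.+1%:R by rewrite ler1n.
have d'0 : 0 < d' by rewrite divr_gt0// mulr_gt0// ltr0n.
have d'd : d' <= d by rewrite ler_pdivrMr ?mulr_gt0 ?ltr0n// ler_pMr//; lra.
have kin (w : 'rV[R]_n.+1) : sph w -> (forall i, `|w ord0 i - th ord0 i| <= d') -> q' <= k w.
  move=> Hw Hi; rewrite kE// /q' lerD2l lerN2.
  have : \sum_i (w ord0 i - th ord0 i) ^+ 2 <= d ^+ 2 / 4.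
    apply: (@le_trans _ _ (\sum_(i < n.+1) d' ^+ 2)).
      apply: ler_sum => i _; rewrite -real_normK ?num_real// lerXn2r ?nnegrE//; first exact: ltW.
    rewrite sumr_const card_ord.
    have -> : d' ^+ 2 *+ n.+1 = d ^+ 2 / 4 / n.+1%:R.
      have aux (X x : R) : X != 0 -> X * (x / (2 * X)) ^+ 2 = x ^+ 2 / 4 / X by move=> X0; field.
      by rewrite -mulr_natl; apply: aux; rewrite pnatr_eq0.
    by rewrite ler_pdivrMr ?ltr0n// ler_pMr//; lra.
  by lra.
have [K [ex [K0 Hcap]]] := @sphere_int_cap R n.
(* Adding [B * q ^+ N] makes the integrand nonnegative on the whole sphere, and only this constant
   survives integration since the other term integrates to 0. The cap around [th] bounds the result
   from below at the rate [q']. *)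
have main N : e * q' ^+ N * K * d' ^+ ex <= B * q ^+ N * sarea R n.+1.
  have sk : scont (fun w => g w * k w ^+ N) by apply: scontM => // w Hw; apply: contX; exact: kc.
  have -> : B * q ^+ N * sarea R n.+1 = sphere_int (fun w => g w * k w ^+ N + B * q ^+ N).
    by rewrite sphere_intD// ?H0 ?add0r ?sphere_int_cst//; exact: scont_cst.
  have gk (w : 'rV[R]_n.+1) : sph w -> (forall i, `|w ord0 i - th ord0 i| <= d) -> 0 <= g w * k w ^+ N.
    by move=> Hw /gd hw; rewrite mulr_ge0 ?exprn_ge0 ?kpos//; apply: le_trans hw; exact: ltW.
  have Bq : 0 <= B * q ^+ N by rewrite mulr_ge0// exprn_ge0// ltW.
  apply: (Hcap th) => //.
  - by lra.
  - by apply: scontD => //; exact: scont_cst.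
  - move=> w Hw; have [hd|hd] := pselect (forall i, `|w ord0 i - th ord0 i| <= d).
      by rewrite addr_ge0// gk.
    have h1 := kout w Hw hd.
    have : `|g w * k w ^+ N| <= B * q ^+ N.
      rewrite normrM [`|k w ^+ N|]ger0_norm ?exprn_ge0 ?kpos//.
      by apply: ler_pM; rewrite ?exprn_ge0 ?kpos ?HB ?lerXn2r ?nnegrE ?kpos ?(ltW q0).
    by rewrite ler_norml => /andP[]; lra.
  - by rewrite mulr_ge0 ?exprn_ge0// ltW// (lt_trans q0).
  - move=> w Hw Hi; apply: (@le_trans _ _ (g w * k w ^+ N)); last by rewrite lerDl.
    apply: ler_pM; [exact: ltW|by rewrite exprn_ge0// ltW// (lt_trans q0)| |].
      by apply: gd => i; apply: le_trans d'd.
    by apply: lerXn2r; rewrite ?nnegrE ?kpos ?kin// ltW// (lt_trans q0).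
have q'0 : 0 < q' by exact: lt_trans qq.
set c0 := e * K * d' ^+ ex; set c1 := B * sarea R n.+1.
have c00 : 0 < c0 by rewrite !mulr_gt0// exprn_gt0.
have c10 : 0 <= c1 by rewrite mulr_ge0// sarea_ge0.
have [|||N HN] := @geo_small R (q / q') (c0 / (1 + c1)).
- by rewrite divr_ge0// ltW.
- by rewrite ltr_pdivrMr// mul1r.
- by rewrite divr_gt0// ltr_wpDr.
have := HN N (leqnn N); rewrite expr_div_n ltr_pdivrMr ?exprn_gt0// mulrAC ltr_pdivlMr ?ltr_wpDr//.
have := main N; rewrite (_ : _ * d' ^+ ex = c0 * q' ^+ N) 1?(_ : B * _ * _ = c1 * q ^+ N); [|by rewrite /c1; ring|by rewrite /c0; ring].
have := exprn_gt0 N q0; move=> h1 h2 h3.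
have : q ^+ N * (1 + c1) <= c1 * q ^+ N by exact: le_trans (ltW h3) h2.
by nra.
Qed.
End Peak.

Section ComplexIntegral.
Variable R : realType.

Definition sccts n (h : 'rV[R]_n -> R[i]) := forall w, sph w -> ccts h w.
Implicit Types c : R[i].

Lemma sccts_Re n (h : 'rV[R]_n -> R[i]) : sccts h -> scont (fun w => complex.Re (h w)).
Proof. by move=> hs w /hs[]. Qed.
Lemma sccts_Im n (h : 'rV[R]_n -> R[i]) : sccts h -> scont (fun w => complex.Im (h w)).
Proof. by move=> hs w /hs[]. Qed.
Lemma sccts_cst n c : sccts (fun _ : 'rV[R]_n => c). Proof. by move=> w _; exact: ccts_cst. Qed.
Lemma scctsD n (h1 h2 : 'rV[R]_n -> R[i]) : sccts h1 -> sccts h2 -> sccts (fun w => h1 w + h2 w).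
Proof. by move=> s1 s2 w Hw; apply: cctsD; [exact: s1|exact: s2]. Qed.
Lemma scctsM n (h1 h2 : 'rV[R]_n -> R[i]) : sccts h1 -> sccts h2 -> sccts (fun w => h1 w * h2 w).
Proof. by move=> s1 s2 w Hw; apply: cctsM; [exact: s1|exact: s2]. Qed.
Lemma scctsN n (h : 'rV[R]_n -> R[i]) : sccts h -> sccts (fun w => - h w).
Proof. by move=> s1 w Hw; apply: cctsN; exact: s1. Qed.
Lemma scctsJ n (h : 'rV[R]_n -> R[i]) : sccts h -> sccts (fun w => (h w)^*).
Proof. by move=> s1 w Hw; apply: cctsJ; exact: s1. Qed.
Lemma scctsZ n c (h : 'rV[R]_n -> R[i]) : sccts h -> sccts (fun w => c * h w).
Proof. by move=> s1; apply: scctsM => //; exact: sccts_cst. Qed.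
Lemma sccts_sum n (I : Type) (r : seq I) (F : I -> 'rV[R]_n -> R[i]) :
  (forall i, sccts (F i)) -> sccts (fun w => \sum_(i <- r) F i w).
Proof. by move=> H w Hw; apply: ccts_sum => i; exact: H. Qed.

Lemma eq_sphere_intC n (h1 h2 : 'rV[R]_n -> R[i]) : (forall w, sph w -> h1 w = h2 w) ->
  sphere_intC h1 = sphere_intC h2.
Proof. by move=> H; congr Complex; apply: eq_sphere_int => w /H ->. Qed.
Lemma sphere_intCD n (h1 h2 : 'rV[R]_n.+1 -> R[i]) : sccts h1 -> sccts h2 ->
  sphere_intC (fun w => h1 w + h2 w) = sphere_intC h1 + sphere_intC h2.
Proof.
move=> s1 s2; apply: ceqP; rewrite ?cReD ?cImD /=.
- rewrite -sphere_intD; try exact: sccts_Re.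
  by apply: eq_sphere_int => w _; rewrite cReD.
- rewrite -sphere_intD; try exact: sccts_Im.
  by apply: eq_sphere_int => w _; rewrite cImD.
Qed.
Lemma sphere_intCZ n c (h : 'rV[R]_n.+1 -> R[i]) : sccts h ->
  sphere_intC (fun w => c * h w) = c * sphere_intC h.
Proof.
move=> s1; have r := sccts_Re s1; have i := sccts_Im s1.
apply: ceqP; rewrite ?cReM ?cImM /=.
- rewrite -mulNr -!sphere_intZ// -sphere_intD; try exact: scontZ.
  by apply: eq_sphere_int => w _; rewrite cReM mulNr.
- rewrite -!sphere_intZ// -sphere_intD; try exact: scontZ.
  by apply: eq_sphere_int => w _; rewrite cImM.
Qed.
Lemma sphere_intCB n (h1 h2 : 'rV[R]_n.+1 -> R[i]) : sccts h1 -> sccts h2 ->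
  sphere_intC (fun w => h1 w - h2 w) = sphere_intC h1 - sphere_intC h2.
Proof.
move=> s1 s2; rewrite -mulN1r -(sphere_intCZ (-1) s2) -(sphere_intCD s1 (scctsZ (-1) s2)).
by apply: eq_sphere_intC => w _; rewrite mulN1r.
Qed.
Lemma sphere_intC0 n : sphere_intC (fun _ : 'rV[R]_n.+1 => 0) = 0.
Proof. by apply: ceqP; exact: sphere_int0. Qed.
Lemma sphere_intC_sum n (I : Type) (r : seq I) (F : I -> 'rV[R]_n.+1 -> R[i]) :
  (forall i, sccts (F i)) ->
  sphere_intC (fun w => \sum_(i <- r) F i w) = \sum_(i <- r) sphere_intC (F i).
Proof.
move=> H; elim: r => [|i r IH].
  rewrite big_nil -[RHS](sphere_intC0 n); apply: eq_sphere_intC => w _; exact: big_nil.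
rewrite big_cons -IH -sphere_intCD//; last exact: sccts_sum.
by apply: eq_sphere_intC => w _; rewrite big_cons.
Qed.
Lemma sphere_intC_real n (h : 'rV[R]_n.+1 -> R) :
  sphere_intC (fun w => (h w)%:C) = (sphere_int h)%:C.
Proof. by apply: ceqP => //=; exact: sphere_int0. Qed.
(** With [z] the integral, [cabs z ^+ 2] is the real part of the integral of [z^* * h], which
    reduces the bound to a real integrand. *)
Lemma sphere_intC_abs n (h : 'rV[R]_n.+1 -> R[i]) (g : 'rV[R]_n.+1 -> R) :
  sccts h -> scont g -> (forall w, sph w -> cabs (h w) <= g w) ->
  cabs (sphere_intC h) <= sphere_int g.
Proof.
move=> hs gs H; set z := sphere_intC h.
have [z0|z0] := eqVneq z 0.
  rewrite z0 cabs0; apply: sphere_int_ge0 => // w Hw.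
  by apply: le_trans (H w Hw); exact: cabs_ge0.
have zp : 0 < cabs z by rewrite cabs_gt0.
rewrite -(ler_pM2l zp) -expr2.
have -> : cabs z ^+ 2 = complex.Re (z^* * sphere_intC h) by rewrite -/z mulrC mulcJE.
rewrite -sphere_intCZ// -sphere_intZ//=; apply: sphere_int_le.
- by apply: sccts_Re; exact: scctsZ.
- exact: scontZ.
- move=> w Hw; apply: (le_trans (ler_norm _)); apply: (le_trans (Re_le_cabs _)).
  by rewrite cabsM cabsJ ler_pM2l// H.
Qed.
Lemma sphere_intC_bound n (h : 'rV[R]_n.+1 -> R[i]) (M : R) : sccts h ->
  (forall w, sph w -> cabs (h w) <= M) -> cabs (sphere_intC h) <= M * sarea R n.+1.
Proof.
by move=> hs H; rewrite -sphere_int_cst; apply: sphere_intC_abs => //; exact: scont_cst.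
Qed.

Lemma sphere_intC_param (T : topologicalType) n (H : T -> 'rV[R]_n.+1 -> R[i]) (t0 : T) :
  (\forall t \near t0, forall w, sph w -> ccts (fun p => H p.1 p.2) (t, w)) ->
  ccts (fun t => sphere_intC (H t)) t0.
Proof.
move=> hc; have hc0 := nbhs_singleton hc; split => /=.
- apply: (@sphere_int_param _ _ _ (fun t w => complex.Re (H t w))).
    by move=> w /hc0 [].
  apply: filterS hc => t Ht w /Ht [h _].
  exact: (@cont_pair2 _ _ _ (fun t w => complex.Re (H t w)) t w h).
- apply: (@sphere_int_param _ _ _ (fun t w => complex.Im (H t w))).
    by move=> w /hc0 [].
  apply: filterS hc => t Ht w /Ht [_ h].
  exact: (@cont_pair2 _ _ _ (fun t w => complex.Im (H t w)) t w h).
Qed.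

Definition nrm n (w : 'rV[R]_n) : 'rV[R]_n := (enorm w)^-1 *: w.
Lemma nrm_sph n (w : 'rV[R]_n) : sph w -> nrm w = w.
Proof. by rewrite /nrm /sph /= => ->; rewrite invr1 scale1r. Qed.
Lemma enorm_cont n (w : 'rV[R]_n) : {for w, continuous (@enorm R n)}.
Proof.
apply: (@continuous_comp _ _ _ (fun w : 'rV[R]_n => \sum_i w ord0 i ^+ 2) (fun x => Num.sqrt x)).
  by apply: cont_sum => i; apply: contX; exact: cont_coord.
exact: sqrt_continuous.
Qed.
Lemma sph_nrm n (w : 'rV[R]_n) : enorm w != 0 -> sph (nrm w).
Proof.
move=> w0; apply/sphE; under eq_bigr do rewrite mxE exprMn.
by rewrite -mulr_sumr -enorm_sq exprVn mulVf// sqrf_eq0.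
Qed.
Lemma nrm_cont n (w : 'rV[R]_n) : sph w -> {for w, continuous (@nrm n)}.
Proof.
move=> Hw; apply: cvg_rV => i.
rewrite (_ : (fun s => _) = (fun s => (enorm s)^-1 * s ord0 i)); last by apply/funext => s; rewrite mxE.
apply: contM; last exact: cont_coord.
apply: (@continuousV R _ (@enorm R n)); last exact: enorm_cont.
by move: Hw; rewrite /sph /= => ->; exact: oner_neq0.
Qed.
Lemma sccts_nrm n (h : 'rV[R]_n -> R[i]) : sccts h -> sccts (h \o @nrm n).
Proof.
move=> hs w Hw; apply: (@ccts_comp R _ _ (@nrm n) h); first exact: nrm_cont.
by rewrite nrm_sph//; exact: hs.
Qed.
Lemma near_sph n (w : 'rV[R]_n) : sph w -> \forall v \near w, sph (nrm v).
Proof.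
move=> Hw; have h2 : 0 < (2 : R)^-1 by [].
have /cvgrPdistC_lt /(_ _ h2) := @enorm_cont n w.
apply: filterS => v; move: Hw; rewrite /sph /= => ->; rewrite ltr_norml => /andP[h _].
by apply: sph_nrm; rewrite gt_eqF//; move: h; lra.
Qed.

(* Summability is only assumed on the sphere, so the sum is made continuous near
   the sphere by precomposition with the radial projection. *)
Lemma sccts_gsum n (u : nat -> 'rV[R]_n -> R[i]) (M x : R) : 0 <= x -> x < 1 ->
  (forall j, sccts (u j)) -> (forall j w, sph w -> cabs (u j w) <= M * x ^+ j) ->
  sccts (fun w => gsum (fun j => u j (nrm w))).
Proof.
move=> x0 x1 us ub w Hw.
apply: ccts_unif => e e0.
have M0 : 0 <= M by have := ub 0 w Hw; rewrite expr0 mulr1; apply: le_trans; exact: cabs_ge0.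
have d0 : 0 < e * (1 - x) / (1 + M) by rewrite divr_gt0 ?mulr_gt0 ?subr_gt0// ltr_wpDr.
have [N HN] := geo_small x0 x1 d0.
exists (fun w => \sum_(j < N) u j (nrm w)); split.
  by apply: ccts_sum => j; apply: sccts_nrm.
apply: filterS (near_sph Hw) => v Hv.
apply: (le_trans (gsumP N x0 x1 (fun j => ub j _ Hv))).
have := HN N (leqnn N); rewrite ltr_pdivlMr ?ltr_wpDr// => h.
rewrite ler_pdivrMr ?subr_gt0//; apply: ltW; apply: le_lt_trans h.
by rewrite mulrC ler_wpM2l ?exprn_ge0// lerDr.
Qed.

Lemma sphere_intC_gsum n (u : nat -> 'rV[R]_n.+1 -> R[i]) (M x : R) : 0 <= x -> x < 1 ->
  (forall j, sccts (u j)) -> (forall j w, sph w -> cabs (u j w) <= M * x ^+ j) ->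
  sphere_intC (fun w => gsum (fun j => u j w)) = gsum (fun j => sphere_intC (u j)).
Proof.
move=> x0 x1 us ub.
have gs := sccts_gsum x0 x1 us ub.
have -> : sphere_intC (fun w => gsum (fun j => u j w)) = sphere_intC (fun w => gsum (fun j => u j (nrm w))).
  by apply: eq_sphere_intC => w Hw; apply: gsum_eq => j; rewrite nrm_sph.
apply: (@gsum_unique _ _ (M * sarea R n.+1) x) => //.
  by move=> j; rewrite mulrAC; apply: sphere_intC_bound => // w Hw; exact: ub.
move=> e e0.
have [w0 Hw0] := sph_inhabited R n.
have M0 : 0 <= M by have := ub 0 w0 Hw0; rewrite expr0 mulr1; apply: le_trans; exact: cabs_ge0.
have A0 := sarea_ge0 R n.
have M1 : 0 <= M * sarea R n.+1 by rewrite mulr_ge0.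
have d0 : 0 < e * (1 - x) / (1 + M * sarea R n.+1).
  by rewrite divr_gt0 ?mulr_gt0 ?subr_gt0// ltr_wpDr.
have [N HN] := geo_small x0 x1 d0.
exists N => m Nm.
have su : sccts (fun w => \sum_(j < m) u j w) by apply: sccts_sum => j; exact: us.
have -> : \sum_(j < m) sphere_intC (u j) = sphere_intC (fun w => \sum_(j < m) u j w).
  by rewrite (@sphere_intC_sum _ _ _ (fun (j : 'I_m) => u j))// => j; exact: us.
rewrite -(sphere_intCB gs su).
apply: (@le_trans _ _ (M * x ^+ m / (1 - x) * sarea R n.+1)).
  apply: (sphere_intC_bound (scctsD gs (scctsN su))) => w Hw; rewrite nrm_sph//; apply: gsumP => // j; exact: ub.
have := HN m Nm; rewrite ltr_pdivlMr ?ltr_wpDr// => h.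
rewrite mulrAC ler_pdivrMr ?subr_gt0//; apply: ltW; apply: le_lt_trans h.
by rewrite mulrAC mulrC ler_wpM2l ?exprn_ge0// lerDr.
Qed.
End ComplexIntegral.


(** * Goursat's lemma *)

Section Goursat.
Variable R : realType.
Implicit Types (a b c d x y : R).

Lemma dist2 (A B F u v w E : R) : `|A - F - u| <= E -> `|B - F - v| <= E -> w = u - v -> `|A - B - w| <= 2 * E.
Proof. by rewrite !ler_norml => /andP[? ?] /andP[? ?] ->; apply/andP; split; lra. Qed.

Lemma rint_dist a b (f : R -> R) k E : a <= b -> cts_on a b f ->
  (forall t, a <= t <= b -> `|f t - k| <= E) ->
  `|rint a b f - k * (b - a)| <= E * (b - a).
Proof.
move=> ab cf H.
have cc (x : R) : cts_on a b (fun=> x) by move=> t _; exact: cont_cst.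
rewrite ler_norml lerBlDr lerBrDr -mulNr -!mulrDl -!rint_cst//; apply/andP; split;
  by apply: rint_le => // t /H; rewrite ler_norml => /andP[]; lra.
Qed.

(** The shared [p2] says that the [y]-derivative of [P] equals the [x]-derivative of [Q]: the form
    [P dx + Q dy] is differentiable at the point and closed there. *)
Definition gdiff (P Q : R -> R -> R) x0 y0 := exists p1 p2 q2 : R,
  forall e, 0 < e -> exists2 r, 0 < r & forall x y, `|x - x0| <= r -> `|y - y0| <= r ->
   `|P x y - P x0 y0 - (p1 * (x - x0) + p2 * (y - y0))| <= e * (`|x - x0| + `|y - y0|) /\
   `|Q x y - Q x0 y0 - (p2 * (x - x0) + q2 * (y - y0))| <= e * (`|x - x0| + `|y - y0|).

Lemma lip_cont (f : R -> R) x0 r L : 0 < r ->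
  (forall x, `|x - x0| <= r -> `|f x - f x0| <= L * `|x - x0|) -> {for x0, continuous f}.
Proof.
move=> r0 H; apply/cvgrPdistC_lt => e e0.
have L0 : 0 < 1 + `|L| by rewrite ltr_wpDr.
have m0 : 0 < Num.min r (e / (1 + `|L|)) by rewrite lt_min r0 divr_gt0.
have := @nbhsx_ballx _ _ x0 _ m0; apply: filterS => x; rewrite /ball /= distrC lt_min => /andP[h1 h2].
apply: (le_lt_trans (H x (ltW h1))); apply: (@le_lt_trans _ _ ((1 + `|L|) * `|x - x0|)).
  by rewrite ler_wpM2r// (le_trans (ler_norm _))// lerDr.
by rewrite mulrC -ltr_pdivlMr.
Qed.

Lemma gdiff_cts P Q x0 y0 : gdiff P Q x0 y0 ->
  {for x0, continuous (fun x => P x y0)} /\ {for y0, continuous (fun y => Q x0 y)}.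
Proof.
move=> [p1 [p2 [q2 /(_ 1 ltr01) [r r0 H]]]]; split.
- apply: (@lip_cont _ _ r (`|p1| + 1)) => // x hx.
  have [] := H x y0 hx; first by rewrite subrr normr0 ltW.
  rewrite subrr !mulr0 !addr0 normr0 addr0 mul1r => h _.
  rewrite (_ : _ - _ = (P x y0 - P x0 y0 - p1 * (x - x0)) + p1 * (x - x0)); last by ring.
  by apply: (le_trans (ler_normD _ _)); rewrite normrM mulrDl mul1r addrC lerD2l.
- apply: (@lip_cont _ _ r (`|q2| + 1)) => // y hy.
  have [] := H x0 y _ hy; first by rewrite subrr normr0 ltW.
  rewrite subrr !mulr0 !add0r normr0 add0r mul1r => _ h.
  rewrite (_ : _ - _ = (Q x0 y - Q x0 y0 - q2 * (y - y0)) + q2 * (y - y0)); last by ring.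
  by apply: (le_trans (ler_normD _ _)); rewrite normrM mulrDl mul1r addrC lerD2l.
Qed.

(** The counterclockwise circulation of [P dx + Q dy] around the rectangle with lower left corner
    [(a, c)] and sides [h], [v]. *)
Definition bdry (P Q : R -> R -> R) a h c v : R :=
  rint a (a + h) (fun x => P x c) - rint a (a + h) (fun x => P x (c + v)) +
  rint c (c + v) (Q (a + h)) - rint c (c + v) (Q a).

Section Bisect.
Variables (P Q : R -> R -> R) (a0 h0 c0 v0 : R).
Hypothesis h00 : 0 <= h0.
Hypothesis v00 : 0 <= v0.
Hypothesis PQ : forall x y, a0 <= x <= a0 + h0 -> c0 <= y <= c0 + v0 -> gdiff P Q x y.

Definition inside a h c v := [/\ a0 <= a, 0 <= h, a + h <= a0 + h0, c0 <= c & 0 <= v /\ c + v <= c0 + v0].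

Lemma inside_P a h c v y : inside a h c v -> c <= y <= c + v -> cts_on a (a + h) (fun x => P x y).
Proof.
move=> [? ? ? ? [? ?]] /andP[? ?] t /andP[? ?].
by have [] := gdiff_cts (@PQ t y _ _) => //; apply/andP; split; lra.
Qed.
Lemma inside_Q a h c v x : inside a h c v -> a <= x <= a + h -> cts_on c (c + v) (Q x).
Proof.
move=> [? ? ? ? [? ?]] /andP[? ?] t /andP[? ?].
by have [] := gdiff_cts (@PQ x t _ _) => //; apply/andP; split; lra.
Qed.

Lemma bdry_splitx a h c v : inside a h c v ->
  bdry P Q a h c v = bdry P Q a (h / 2) c v + bdry P Q (a + h / 2) (h / 2) c v.
Proof.
move=> H; have [? ? ? ? [? ?]] := H.
have E : a + h / 2 + h / 2 = a + h by field.
rewrite /bdry E (@rint_split _ a (a + h / 2) (a + h) (fun x => P x c)); [|lra|lra|].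
  rewrite (@rint_split _ a (a + h / 2) (a + h) (fun x => P x (c + v))); [|lra|lra|]; first by ring.
  by apply: inside_P H _; apply/andP; split; lra.
by apply: inside_P H _; apply/andP; split; lra.
Qed.
Lemma bdry_splity a h c v : inside a h c v ->
  bdry P Q a h c v = bdry P Q a h c (v / 2) + bdry P Q a h (c + v / 2) (v / 2).
Proof.
move=> H; have [? ? ? ? [? ?]] := H.
have E : c + v / 2 + v / 2 = c + v by field.
rewrite /bdry E (@rint_split _ c (c + v / 2) (c + v) (Q a)); [|lra|lra|].
  rewrite (@rint_split _ c (c + v / 2) (c + v) (Q (a + h))); [|lra|lra|]; first by ring.
  by apply: inside_Q H _; apply/andP; split; lra.
by apply: inside_Q H _; apply/andP; split; lra.
Qed.

Let hk k := h0 / 2 ^+ k.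
Let vk k := v0 / 2 ^+ k.

(** Inner sides cancel, so the circulation is the sum of those of the four quarters, and one of them
    carries at least a quarter of it. *)
Lemma bisect_step a c k : inside a (hk k) c (vk k) -> exists a' c',
  [/\ a <= a', a' + hk k.+1 <= a + hk k, c <= c', c' + vk k.+1 <= c + vk k &
   inside a' (hk k.+1) c' (vk k.+1) /\
   `|bdry P Q a (hk k) c (vk k)| <= 4 * `|bdry P Q a' (hk k.+1) c' (vk k.+1)|].
Proof.
move=> H; have [i1 i2 i3 i4 [i5 i6]] := H.
have Eh : hk k.+1 = hk k / 2 by rewrite /hk exprS invfM; ring.
have Ev : vk k.+1 = vk k / 2 by rewrite /vk exprS invfM; ring.
rewrite Eh Ev.
have split2 (x y : R) : `|x + y| <= 2 * `|x| \/ `|x + y| <= 2 * `|y|.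
  have := ler_normD x y; have [h|h] := leP `|x| `|y|; [right|left]; lra.
have S1 : inside a (hk k / 2) c (vk k) by split; [lra|lra|lra|lra|split; lra].
have S2 : inside (a + hk k / 2) (hk k / 2) c (vk k) by split; [lra|lra|lra|lra|split; lra].
rewrite (bdry_splitx H).
have [h1|h1] := split2 (bdry P Q a (hk k / 2) c (vk k)) (bdry P Q (a + hk k / 2) (hk k / 2) c (vk k)).
- rewrite [in X in _ <= 2 * X](bdry_splity S1) in h1.
  have [h2|h2] := split2 (bdry P Q a (hk k / 2) c (vk k / 2)) (bdry P Q a (hk k / 2) (c + vk k / 2) (vk k / 2)).
  + by exists a, c; split; last (by split; [clear h1 h2; split; [lra|lra|lra|lra|split; lra]|lra]); clear h1 h2; lra.
  + by exists a, (c + vk k / 2); split; last (by split; [clear h1 h2; split; [lra|lra|lra|lra|split; lra]|lra]); clear h1 h2; lra.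
- rewrite [in X in _ <= 2 * X](bdry_splity S2) in h1.
  have [h2|h2] := split2 (bdry P Q (a + hk k / 2) (hk k / 2) c (vk k / 2)) (bdry P Q (a + hk k / 2) (hk k / 2) (c + vk k / 2) (vk k / 2)).
  + by exists (a + hk k / 2), c; split; last (by split; [clear h1 h2; split; [lra|lra|lra|lra|split; lra]|lra]); clear h1 h2; lra.
  + by exists (a + hk k / 2), (c + vk k / 2); split; last (by split; [clear h1 h2; split; [lra|lra|lra|lra|split; lra]|lra]); clear h1 h2; lra.
Qed.

(** Differences of opposite sides are compared with the affine approximation, whose contributions
    [- p2 * v * h] and [p2 * h * v] cancel because the form is closed; only the remainder is
    left. *)
Lemma bdry_small a h c v x0 y0 p1 p2 q2 e r : inside a h c v ->
  a <= x0 <= a + h -> c <= y0 <= c + v -> h <= r -> v <= r -> 0 < e ->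
  (forall x y, `|x - x0| <= r -> `|y - y0| <= r ->
   `|P x y - P x0 y0 - (p1 * (x - x0) + p2 * (y - y0))| <= e * (`|x - x0| + `|y - y0|) /\
   `|Q x y - Q x0 y0 - (p2 * (x - x0) + q2 * (y - y0))| <= e * (`|x - x0| + `|y - y0|)) ->
  `|bdry P Q a h c v| <= 2 * e * (h + v) ^+ 2.
Proof.
move=> H /andP[x1 x2] /andP[y1 y2] hr vr e0 K.
have [i1 i2 i3 i4 [i5 i6]] := H.
have dist x y : a <= x <= a + h -> c <= y <= c + v ->
   `|P x y - P x0 y0 - (p1 * (x - x0) + p2 * (y - y0))| <= e * (h + v) /\
   `|Q x y - Q x0 y0 - (p2 * (x - x0) + q2 * (y - y0))| <= e * (h + v).
  move=> /andP[? ?] /andP[? ?].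
  have dx : `|x - x0| <= h by rewrite ler_norml; apply/andP; split; lra.
  have dy : `|y - y0| <= v by rewrite ler_norml; apply/andP; split; lra.
  have [k1 k2] := K x y (le_trans dx hr) (le_trans dy vr).
  by split; [apply: (le_trans k1)|apply: (le_trans k2)]; rewrite ler_pM2l// lerD.
have cP y : c <= y <= c + v -> cts_on a (a + h) (fun x => P x y) := fun Hy => inside_P H Hy.
have cQ x : a <= x <= a + h -> cts_on c (c + v) (Q x) := fun Hx => inside_Q H Hx.
have c1 : c <= c <= c + v by rewrite lexx lerDl.
have c2 : c <= c + v <= c + v by rewrite lexx lerDl i5.
have a1 : a <= a <= a + h by rewrite lexx lerDl.
have a2 : a <= a + h <= a + h by rewrite lexx lerDl i2.
have -> : bdry P Q a h c v = rint a (a + h) (fun x => P x c - P x (c + v)) +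
    rint c (c + v) (fun y => Q (a + h) y - Q a y).
  by rewrite /bdry !rintB//; [ring|exact: cQ|exact: cQ|exact: cP|exact: cP].
have := @rint_dist a (a + h) (fun x => P x c - P x (c + v)) (- (p2 * v)) (2 * (e * (h + v))).
have -> : a + h - a = h by ring.
move=> /(_ _ _ _)/wrap[]; first by rewrite lerDl.
  by move=> t Ht; apply: (@cvgB _ _ _ _ _ (fun x => P x c) (fun x => P x (c + v))); [exact: (cP c)|exact: (cP (c + v))].
  move=> t Ht; have [k1 _] := dist t c Ht c1; have [k2 _] := dist t (c + v) Ht c2.
  by rewrite /=; apply: (dist2 k1 k2); ring.
move=> B1.
have := @rint_dist c (c + v) (fun y => Q (a + h) y - Q a y) (p2 * h) (2 * (e * (h + v))).
have -> : c + v - c = v by ring.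
move=> /(_ _ _ _)/wrap[]; first by rewrite lerDl.
  by move=> t Ht; apply: (@cvgB _ _ _ _ _ (Q (a + h)) (Q a)); [exact: (cQ (a + h))|exact: (cQ a)].
  move=> t Ht; have [_ k1] := dist a t a1 Ht; have [_ k2] := dist (a + h) t a2 Ht.
  by rewrite /=; apply: (dist2 k2 k1); ring.
move=> B2.
move: B1 B2; set I1 := rint _ _ _; set I2 := rint _ _ _ => B1 B2.
rewrite (_ : I1 + I2 = (I1 - - (p2 * v) * h) + (I2 - p2 * h * v)); last by ring.
apply: (le_trans (ler_normD _ _)); apply: (le_trans (lerD B1 B2)).
by rewrite le_eqVlt; apply/orP; left; apply/eqP; ring.
Qed.

(** Goursat's bisection: nested quarters shrink to a point, where [bdry_small] bounds the
    circulation by an arbitrarily small multiple of the squared size. *)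
Lemma goursat_rect : bdry P Q a0 h0 c0 v0 = 0.
Proof.
have choice k (p : R * R) : exists p' : R * R, inside p.1 (hk k) p.2 (vk k) ->
  [/\ p.1 <= p'.1, p'.1 + hk k.+1 <= p.1 + hk k, p.2 <= p'.2, p'.2 + vk k.+1 <= p.2 + vk k &
   inside p'.1 (hk k.+1) p'.2 (vk k.+1) /\
   `|bdry P Q p.1 (hk k) p.2 (vk k)| <= 4 * `|bdry P Q p'.1 (hk k.+1) p'.2 (vk k.+1)|].
  have [H|H] := pselect (inside p.1 (hk k) p.2 (vk k)).
    by have [a' [c' K]] := bisect_step H; exists (a', c').
  by exists p => /H.
pose nxt k p := sval (cid (choice k p)).
(* Lower left corners of the nested quarters, by dependent choice. *)
pose fix s k := if k is k'.+1 then nxt k' (s k') else (a0, c0).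
have hk0 : hk 0 = h0 by rewrite /hk expr0 divr1.
have vk0 : vk 0 = v0 by rewrite /vk expr0 divr1.
have ins k : inside (s k).1 (hk k) (s k).2 (vk k).
  elim: k => [|k IH]; first by rewrite hk0 vk0.
  by have [_ _ _ _ []] := svalP (cid (choice k (s k))) IH.
have step k := svalP (cid (choice k (s k))) (ins k).
have big k : `|bdry P Q a0 h0 c0 v0| <= 4 ^+ k * `|bdry P Q (s k).1 (hk k) (s k).2 (vk k)|.
  elim: k => [|k IH]; first by rewrite hk0 vk0 expr0 mul1r.
  apply: (le_trans IH); rewrite exprSr -mulrA ler_pM2l ?exprn_gt0//.
  by have [_ _ _ _ []] := step k.
have mono1 i j : (i <= j)%N -> (s i).1 <= (s j).1 /\ (s j).1 + hk j <= (s i).1 + hk i.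
  move=> /subnK <-; elim: (j - i)%N => [|m [IH1 IH2]]; first by split.
  have [k1 k2 _ _ _] := step (m + i)%N.
  by split; [exact: le_trans k1|exact: le_trans k2 IH2].
have mono2 i j : (i <= j)%N -> (s i).2 <= (s j).2 /\ (s j).2 + vk j <= (s i).2 + vk i.
  move=> /subnK <-; elim: (j - i)%N => [|m [IH1 IH2]]; first by split.
  have [_ _ k1 k2 _] := step (m + i)%N.
  by split; [exact: le_trans k1|exact: le_trans k2 IH2].
(* The supremum of the left ends lies in every interval; used for each coordinate. *)
have sup_ex (f g : nat -> R) : (forall i j, f i <= g j) -> exists x, forall k, f k <= x <= g k.
  move=> fg; exists (sup (range f)) => k; apply/andP; split.
    by apply: ub_le_sup; [exists (g 0%N) => _ [i _ <-]|exists k].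
  by apply: ge_sup; [exists (f 0%N), 0%N|move=> _ [i _ <-]].
have [|x0 Hx0] := sup_ex (fun k => (s k).1) (fun k => (s k).1 + hk k).
  move=> i j; have [_ pi _ _ [pj _]] := ins (maxn i j); have [_ qi _ _ [qj _]] := ins (maxn i j).
  have [k1 _] := mono1 i (maxn i j) (leq_maxl _ _); have [_ k2] := mono1 j (maxn i j) (leq_maxr _ _).
  by apply: (le_trans k1); apply: le_trans k2; rewrite lerDl.
have [|y0 Hy0] := sup_ex (fun k => (s k).2) (fun k => (s k).2 + vk k).
  move=> i j; have [_ pi _ _ [pj _]] := ins (maxn i j); have [_ qi _ _ [qj _]] := ins (maxn i j).
  have [k1 _] := mono2 i (maxn i j) (leq_maxl _ _); have [_ k2] := mono2 j (maxn i j) (leq_maxr _ _).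
  by apply: (le_trans k1); apply: le_trans k2; rewrite lerDl.
have := Hx0 0%N; have := Hy0 0%N; rewrite hk0 vk0 /= => y00 x00.
have [p1 [p2 [q2 G]]] := PQ x00 y00.
apply/eqP; rewrite -normr_eq0 eq_le normr_ge0 andbT; apply/ler_addgt0Pr => e e0; rewrite add0r.
have L0 : 0 < 1 + 2 * (h0 + v0) ^+ 2 by rewrite ltr_wpDr// mulr_ge0// sqr_ge0.
have e1 : 0 < e / (1 + 2 * (h0 + v0) ^+ 2) by rewrite divr_gt0.
have [r r0 K] := G _ e1.
have hv : 0 < 1 + h0 + v0 by rewrite ltr_wpDr// ltr_wpDr.
have r1 : 0 < r / (1 + h0 + v0) by rewrite divr_gt0.
have i2 : 1 / 2 < 1 :> R by rewrite ltr_pdivrMr// mul1r ltr1n.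
have [k Hk] := geo_small (divr_ge0 ler01 (ler0n R 2)) i2 r1.
have := Hk k (leqnn k); rewrite ltr_pdivlMr//.
rewrite expr_div_n expr1n => hh.
have i20 : 0 < 1 / 2 ^+ k :> R by rewrite divr_gt0// exprn_gt0.
have [hkr vkr] : hk k <= r /\ vk k <= r.
  rewrite mul1r in hh i20; split; apply: le_trans (ltW hh); rewrite /hk /vk mulrC; apply: ler_wpM2l; rewrite ?(ltW i20)//.
    by rewrite addrAC lerDr addr_ge0.
  by rewrite lerDr addr_ge0.
have := bdry_small (ins k) (Hx0 k) (Hy0 k) hkr vkr e1 K.
move=> h1; apply: (le_trans (big k)).
apply: (@le_trans _ _ (4 ^+ k * (2 * (e / (1 + 2 * (h0 + v0) ^+ 2)) * (hk k + vk k) ^+ 2))).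
  by rewrite ler_pM2l// exprn_gt0.
(* The fourfold loss at each bisection is exactly made up by halving the sides, which enter
   squared. *)
have -> : 4 ^+ k * (2 * (e / (1 + 2 * (h0 + v0) ^+ 2)) * (hk k + vk k) ^+ 2) =
   e * (2 * (h0 + v0) ^+ 2) / (1 + 2 * (h0 + v0) ^+ 2).
  rewrite /hk /vk -mulrDl exprMn exprVn -exprM mulnC exprM (_ : 2 ^+ 2 = 4); last by ring.
  have : (4 : R) ^+ k != 0 by rewrite expf_neq0.
  by move: (4 ^+ k) => X X0; field; rewrite X0 gt_eqF.
by rewrite ler_pdivrMr// ler_wpM2l ?(ltW e0)// lerDr.
Qed.
End Bisect.
End Goursat.


(** * Complex differentiability in terms of real estimates *)

Lemma derivable_eps (K : numFieldType) (g : K -> K) (z : K) :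
  derivable (g : K^o -> K^o) z 1 <-> exists d, forall e, 0 < e -> exists2 r, 0 < r &
    forall w, `|w| < r -> `|g (z + w) - g z - d * w| <= e * `|w|.
Proof.
split=> [/cvg_ex[d /cvgrPdist_le H]|[d H]].
- exists d => e e0; have /nbhs_ballP[r /= r0 Hr] := H e e0.
  exists r => // w wr; have [->|w0] := eqVneq w 0.
    by rewrite addr0 subrr sub0r mulr0 oppr0 !normr0 mulr0.
  have := Hr w; rewrite /ball /= sub0r normrN => /(_ wr w0).
  rewrite /shift /= /GRing.scale /= mulr1 (addrC w z) => h.
  have -> : g (z + w) - g z - d * w = - ((d - w^-1 * (g (z + w) - g z)) * w).
    by rewrite mulrBl opprB mulrAC mulVf// mul1r.
  by rewrite normrN normrM ler_wpM2r.
- apply/cvg_ex; exists (d : K^o); apply/cvgrPdist_le => e e0.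
  have [r r0 Hr] := H e e0; apply/nbhs_ballP; exists r => //= w.
  rewrite /ball /= sub0r normrN => wr w0.
  have := Hr w wr; rewrite /shift /= /GRing.scale /= mulr1 (addrC w z) => h.
  rewrite -(ler_pM2r (x := `|w|)) ?normr_gt0// -normrM -normrN.
  by have -> : - ((d - w^-1 * (g (z + w) - g z)) * w) = g (z + w) - g z - d * w
    by rewrite mulrBl opprB mulrAC mulVf// mul1r.
Qed.

Lemma derivableM_field (K : numFieldType) (g h : K -> K) (z : K) :
  derivable (g : K^o -> K^o) z 1 -> derivable (h : K^o -> K^o) z 1 ->
  derivable ((fun z => g z * h z) : K^o -> K^o) z 1.
Proof. by move=> d1 d2; exact: (@derivableM K K^o g h z 1). Qed.
Lemma derivableV_field (K : numFieldType) (z : K) : z != 0 ->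
  derivable ((fun z => z^-1) : K^o -> K^o) z 1.
Proof. by move=> z0; apply: (@derivableV K K^o id z 1) => //; exact: derivable_id. Qed.
Lemma derivable_id_field (K : numFieldType) (z : K) : derivable (id : K^o -> K^o) z 1.
Proof. exact: derivable_id. Qed.
Lemma derivable_cst_field (K : numFieldType) (c z : K) : derivable ((fun=> c) : K^o -> K^o) z 1.
Proof. exact: derivable_cst. Qed.

Section Cdiff.
Variable R : realType.
Implicit Types (g h : R[i] -> R[i]) (z w d : R[i]).

(** In the normed structure of [R[i]] over itself a radius is a positive complex number; here [e]
    and [r] are real, so that real inequalities apply directly. *)
Definition cdiff g z d := forall e : R, 0 < e -> exists2 r : R, 0 < r &
  forall w, cabs w <= r -> cabs (g (z + w) - g z - d * w) <= e * cabs w.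

Lemma derivable_cdiff g z : derivable (g : R[i]^o -> R[i]^o) z 1 <-> exists d, cdiff g z d.
Proof.
rewrite derivable_eps; split=> -[d H]; exists d => e e0.
- have [|r r0 Hr] := H e%:C; first by rewrite ltcR.
  have Er : r = (complex.Re r)%:C by rewrite RRe_real// ger0_real// ltW.
  rewrite Er ltcR in r0; exists (complex.Re r / 2); first by rewrite divr_gt0.
  move=> w wr; have := Hr w; rewrite !cabsE Er ltcR -rmorphM lecR; apply.
  by apply: (le_lt_trans wr); lra.
- have Ee : e = (complex.Re e)%:C by rewrite RRe_real// ger0_real// ltW.
  rewrite Ee ltcR in e0; have [r r0 Hr] := H _ e0.
  exists r%:C; first by rewrite ltcR.
  by move=> w; rewrite !cabsE ltcR Ee -rmorphM lecR => /ltW; exact: Hr.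
Qed.

Lemma cdiffM g h z : (exists d, cdiff g z d) -> (exists d, cdiff h z d) ->
  exists d, cdiff (fun z => g z * h z) z d.
Proof. by rewrite -!derivable_cdiff => d1 d2; exact: derivableM_field. Qed.
Lemma cdiffV z : z != 0 -> exists d, cdiff (fun z => z^-1) z d.
Proof. by rewrite -derivable_cdiff; exact: derivableV_field. Qed.
Lemma cdiff_id z : exists d, cdiff id z d.
Proof. by rewrite -derivable_cdiff; exact: derivable_id_field. Qed.
Lemma cdiff_cst c z : exists d, cdiff (fun=> c) z d.
Proof. by rewrite -derivable_cdiff; exact: derivable_cst_field. Qed.
Lemma cdiffX g z n : (exists d, cdiff g z d) -> exists d, cdiff (fun z => g z ^+ n) z d.
Proof.
move=> H; elim: n => [|n IH]; first exact: cdiff_cst.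
rewrite (_ : (fun z => _) = (fun z => g z * g z ^+ n)); last by apply/funext => s; rewrite exprS.
exact: cdiffM.
Qed.

Lemma cdiff_ccts (T : topologicalType) (phi : T -> R[i]) g t : ccts phi t ->
  (exists d, cdiff g (phi t) d) -> ccts (fun s => g (phi s)) t.
Proof.
move=> /cctsP hphi [d /(_ 1 ltr01) [r r0 H]]; apply/cctsP => e e0.
have D : 0 < 2 + cabs d by have := cabs_ge0 d; lra.
have m0 : 0 < Num.min r (e / (2 + cabs d)) by rewrite lt_min r0 divr_gt0.
apply: filterS (hphi _ m0) => s; rewrite lt_min => /andP[/ltW h1 h2].
have := H _ h1; set w := phi s - phi t in h1 h2 *.
rewrite (_ : phi t + w = phi s); last by rewrite /w addrC subrK.
move=> h3; rewrite (_ : g (phi s) - g (phi t) = (g (phi s) - g (phi t) - d * w) + d * w); last by rewrite subrK.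
apply: (le_lt_trans (cabsD _ _)); rewrite cabsM; move: h2; rewrite ltr_pdivlMr// => h2.
by have := cabs_ge0 w; nra.
Qed.

(** Real differentiability in two real variables, [A] and [B] being the partial derivatives; it
    carries the chain rule from [cdiff] to polar coordinates. *)
Definition pdiff (f : R -> R -> R[i]) (x0 y0 : R) (A B : R[i]) :=
  forall e : R, 0 < e -> exists2 r : R, 0 < r & forall x y, `|x - x0| <= r -> `|y - y0| <= r ->
    cabs (f x y - f x0 y0 - (A * (x - x0)%:C + B * (y - y0)%:C)) <= e * (`|x - x0| + `|y - y0|).

Lemma pdiff_lip f x0 y0 A B : pdiff f x0 y0 A B -> exists L r : R, [/\ 0 <= L, 0 < r &
  forall x y, `|x - x0| <= r -> `|y - y0| <= r ->
    cabs (f x y - f x0 y0) <= L * (`|x - x0| + `|y - y0|)].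
Proof.
move=> /(_ 1 ltr01) [r r0 H]; exists (1 + cabs A + cabs B), r; split => //.
  by rewrite !addr_ge0// cabs_ge0.
move=> x y hx hy; have h1 := H x y hx hy.
rewrite (_ : f x y - f x0 y0 = (f x y - f x0 y0 - (A * (x - x0)%:C + B * (y - y0)%:C)) +
   (A * (x - x0)%:C + B * (y - y0)%:C)); last by rewrite subrK.
apply: (le_trans (cabsD _ _)).
have h2 := cabsD (A * (x - x0)%:C) (B * (y - y0)%:C); rewrite !cabsM !cabsR in h2.
have a0 := cabs_ge0 A; have b0 := cabs_ge0 B.
have n1 := normr_ge0 (x - x0); have n2 := normr_ge0 (y - y0).
by nra.
Qed.

Let frac_bound (e k L S : R) : 0 < k -> 0 <= L -> 0 <= S -> 0 < e -> e / (k * (1 + L)) * (L * S) <= e / k * S.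
Proof.
move=> k0 L0 S0 e0; have L1 : 0 < 1 + L by lra.
rewrite invfM !mulrA; apply: ler_wpM2r => //.
rewrite mulrAC ler_pdivrMr// ler_wpM2l ?divr_ge0 ?ltW//; lra.
Qed.

Lemma pdiff_comp f g x0 y0 A B d : pdiff f x0 y0 A B -> cdiff g (f x0 y0) d ->
  pdiff (fun x y => g (f x y)) x0 y0 (d * A) (d * B).
Proof.
move=> Hf Hg e e0; have [L [r1 [L0 r10 HL]]] := pdiff_lip Hf.
have D0 := cabs_ge0 d.
have e1 : 0 < e / (2 * (1 + L)) by rewrite divr_gt0// mulr_gt0//; lra.
have e2 : 0 < e / (2 * (1 + cabs d)) by rewrite divr_gt0// mulr_gt0//; lra.
have [r2 r20 H2] := Hg _ e1; have [r3 r30 H3] := Hf _ e2.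
exists (Num.min r1 (Num.min r3 (r2 / (2 * (1 + L))))).
  by rewrite !lt_min r10 r30 /= divr_gt0// mulr_gt0//; lra.
move=> x y; rewrite !le_min => /and3P[x1 x2 x3] /and3P[y1 y2 y3].
have l := HL x y x1 y1; set w := f x y - f x0 y0 in l.
have nx := normr_ge0 (x - x0); have ny := normr_ge0 (y - y0).
have L1 : 0 < 2 * (1 + L) by lra.
have wr : cabs w <= r2.
  apply: (le_trans l); move: x3 y3; rewrite !ler_pdivlMr// => x3 y3; nra.
have := H2 w wr; rewrite (_ : f x0 y0 + w = f x y); last by rewrite /w addrC subrK.
move=> h1; have h2 := H3 x y x2 y2; rewrite -/w in h2.
rewrite (_ : g (f x y) - g (f x0 y0) - (d * A * (x - x0)%:C + d * B * (y - y0)%:C) =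
  (g (f x y) - g (f x0 y0) - d * w) + d * (w - (A * (x - x0)%:C + B * (y - y0)%:C))); last by ring.
apply: (le_trans (cabsD _ _)); rewrite cabsM.
set S := `|x - x0| + `|y - y0| in l h2 *.
have S0 : 0 <= S by rewrite /S; lra.
have t1 : e / (2 * (1 + L)) * cabs w <= e / 2 * S.
  apply: (@le_trans _ _ (e / (2 * (1 + L)) * (L * S))); first by rewrite ler_pM2l.
  exact: frac_bound.
have t2 : cabs d * (e / (2 * (1 + cabs d)) * S) <= e / 2 * S.
  by rewrite mulrCA; exact: frac_bound.
have t3 := ler_wpM2l D0 h2.
by lra.
Qed.

Lemma pdiffM f (h : R -> R -> R[i]) x0 y0 A B A' B' : pdiff f x0 y0 A B -> pdiff h x0 y0 A' B' ->
  pdiff (fun x y => f x y * h x y) x0 y0 (A * h x0 y0 + f x0 y0 * A') (B * h x0 y0 + f x0 y0 * B').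
Proof.
move=> Hf Hh e e0.
have [L [r1 [L0 r10 HL]]] := pdiff_lip Hf.
have [L' [r2 [L'0 r20 HL']]] := pdiff_lip Hh.
set F := f x0 y0; set H := h x0 y0.
have F0 := cabs_ge0 F; have H0 := cabs_ge0 H.
have e1 : 0 < e / (3 * (1 + cabs H)) by rewrite divr_gt0// mulr_gt0//; lra.
have e2 : 0 < e / (3 * (1 + cabs F)) by rewrite divr_gt0// mulr_gt0//; lra.
have [r3 r30 H3] := Hf _ e1; have [r4 r40 H4] := Hh _ e2.
have LL : 0 < 1 + L * L' by rewrite ltr_wpDr// mulr_ge0.
exists (Num.min (Num.min r1 r2) (Num.min (Num.min r3 r4) (e / (6 * (1 + L * L'))))).
  by rewrite !lt_min r10 r20 r30 r40 /= divr_gt0// mulr_gt0.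
move=> x y; rewrite !le_min => /andP[/andP[x1 x2] /andP[/andP[x3 x4] x5]].
move=> /andP[/andP[y1 y2] /andP[/andP[y3 y4] y5]].
have l := HL x y x1 y1; have l' := HL' x y x2 y2.
have k := H3 x y x3 y3; have k' := H4 x y x4 y4.
set dx := (x - x0)%:C in k k' *; set dy := (y - y0)%:C in k k' *.
have nx := normr_ge0 (x - x0); have ny := normr_ge0 (y - y0).
set S := `|x - x0| + `|y - y0| in l l' k k' *.
have S0 : 0 <= S by rewrite /S; lra.
rewrite (_ : f x y * h x y - F * H - ((A * H + F * A') * dx + (B * H + F * B') * dy) =
  (f x y - F - (A * dx + B * dy)) * H + F * (h x y - H - (A' * dx + B' * dy)) + (f x y - F) * (h x y - H)); last by ring.
apply: (le_trans (cabsD _ _)).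
have := cabsD ((f x y - F - (A * dx + B * dy)) * H) (F * (h x y - H - (A' * dx + B' * dy))).
rewrite !cabsM => t0.
have t1 : cabs (f x y - F - (A * dx + B * dy)) * cabs H <= e / 3 * S.
  apply: (@le_trans _ _ (e / (3 * (1 + cabs H)) * S * cabs H)); first by rewrite ler_wpM2r.
  by rewrite -mulrA (mulrC S); exact: frac_bound.
have t2 : cabs F * cabs (h x y - H - (A' * dx + B' * dy)) <= e / 3 * S.
  apply: (@le_trans _ _ (cabs F * (e / (3 * (1 + cabs F)) * S))); first by rewrite ler_wpM2l.
  by rewrite mulrCA; exact: frac_bound.
have t3 : cabs (f x y - F) * cabs (h x y - H) <= e / 3 * S.
  apply: (@le_trans _ _ ((L * S) * (L' * S))); first by apply: ler_pM => //; exact: cabs_ge0.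
  have Sr : S <= e / (3 * (1 + L * L')).
    rewrite /S (_ : e / (3 * (1 + L * L')) = e / (6 * (1 + L * L')) + e / (6 * (1 + L * L'))); last first.
      by field; rewrite gt_eqF.
    exact: lerD.
  rewrite (_ : L * S * (L' * S) = (L * L' * S) * S); last by ring.
  apply: ler_wpM2r => //; move: Sr; rewrite ler_pdivlMr ?mulr_gt0// => Sr.
  have := mulr_ge0 L0 L'0; nra.
by lra.
Qed.

Definition cis (t : R) : R[i] := cos t +i* sin t.

Lemma is_derive_eps (f : R -> R) (x d : R) : is_derive x (1 : R) f d ->
  forall e, 0 < e -> exists2 r, 0 < r & forall y, `|y - x| <= r -> `|f y - f x - d * (y - x)| <= e * `|y - x|.
Proof.
move=> [/cvgrPdist_le H Hd] e e0; rewrite -/(derive f x 1) Hd in H.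
have /nbhs_ballP[r /= r0 Hr] := H e e0.
exists (r / 2) => [|y hy]; first by rewrite divr_gt0.
have [->|yx] := eqVneq y x; first by rewrite !subrr sub0r mulr0 oppr0 !normr0 mulr0.
have := Hr (y - x); rewrite /ball /= sub0r normrN.
have -> : `|y - x| < r by apply: (le_lt_trans hy); lra.
rewrite subr_eq0 => /(_ isT yx).
rewrite /shift /= /GRing.scale /= mulr1 subrK => h.
have -> : f y - f x - d * (y - x) = - ((d - (y - x)^-1 * (f y - f x)) * (y - x)).
  by rewrite mulrBl opprB mulrAC mulVf ?subr_eq0// mul1r.
by rewrite normrN normrM ler_wpM2r.
Qed.

Lemma pdiff_cis x0 y0 : pdiff (fun _ y => cis y) x0 y0 0 ('i * cis y0).
Proof.
move=> e e0; have e2 : 0 < e / 2 by rewrite divr_gt0.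
have [r1 r10 H1] := is_derive_eps (is_derive_cos y0) e2.
have [r2 r20 H2] := is_derive_eps (is_derive_sin y0) e2.
exists (Num.min r1 r2); first by rewrite lt_min r10.
move=> x y _; rewrite le_min => /andP[y1 y2].
apply: (le_trans (cabs_le_ReIm _)).
rewrite /cis; simpc; rewrite /=.
have := lerD (H1 y y1) (H2 y y2).
set u := `|cos y - _ - _|; set v := `|sin y - _ - _| => h.
rewrite (_ : `|_| = u); last by rewrite /u; congr `|_|; ring.
have nx := normr_ge0 (x - x0).
by nra.
Qed.
Lemma pdiff_x x0 y0 : pdiff (fun x _ => x%:C) x0 y0 1 0.
Proof.
move=> e e0; exists 1 => // x y _ _.
have -> : x%:C - x0%:C - (1 * (x - x0)%:C + 0 * (y - y0)%:C) = 0 :> R[i] by rewrite rmorphB; ring.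
by rewrite cabs0 mulr_ge0 ?addr_ge0// ltW.
Qed.
Lemma pdiffN f x0 y0 A B : pdiff f x0 y0 A B -> pdiff (fun x y => f x (- y)) x0 (- y0) A (- B).
Proof.
move=> H e e0; have [r r0 Hr] := H e e0; exists r => // x y hx hy.
have hy' : `|- y - y0| <= r by rewrite -opprD normrN; move: hy; rewrite opprK.
have := Hr x (- y) hx hy'; rewrite opprK.
rewrite (_ : B * (- y - y0)%:C = - B * (y + y0)%:C); last by rewrite -opprD rmorphN /=; ring.
by rewrite (_ : `|- y - y0| = `|y + y0|)//; rewrite -opprD normrN.
Qed.
End Cdiff.


(** * Power series expansion of holomorphic functions *)

Section Circle.
Variable R : realType.
Implicit Types (g h : R[i] -> R[i]) (z : R[i]).

Lemma pdiff_cst (c : R[i]) x0 y0 : pdiff (fun _ _ : R => c) x0 y0 0 0.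
Proof.
move=> e e0; exists 1 => // x y _ _.
by rewrite subrr !mul0r addr0 subr0 cabs0 mulr_ge0 ?addr_ge0// ltW.
Qed.
Lemma pdiffD f (h : R -> R -> R[i]) (x0 y0 : R) A B A' B' : pdiff f x0 y0 A B -> pdiff h x0 y0 A' B' ->
  pdiff (fun x y => f x y + h x y) x0 y0 (A + A') (B + B').
Proof.
move=> Hf Hh e e0; have e2 : 0 < e / 2 by rewrite divr_gt0.
have [r1 r10 H1] := Hf _ e2; have [r2 r20 H2] := Hh _ e2.
exists (Num.min r1 r2); first by rewrite lt_min r10.
move=> x y; rewrite !le_min => /andP[x1 x2] /andP[y1 y2].
have h1 := H1 x y x1 y1; have h2 := H2 x y x2 y2.
set dx := (x - x0)%:C in h1 h2 *; set dy := (y - y0)%:C in h1 h2 *.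
rewrite (_ : f x y + h x y - _ - _ = (f x y - f x0 y0 - (A * dx + B * dy)) +
  (h x y - h x0 y0 - (A' * dx + B' * dy))); last by ring.
by apply: (le_trans (cabsD _ _)); lra.
Qed.

Lemma pdiff_gdiff (U W : R -> R -> R[i]) x0 y0 A B A' B' : pdiff U x0 y0 A B -> pdiff W x0 y0 A' B' ->
  complex.Re A = complex.Im B' ->
  gdiff (fun x y => complex.Im (W x y)) (fun x y => complex.Re (U x y)) x0 y0.
Proof.
move=> HU HW AB; exists (complex.Im A'), (complex.Re A), (complex.Re B) => e e0.
have [r1 r10 H1] := HU _ e0; have [r2 r20 H2] := HW _ e0.
exists (Num.min r1 r2); first by rewrite lt_min r10.
move=> x y; rewrite !le_min => /andP[x1 x2] /andP[y1 y2]; split.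
- apply: le_trans (H2 x y x2 y2); apply: le_trans (Im_le_cabs _).
  by rewrite !(cImD, cImN, cImM) AB /= !mulr0 !add0r.
- apply: le_trans (H1 x y x1 y1); apply: le_trans (Re_le_cabs _).
  by rewrite !(cReD, cReN, cReM) /= !mulr0 !subr0.
Qed.

Lemma cabs_cis (t : R) : cabs (cis t) = 1.
Proof. by rewrite /cis /= cos2Dsin2 sqrtr1. Qed.

(** With [x] the radius and [y] the angle, the closed form [h dz / (i z)] is [h dy - i h dx / x].
    The circle is covered by the angles [y] and [- y] for [y] in [[0, pi]], as in [sphere_int];
    folding the lower half onto the upper one reverses its [dx] term, whence the minus sign in
    [polP]. The real part has coefficients [Im (polP h)] and [Re (polQ h)]. *)
Definition polQ h (x y : R) := h (x%:C * cis y) + h (x%:C * cis (- y)).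
Definition polP h (x y : R) := (h (x%:C * cis y) + (-1) * h (x%:C * cis (- y))) * (x%:C)^-1.

Lemma polar_gdiff h (x0 y0 : R) : 0 < x0 -> (forall z, cabs z = x0 -> exists d, cdiff h z d) ->
  gdiff (fun x y => complex.Im (polP h x y)) (fun x y => complex.Re (polQ h x y)) x0 y0.
Proof.
move=> x00 H.
have cz t : cabs (x0%:C * cis t) = x0 by rewrite cabsM cabs_cis mulr1 cabsR gtr0_norm.
have [d1 D1] := H _ (cz y0); have [d2 D2] := H _ (cz (- y0)).
have k1 := pdiff_comp (pdiffM (pdiff_x x0 y0) (pdiff_cis x0 y0)) D1.
have k2' := pdiff_comp (pdiffM (pdiff_x x0 (- y0)) (pdiff_cis x0 (- y0))) D2.
have k2 := pdiffN k2'; rewrite opprK in k2.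
have x0C : x0%:C != 0 :> R[i] by rewrite -cabs_gt0 cabsR gtr0_norm.
have [di Di] := cdiffV x0C.
have k3 := pdiff_comp (pdiff_x x0 y0) Di.
have kW := pdiffM (pdiffD k1 (pdiffM (pdiff_cst (-1) x0 y0) k2)) k3.
apply: (pdiff_gdiff (pdiffD k1 k2) kW).
(* Cauchy-Riemann in polar form: ['i] times the [x]-derivative of [polQ h] is the [y]-derivative of
   [polP h]. [aux] checks this on the expressions given by the chain rule. *)
rewrite -[LHS]ImiRe; congr complex.Im.
have aux (a b E E' X I u v w : R[i]) : X != 0 ->
  (a * (1 * E + X * 0) + b * (1 * E' + X * 0)) * I =
  (a * (0 * E + X * (I * E)) + (0 * v + -1 * - (b * (0 * E' + X * (I * E'))))) / X + (u + -1 * v) * (w * 0).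
  by move=> X0; field.
exact: aux.
Qed.

Definition zof (w : 'rV[R]_2) : R[i] := w ord0 ord0 +i* w ord0 (lift ord0 ord0).
Definition circ h (r : R) : R[i] := sphere_intC (fun w => h (r%:C * zof w)).

Lemma zof_sph w : sph w -> cabs (zof w) = 1.
Proof. by move=> /sphE; rewrite big_ord_recl big_ord1 /= => ->; rewrite sqrtr1. Qed.
Lemma zof_cont w : ccts zof w.
Proof. by split => /=; exact: cont_coord. Qed.
Lemma zof_slice t s : zof (slice t (const_mx s)) = cos t +i* (sin t * s).
Proof. by rewrite /zof slice0 sliceS mxE. Qed.
Lemma zof_inj_sph z : cabs z = 1 -> exists w, sph w /\ zof w = z.
Proof.
move=> z1; exists (\row_i (if i == ord0 then complex.Re z else complex.Im z)); split.
  by apply/sphE; rewrite big_ord_recl big_ord1 !mxE /= -cabs_sqr z1 expr1n.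
by rewrite /zof !mxE /=; case: (z).
Qed.
Lemma polar_zof z : z != 0 -> exists w, sph w /\ z = (cabs z)%:C * zof w.
Proof.
move=> z0; have zC : (cabs z)%:C != 0 :> R[i].
  by rewrite -cabs_gt0 cabsR ger0_norm ?cabs_ge0// cabs_gt0.
have [|w [Hw wE]] := @zof_inj_sph (z / (cabs z)%:C).
  by rewrite cabsM cabsV cabsR ger0_norm ?cabs_ge0// divff// cabs_eq0.
by exists w; split => //; rewrite wE mulrC divfK.
Qed.

Lemma Re_circ h r : complex.Re (circ h r) = rint 0 pi (fun t => complex.Re (polQ h r t)).
Proof.
rewrite /circ /sphere_intC [LHS]/= -/(rint 0 pi _); apply: eq_rint => t _.
rewrite expr0 mul1r /polQ cReD.
have E s : row_mx (const_mx (cos t) : 'rV[R]_1) (sin t *: (const_mx s : 'rV[R]_1)) = slice t (const_mx s) by [].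
rewrite !E !zof_slice /cis cosN sinN mulr1 mulrN1; by [].
Qed.

(* In polar coordinates the annulus is a rectangle, on which [goursat_rect] applies. *)
Lemma circ_Re_const h r0 r1 r2 : (forall z, 0 < cabs z -> cabs z < r0 -> exists d, cdiff h z d) ->
  0 < r1 -> r1 <= r2 -> r2 < r0 -> complex.Re (circ h r1) = complex.Re (circ h r2).
Proof.
move=> H r10 r12 r20.
have := @goursat_rect R (fun x y => complex.Im (polP h x y)) (fun x y => complex.Re (polQ h x y))
  r1 (r2 - r1) 0 pi _ (pi_ge0 R) _.
rewrite subr_ge0 add0r subrKC => /(_ r12 _)/wrap[].
  move=> x y /andP[x1 x2] _; apply: polar_gdiff; first exact: lt_le_trans x1.
  by move=> z zx; apply: H; rewrite zx; [exact: lt_le_trans x1|exact: le_lt_trans r20].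
rewrite /bdry add0r subrKC -!Re_circ.
(* At the angles 0 and [pi] the two halves of the circle meet, so the radial sides contribute
   nothing. *)
have -> : rint r1 r2 (fun x => complex.Im (polP h x 0)) = 0.
  transitivity (rint r1 r2 (fun=> 0)); last exact: rint0.
  apply: eq_rint => x _.
  by rewrite /polP oppr0 mulN1r subrr mul0r.
have -> : rint r1 r2 (fun x => complex.Im (polP h x pi)) = 0.
  transitivity (rint r1 r2 (fun=> 0)); last exact: rint0.
  apply: eq_rint => x _.
  by rewrite /polP /cis sinN cosN sinpi oppr0 mulN1r subrr mul0r.
by move=> /eqP; rewrite subr0 add0r subr_eq0 => /eqP.
Qed.

Lemma cdiff_sccts g (r : R) : (forall z, cabs z = `|r| -> exists d, cdiff g z d) ->
  sccts (fun w => g (r%:C * zof w)).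
Proof.
move=> H w Hw; apply: (@cdiff_ccts _ _ (fun w => r%:C * zof w)).
  by apply: cctsM; [exact: ccts_cst|exact: zof_cont].
by apply: H; rewrite cabsM cabsR zof_sph// mulr1.
Qed.

Lemma circ_const h r0 r1 r2 : (forall z, 0 < cabs z -> cabs z < r0 -> exists d, cdiff h z d) ->
  0 < r1 -> r1 <= r2 -> r2 < r0 -> circ h r1 = circ h r2.
Proof.
move=> H r10 r12 r20; apply: ceqP; first exact: circ_Re_const H _ _ _.
have c1 r : 0 < r -> r < r0 -> sccts (fun w => h (r%:C * zof w)).
  move=> ? ?; apply: cdiff_sccts => z; rewrite gtr0_norm// => zr; apply: H; by rewrite zr.
(* Multiplication by [- 'i] moves the imaginary part to the real part, where the previous lemma
   applies. *)
have E r : 0 < r -> r < r0 -> complex.Im (circ h r) = complex.Re (circ (fun z => (- 'i) * h z) r).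
  move=> ? ?; have -> : circ (fun z => (- 'i) * h z) r = (- 'i) * circ h r.
    by apply: sphere_intCZ; exact: c1.
  by rewrite cReM /=; ring.
rewrite !E ?(lt_le_trans r10)// ?(le_lt_trans r12)//.
apply: circ_Re_const r10 r12 r20 => z z0 zr; apply: cdiffM; [exact: cdiff_cst|exact: H].
Qed.

Lemma sarea_gt0 n : 0 < sarea R n.+1.
Proof.
have [K [e [K0 H]]] := @sphere_int_cap R n; have [w0 Hw0] := sph_inhabited R n.
have := @H w0 1 (fun=> 1) 1 Hw0 ltr01 (lexx _) (@scont_cst R n.+1 1).
rewrite mul1r expr1n mulr1 => /(_ _ _ _)/wrap[]//; exact: lt_le_trans.
Qed.

(** Scaling by 2 multiplies these functions, hence their means, by a constant different from 1;
    since the mean does not depend on the radius, it is 0. *)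
Lemma circ_pow_eq0 j : sphere_intC (fun w => zof w ^+ j.+1) = 0 /\
  sphere_intC (fun w => (zof w)^-1 ^+ j.+1) = 0.
Proof.
have key (h : R[i] -> R[i]) (c : R[i]) : (forall z, z != 0 -> exists d, cdiff h z d) ->
   (forall z, h ((2 : R)%:C * z) = c * h z) -> c != 1 -> circ h 1 = 0.
  move=> H hc c1.
  have E : circ h 1 = circ h 2.
    by apply: (@circ_const _ 3) => //; [move=> z z0 _; apply: H; rewrite -cabs_gt0|lra|lra].
  have E2 : circ h 2 = c * circ h 1.
    rewrite /circ -sphere_intCZ; first by apply: eq_sphere_intC => w _; rewrite mul1r.
    apply: cdiff_sccts => z; rewrite normr1 => z1; apply: H; by rewrite -cabs_gt0 z1.
  move/eqP: E; rewrite E2 -[X in X == _]mul1r -subr_eq0 -mulrBl mulf_eq0 subr_eq0 eq_sym (negbTE c1) /=.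
  by move/eqP.
have one1 (h : R[i] -> R[i]) : sphere_intC (fun w => h (zof w)) = circ h 1.
  by rewrite /circ; apply: eq_sphere_intC => w _; rewrite mul1r.
have ne1 (x : R) : x != 1 -> x%:C != 1 :> R[i].
  by move=> h; apply: contraNneq h => /complexI ->.
split.
- rewrite (one1 (fun z => z ^+ j.+1)); apply: (key _ ((2 ^+ j.+1 : R)%:C)).
  + by move=> z _; apply: cdiffX; exact: cdiff_id.
  + by move=> z; rewrite exprMn rmorphXn.
  + by apply: ne1; rewrite gt_eqF// exprn_egt1//; lra.
- rewrite (one1 (fun z => z^-1 ^+ j.+1)); apply: (key _ ((2^-1 ^+ j.+1 : R)%:C)).
  + by move=> z z0; apply: (@cdiffX _ (fun z => z^-1)); exact: cdiffV.
  + by move=> z; rewrite invfM exprMn rmorphXn fmorphV.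
  + by apply: ne1; rewrite lt_eqF// exprn_ilt1//; lra.
Qed.

Lemma zof_neq0 w : sph w -> zof w != 0.
Proof. by move=> Hw; rewrite -cabs_gt0 zof_sph. Qed.
Lemma zofV_sccts : sccts (fun w => (zof w)^-1).
Proof.
move=> w Hw; apply: (@cdiff_ccts _ _ zof (fun z => z^-1)); first exact: zof_cont.
by apply: cdiffV; exact: zof_neq0.
Qed.

Lemma circ_pow a b : sphere_intC (fun w => zof w ^+ a * (zof w)^-1 ^+ b) =
  if a == b then (sarea R 2)%:C else 0.
Proof.
case: (ltngtP a b) => ab.
- rewrite -[RHS](circ_pow_eq0 (b - a).-1).2; apply: eq_sphere_intC => w Hw.
  rewrite prednK ?subn_gt0// -{1}(subnK (ltnW ab)) addnC exprD mulrA -exprMn.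
  by rewrite divff ?zof_neq0// expr1n mul1r.
- rewrite -[RHS](circ_pow_eq0 (a - b).-1).1; apply: eq_sphere_intC => w Hw.
  rewrite prednK ?subn_gt0// -{1}(subnK (ltnW ab)) exprD -mulrA -exprMn.
  by rewrite divff ?zof_neq0// expr1n mulr1.
- rewrite ab -sphere_intC_real; apply: eq_sphere_intC => w Hw.
  by rewrite -exprMn divff ?zof_neq0// expr1n.
Qed.

(** Cauchy's integral for the [j]-th Taylor coefficient, with [sarea R 2] the length of the
    circle. *)
Definition tcoef g (r : R) j : R[i] :=
  ((sarea R 2)%:C)^-1 * circ (fun z => g z * z^-1 ^+ j) r.

Section Taylor.
Variables (g : R[i] -> R[i]) (r0 : R).
Hypothesis r00 : 0 < r0.
Hypothesis gd : forall z, cabs z < r0 -> exists d, cdiff g z d.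
Let c := tcoef g (r0 / 2).

Lemma sareaC : (sarea R 2)%:C != 0 :> R[i].
Proof. by rewrite -cabs_gt0 cabsR gtr0_norm sarea_gt0. Qed.

(** [g z / z ^+ j] is holomorphic off 0, so [circ_const] applies; Cauchy's estimates become
    available at every radius below [r0]. *)
Lemma tcoef_const r j : 0 < r -> r < r0 -> circ (fun z => g z * z^-1 ^+ j) r = (sarea R 2)%:C * c j.
Proof.
move=> r1 r2; rewrite /c /tcoef mulrA divff ?sareaC// mul1r.
have H z : 0 < cabs z -> cabs z < r0 -> exists d, cdiff (fun z => g z * z^-1 ^+ j) z d.
  move=> z0 zr; apply: cdiffM; first exact: gd.
  by apply: (@cdiffX _ (fun z => z^-1)); apply: cdiffV; rewrite -cabs_gt0.
by have [h|h] := leP r (r0 / 2); [|symmetry]; apply: (circ_const H) => //; lra.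
Qed.

Lemma circ_bound h r M : 0 < r -> (forall z, cabs z = r -> exists d, cdiff h z d) ->
  (forall z, cabs z = r -> cabs (h z) <= M) -> cabs (circ h r) <= M * sarea R 2.
Proof.
move=> r1 hd hM; apply: sphere_intC_bound.
  by apply: cdiff_sccts => z; rewrite gtr0_norm//; exact: hd.
by move=> w Hw; apply: hM; rewrite cabsM zof_sph// mulr1 cabsR gtr0_norm.
Qed.

Lemma tcoef_bound r M j : 0 < r -> r < r0 -> (forall z, cabs z = r -> cabs (g z) <= M) ->
  cabs (c j) * r ^+ j <= M.
Proof.
move=> r1 r2 HM.
have H z : cabs z = r -> exists d, cdiff (fun z => g z * z^-1 ^+ j) z d.
  move=> zr; apply: cdiffM; first by apply: gd; rewrite zr.
  by apply: (@cdiffX _ (fun z => z^-1)); apply: cdiffV; rewrite -cabs_gt0 zr.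
have := @circ_bound _ r (M * r^-1 ^+ j) r1 H; rewrite tcoef_const// cabsM cabsR gtr0_norm ?sarea_gt0//.
rewrite [sarea R 2 * _]mulrC ler_pM2r ?sarea_gt0// => K.
rewrite -ler_pdivlMr ?exprn_gt0// -exprVn; apply: K => z zr.
by rewrite cabsM cabsX cabsV zr ler_wpM2r ?exprn_ge0 ?invr_ge0 ?HM// ltW.
Qed.

Lemma circ_max r : 0 < r -> r < r0 -> exists M, forall z, cabs z = r -> cabs (g z) <= M.
Proof.
move=> r1 r2.
have [|th Hth H] := @sph_max R 1 (fun w => cabs (g (r%:C * zof w))).
  move=> w Hw; apply: ccts_cabs; apply: (@cdiff_sccts g r) => // z; rewrite gtr0_norm// => zr.
  by apply: gd; rewrite zr.
exists (cabs (g (r%:C * zof th))) => z zr.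
have [|w [Hw ->]] := @polar_zof z; first by rewrite -cabs_gt0 zr.
by rewrite zr; exact: H.
Qed.

Lemma tcoef_geo r : 0 < r -> r < r0 -> exists M, forall j, cabs (c j) <= M * r^-1 ^+ j.
Proof.
move=> r1 r2; have [M HM] := circ_max r1 r2; exists M => j.
by rewrite exprVn ler_pdivlMr ?exprn_gt0//; exact: tcoef_bound.
Qed.

Lemma near0_bound e : 0 < e -> exists2 r, 0 < r < r0 & forall z, cabs z <= r -> cabs (g z - g 0) <= e.
Proof.
move=> e0; have [|d /(_ 1 ltr01) [r1 r10 H]] := gd (z := 0); first by rewrite cabs0.
have D := cabs_ge0 d.
have D2 : 0 < 1 + cabs d by lra.
exists (Num.min (r0 / 2) (Num.min r1 (e / (1 + cabs d)))).
  apply/andP; split; first by rewrite !lt_min divr_gt0//= r10 /= divr_gt0.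
  by apply: (@le_lt_trans _ _ (r0 / 2)); [rewrite ge_min lexx|rewrite ltr_pdivrMr// ltr_pMr// ltr1n].
move=> z; rewrite !le_min => /and3P[_ z1 z2]; have := H z z1; rewrite add0r => h.
rewrite (_ : g z - g 0 = (g z - g 0 - d * z) + d * z); last by rewrite subrK.
apply: (le_trans (cabsD _ _)); rewrite cabsM; move: z2; rewrite ler_pdivlMr//.
have := cabs_ge0 z; nra.
Qed.

(** The mean is the same on all circles, and near 0 the integrand is of the order of the radius;
    [r4] is small enough to bring the integral below [e]. *)
Lemma circ_pos_eq0 j r : 0 < r -> r < r0 -> circ (fun z => g z * z ^+ j.+1) r = 0.
Proof.
move=> r1 r2; apply/eqP; rewrite -cabs_eq0 eq_le cabs_ge0 andbT; apply/ler_addgt0Pr => e e0; rewrite add0r.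
have [r3 /andP[r30 r31] H3] := near0_bound ltr01.
have B0 : 0 < 1 + (1 + cabs (g 0)) * sarea R 2 by rewrite ltr_wpDr// mulr_ge0 ?addr_ge0 ?cabs_ge0 ?sarea_ge0.
set r4 := Num.min r (Num.min 1 (Num.min r3 (e / (1 + (1 + cabs (g 0)) * sarea R 2)))).
have r40 : 0 < r4 by rewrite !lt_min r1 r30 ltr01 /= divr_gt0.
have gj z : cabs z < r0 -> exists d, cdiff (fun z => g z * z ^+ j.+1) z d.
  by move=> zr; apply: cdiffM; [exact: gd|apply: cdiffX; exact: cdiff_id].
have := lexx r4; rewrite {2}/r4 !le_min => /and4P[l1 l2 l3 l4].
rewrite -(@circ_const _ r0 r4 r)//; last by move=> z _; exact: gj.
apply: (@le_trans _ _ ((1 + cabs (g 0)) * r4 * sarea R 2)).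
  apply: circ_bound => // [z zr|z zr]; first by apply: gj; rewrite zr (le_lt_trans l1).
  rewrite cabsM cabsX zr; apply: ler_pM; rewrite ?cabs_ge0 ?exprn_ge0 ?(ltW r40)//.
    have := cabs_distD (g z) (g 0); have := H3 z; rewrite zr => /(_ l3); lra.
  by rewrite exprS ler_piMr ?(ltW r40)// exprn_ile1// ltW.
move: l4; rewrite ler_pdivlMr// => l4; apply: le_trans l4.
by rewrite mulrAC mulrC ler_wpM2l ?ltW// ltrDr.
Qed.

(** The mean value property, again by shrinking the circle until [g] is within [e] of [g 0] on
    it. *)
Lemma tcoef0 : c 0 = g 0.
Proof.
apply/eqP; rewrite -subr_eq0 -cabs_eq0 eq_le cabs_ge0 andbT; apply/ler_addgt0Pr => e e0; rewrite add0r.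
have [r /andP[r1 r2] H] := near0_bound e0.
rewrite -(ler_pM2r (sarea_gt0 1)) -{1}(gtr0_norm (sarea_gt0 1)) -cabsR -cabsM mulrC mulrBr -(tcoef_const 0 r1 r2).
have gz z : cabs z = r -> exists d, cdiff (fun z => g z * z^-1 ^+ 0) z d.
  by move=> zr; apply: cdiffM; [apply: gd; rewrite zr|exact: cdiff_cst].
have -> : circ (fun z => g z * z^-1 ^+ 0) r - (sarea R 2)%:C * g 0 = circ (fun z => g z + (- g 0)) r.
  rewrite /circ sphere_intCD; [|by apply: cdiff_sccts => z; rewrite gtr0_norm// => zr; apply: gd; rewrite zr|exact: sccts_cst].
  congr (_ + _); first by apply: eq_sphere_intC => w _; rewrite expr0 mulr1.
  rewrite -sphere_intC_real mulrC -mulNr -sphere_intCZ; last exact: sccts_cst.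
  by apply: eq_sphere_intC => w _; rewrite mulr1.
apply: sphere_intC_bound.
  apply: scctsD; last exact: sccts_cst.
  by apply: cdiff_sccts => z; rewrite gtr0_norm// => zr; apply: gd; rewrite zr.
by move=> w Hw; apply: H; rewrite cabsM zof_sph// mulr1 cabsR gtr0_norm.
Qed.
End Taylor.
End Circle.


(** * Algebra and uniqueness of geometrically convergent series *)

Section GsumAlgebra.
Variable R : realType.
Implicit Types (u v : nat -> R[i]) (M x : R).

Lemma gsumZ u c M x : 0 <= x -> x < 1 -> (forall j, cabs (u j) <= M * x ^+ j) ->
  gsum (fun j => c * u j) = c * gsum u.
Proof.
move=> x0 x1 H; symmetry; apply: (@gsum_unique _ _ (cabs c * M) x) => //.
  by move=> j; rewrite cabsM -mulrA ler_wpM2l ?cabs_ge0.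
move=> e e0; have C0 := cabs_ge0 c.
have M0 : 0 <= M by have := H 0; rewrite expr0 mulr1; apply: le_trans; exact: cabs_ge0.
have B0 : 0 < 1 + cabs c * M by rewrite ltr_wpDr// mulr_ge0.
have d0 : 0 < e * (1 - x) / (1 + cabs c * M) by rewrite divr_gt0 ?mulr_gt0 ?subr_gt0.
have [N HN] := geo_small x0 x1 d0; exists N => m Nm.
rewrite -mulr_sumr -mulrBr cabsM.
apply: (@le_trans _ _ (cabs c * (M * x ^+ m / (1 - x)))); first by rewrite ler_wpM2l// gsumP.
have := HN m Nm; rewrite ltr_pdivlMr// => h.
rewrite !mulrA ler_pdivrMr ?subr_gt0//; apply: ltW; apply: le_lt_trans h.
by rewrite mulrC ler_wpM2l ?exprn_ge0// lerDr.
Qed.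
Lemma gsumD u v M M' x : 0 <= x -> x < 1 -> (forall j, cabs (u j) <= M * x ^+ j) ->
  (forall j, cabs (v j) <= M' * x ^+ j) -> gsum (fun j => u j + v j) = gsum u + gsum v.
Proof.
move=> x0 x1 H H'; symmetry; apply: (@gsum_unique _ _ (M + M') x) => //.
  by move=> j; apply: (le_trans (cabsD _ _)); rewrite mulrDl lerD.
move=> e e0.
have M0 : 0 <= M by have := H 0; rewrite expr0 mulr1; apply: le_trans; exact: cabs_ge0.
have M'0 : 0 <= M' by have := H' 0; rewrite expr0 mulr1; apply: le_trans; exact: cabs_ge0.
have B0 : 0 < 1 + (M + M') by rewrite ltr_wpDr// addr_ge0.
have d0 : 0 < e * (1 - x) / (1 + (M + M')) by rewrite divr_gt0 ?mulr_gt0 ?subr_gt0.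
have [N HN] := geo_small x0 x1 d0; exists N => m Nm.
rewrite big_split /= opprD addrACA; apply: (le_trans (cabsD _ _)).
apply: (le_trans (lerD (gsumP m x0 x1 H) (gsumP m x0 x1 H'))).
rewrite -mulrDl -mulrDl.
have := HN m Nm; rewrite ltr_pdivlMr// => h.
rewrite ler_pdivrMr ?subr_gt0//; apply: ltW; apply: le_lt_trans h.
by rewrite mulrC ler_wpM2l ?exprn_ge0// lerDr.
Qed.
Lemma gsumB u v M M' x : 0 <= x -> x < 1 -> (forall j, cabs (u j) <= M * x ^+ j) ->
  (forall j, cabs (v j) <= M' * x ^+ j) -> gsum (fun j => u j - v j) = gsum u - gsum v.
Proof.
move=> x0 x1 H H'; have vn : forall j, cabs (-1 * v j) <= M' * x ^+ j by move=> j; rewrite mulN1r cabsN.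
rewrite -mulN1r -(gsumZ _ x0 x1 H') -(gsumD x0 x1 H vn).
by apply: gsum_eq => j; rewrite mulN1r.
Qed.
Lemma gsum_fin u N : (forall j, (N <= j)%N -> u j = 0) -> gsum u = \sum_(j < N) u j.
Proof.
move=> H; symmetry.
have [M HM] : exists M, forall j, cabs (u j) <= M * (1 / 2) ^+ j.
  exists (\sum_(j < N) cabs (u j) * 2 ^+ j) => j.
  have t0 i : 0 <= cabs (u i) * 2 ^+ i by rewrite mulr_ge0 ?cabs_ge0 ?exprn_ge0.
  have [jN|jN] := ltnP j N; last first.
    by rewrite H// cabs0 mulr_ge0 ?exprn_ge0 ?sumr_ge0//; lra.
  rewrite expr_div_n expr1n mul1r -ler_pdivrMr ?invr_gt0 ?exprn_gt0// invrK.
  by rewrite (bigD1 (Ordinal jN))//= lerDl sumr_ge0.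
apply: (@gsum_unique _ _ M (1 / 2)) => //; try lra.
move=> e e0; exists N => m Nm.
rewrite -(subnKC Nm) big_split_ord /= opprD addrA subrr sub0r big1 ?oppr0 ?cabs0 ?ltW// => i _.
by rewrite H// leq_addr.
Qed.
Lemma gsum_single j a : gsum (fun i => if i == j then a else 0 : R[i]) = a.
Proof.
rewrite (@gsum_fin _ j.+1); last by move=> i ij; rewrite gtn_eqF.
rewrite big_ord_recr /= eqxx big1 ?add0r// => i _; by rewrite ltn_eqF.
Qed.

(** By strong induction: once the earlier coefficients vanish, [cabs (e j) * r ^+ j] is at most
    [B * r ^+ N] plus a tail of order [r ^+ j.+1], and division by [r ^+ j] leaves a quantity of
    order [r]. *)
Lemma ps_vanish (e : nat -> R[i]) M q N B (dl : R) : 0 <= q -> (forall j, cabs (e j) <= M * q ^+ j) ->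
  0 < dl -> (forall r : R, 0 < r -> r < dl -> cabs (gsum (fun j => e j * r%:C ^+ j)) <= B * r ^+ N) ->
  forall j, (j < N)%N -> e j = 0.
Proof.
move=> q0 H dl0 HB; elim/ltn_ind => j IH jN.
have M0 : 0 <= M by have := H 0%N; rewrite expr0 mulr1; apply: le_trans; exact: cabs_ge0.
apply/eqP; rewrite -cabs_eq0 eq_le cabs_ge0 andbT; apply/ler_addgt0Pr => ep ep0; rewrite add0r.
have B0 : 0 <= `|B| + 2 * M * q ^+ j.+1 by rewrite addr_ge0// !mulr_ge0// exprn_ge0.
have B1 : 0 < 1 + (`|B| + 2 * M * q ^+ j.+1) by lra.
have q1 : 0 < 2 * (1 + q) by lra.
(* In order: the range of the hypothesis, monotonicity of the powers of [r], a ratio [q * r] of at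
   most 1/2, and the final bound by [ep]. *)
set r := Num.min (dl / 2) (Num.min 1 (Num.min (1 / (2 * (1 + q))) (ep / (1 + (`|B| + 2 * M * q ^+ j.+1))))).
have r0 : 0 < r by rewrite !lt_min !divr_gt0//= ltr01.
have := lexx r; rewrite {2}/r !le_min => /and4P[l1 l2 l3 l4].
have qr : q * r <= 1 / 2.
  move: l3; rewrite ler_pdivlMr// => l3; nra.
have rC j' : cabs (r%:C ^+ j') = r ^+ j' by rewrite cabsX cabsR gtr0_norm.
have Hq i : cabs (e i * r%:C ^+ i) <= M * (q * r) ^+ i.
  by rewrite cabsM rC exprMn mulrA ler_wpM2r// exprn_ge0// ltW.
have qr0 : 0 <= q * r by rewrite mulr_ge0// ltW.
have qr1 : q * r < 1 by lra.
have := gsumP j.+1 qr0 qr1 Hq.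
rewrite big_ord_recr /= big1 ?add0r; last by move=> i _; rewrite IH ?mul0r// (ltn_trans (ltn_ord i)).
have rd : r < dl by lra.
have := HB r r0 rd; set G := gsum _ => h1 h2.
have h3 : cabs (e j * r%:C ^+ j) <= B * r ^+ N + M * (q * r) ^+ j.+1 / (1 - q * r).
  rewrite (_ : e j * _ = G - (G - e j * r%:C ^+ j)); last by ring.
  by apply: (le_trans (cabsD _ _)); rewrite cabsN lerD.
rewrite cabsM rC in h3.
have h4 : B * r ^+ N <= `|B| * r ^+ j.+1.
  apply: (@le_trans _ _ (`|B| * r ^+ N)); first by rewrite ler_wpM2r ?ler_norm// exprn_ge0// ltW.
  by rewrite ler_wpM2l// ler_wiXn2l// ltW.
have h5 : M * (q * r) ^+ j.+1 / (1 - q * r) <= 2 * M * q ^+ j.+1 * r ^+ j.+1.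
  rewrite ler_pdivrMr; last by lra.
  have X0 : 0 <= M * (q * r) ^+ j.+1 by rewrite !mulr_ge0// exprn_ge0// ltW.
  have -> : 2 * M * q ^+ j.+1 * r ^+ j.+1 * (1 - q * r) = (M * (q * r) ^+ j.+1) * (2 * (1 - q * r)).
    by rewrite exprMn; ring.
  by rewrite ler_peMr//; lra.
have h6 : cabs (e j) <= (`|B| + 2 * M * q ^+ j.+1) * r.
  rewrite -(ler_pM2r (exprn_gt0 j r0)).
  have -> : (`|B| + 2 * M * q ^+ j.+1) * r * r ^+ j = `|B| * r ^+ j.+1 + 2 * M * q ^+ j.+1 * r ^+ j.+1.
    by rewrite [r ^+ j.+1]exprS; ring.
  by lra.
apply: (le_trans h6); move: l4; rewrite ler_pdivlMr// => l4; nra.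
Qed.

Lemma cpeak n (d : 'rV[R]_n.+1 -> R[i]) th : sccts d -> sph th ->
  (forall N, sphere_intC (fun w => d w * (((1 + sdot w th) / 2) ^+ N)%:C) = 0) -> d th = 0.
Proof.
move=> ds Hth H.
have E N : sphere_int (fun w => complex.Re (d w) * ((1 + sdot w th) / 2) ^+ N) = 0 /\
   sphere_int (fun w => complex.Im (d w) * ((1 + sdot w th) / 2) ^+ N) = 0.
  have := H N; move=> /eqP; rewrite eq_complex => /andP[/eqP /= h1 /eqP /= h2]; split.
  - rewrite -[RHS]h1; apply: eq_sphere_int => w _; by rewrite cReM /= mulr0 subr0.
  - rewrite -[RHS]h2; apply: eq_sphere_int => w _; by rewrite cImM /= mulr0 add0r.
apply: ceqP => /=.
- by apply: (peak (sccts_Re ds) Hth) => N; exact: (E N).1.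
- by apply: (peak (sccts_Im ds) Hth) => N; exact: (E N).2.
Qed.
End GsumAlgebra.

Section PowerSeries.
Variable R : realType.
Implicit Types (z : R[i]).

Lemma zofV (w : 'rV[R]_2) : sph w -> (zof w)^-1 = (zof w)^*.
Proof.
move=> Hw; have h := mulcJE (zof w); rewrite zof_sph// expr1n in h.
by apply: (mulfI (zof_neq0 Hw)); rewrite h divff// zof_neq0.
Qed.
(** Makes the powers of the kernel Laurent polynomials in [zof w], so that their integrals against
    [g] are Cauchy integrals. *)
Lemma zof_kernel (w th : 'rV[R]_2) : sph w -> sph th ->
  ((1 + sdot w th) / 2)%:C = (zof w + zof th) ^+ 2 * (zof w)^-1 * (4 * zof th)^-1.
Proof.
move=> Hw Ht.
have e1 : (sdot w th)%:C = (zof w * (zof th)^-1 + (zof w)^-1 * zof th) / 2.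
  rewrite !zofV// /sdot big_ord_recl big_ord1 /zof.
  apply/eqP; rewrite -subr_eq0; apply/eqP; by apply: ceqP; simpc => /=; field.
have E (x : R) : ((1 + x) / 2)%:C = (1 + x%:C) / 2 :> R[i].
  by rewrite rmorphM rmorphD fmorphV rmorph1 rmorph_nat.
rewrite E e1.
have n1 := zof_neq0 Hw; have n2 := zof_neq0 Ht.
by field; rewrite n1 n2.
Qed.

Section Taylor.
Variables (g : R[i] -> R[i]) (r0 : R).
Hypothesis r00 : 0 < r0.
Hypothesis gd : forall z, cabs z < r0 -> exists d, cdiff g z d.
Let c := tcoef g (r0 / 2).

(** On the circle through [z], the function and its series have the same integrals against all
    [zof w ^+ a * (zof w)^-1 ^+ b]. Their difference is then orthogonal to the powers of the kernel,
    and [cpeak] applies at the direction of [z]. *)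
Lemma taylor z : cabs z < r0 -> g z = gsum (fun j => c j * z ^+ j).
Proof.
move=> zr; have [->|z0] := eqVneq z 0.
  rewrite (@gsum_fin _ _ 1); last by case=> // j _; rewrite expr0n mulr0.
  by rewrite big_ord1 expr0 mulr1 /c (tcoef0 r00 gd).
have [th [Hth ->]] := polar_zof z0.
have z1 : 0 < cabs z by rewrite cabs_gt0.
set r := cabs z in zr z1 *.
have r1 : r < (r + r0) / 2 by lra.
have [||M HM] := @tcoef_geo _ g r0 gd ((r + r0) / 2); [by lra|by lra|].
set x := r * ((r + r0) / 2)^-1.
have x0 : 0 <= x by rewrite mulr_ge0 ?invr_ge0//; lra.
have x1 : x < 1 by rewrite ltr_pdivrMr; lra.
pose u j (w : 'rV[R]_2) := c j * (r%:C * zof w) ^+ j.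
have us j : sccts (u j).
  move=> w Hw; apply: cctsM; first exact: ccts_cst.
  by apply: cctsX; apply: cctsM; [exact: ccts_cst|exact: zof_cont].
have rz (w : 'rV[R]_2) : sph w -> cabs (r%:C * zof w) = r by move=> Hw; rewrite cabsM zof_sph// mulr1 cabsR gtr0_norm.
have ub j (w : 'rV[R]_2) : sph w -> cabs (u j w) <= M * x ^+ j.
  move=> Hw; rewrite cabsM cabsX rz// /x exprMn mulrCA [leRHS]mulrC ler_wpM2r//.
  by rewrite exprn_ge0// ltW.
pose d (w : 'rV[R]_2) := g (r%:C * zof w) - gsum (fun j => u j (nrm w)).
have gs : sccts (fun w => g (r%:C * zof w)).
  by apply: cdiff_sccts => y; rewrite gtr0_norm// => yr; apply: gd; rewrite yr.
have uu : sccts (fun w => gsum (fun j => u j (nrm w))) := sccts_gsum x0 x1 us ub.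
have ds : sccts d := scctsD gs (scctsN uu).
suff : d th = 0 by move/eqP; rewrite /d subr_eq0 => /eqP ->; rewrite nrm_sph.
pose T a b (w : 'rV[R]_2) := zof w ^+ a * (zof w)^-1 ^+ b.
have Ts a b : sccts (T a b).
  by move=> w Hw; apply: cctsM; apply: cctsX; [exact: zof_cont|exact: zofV_sccts].
have Tb a b (w : 'rV[R]_2) : sph w -> cabs (T a b w) = 1.
  by move=> Hw; rewrite cabsM !cabsX cabsV zof_sph// invr1 !expr1n mulr1.
have A0 := @sareaC R.
have I2 a b : sphere_intC (fun w => gsum (fun j => u j (nrm w)) * T a b w) =
   gsum (fun j => c j * r%:C ^+ j * (if (j + a == b)%N then (sarea R 2)%:C else 0)).
  have uTs j : sccts (fun w => u j w * T a b w) := scctsM (us j) (Ts a b).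
  have uTb j (w : 'rV[R]_2) : sph w -> cabs (u j w * T a b w) <= M * x ^+ j.
    by move=> Hw; rewrite cabsM Tb// mulr1 ub.
  transitivity (sphere_intC (fun w => gsum (fun j => u j w * T a b w))).
    apply: eq_sphere_intC => w Hw; rewrite mulrC nrm_sph// -(gsumZ _ x0 x1 (fun j => ub j w Hw)).
    by apply: gsum_eq => j; rewrite mulrC.
  rewrite (sphere_intC_gsum x0 x1 uTs uTb); apply: gsum_eq => j.
  rewrite -(@circ_pow R (j + a) b) -(sphere_intCZ _ (Ts (j + a)%N b)).
  by apply: eq_sphere_intC => w _; rewrite /u /T exprMn exprD; ring.
have I1 a b : sphere_intC (fun w => g (r%:C * zof w) * T a b w) =
   gsum (fun j => c j * r%:C ^+ j * (if (j + a == b)%N then (sarea R 2)%:C else 0)).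
  have rC : r%:C != 0 :> R[i] by rewrite -cabs_gt0 cabsR gtr0_norm.
  (* For [a <= b] the integral is a Taylor coefficient; for [a > b] it is a mean of
     [g z * z ^+ (a - b)], zero by [circ_pos_eq0]. *)
  have [ab|ab] := leqP a b.
    rewrite (_ : (fun j => _) = fun j => if j == (b - a)%N then c (b - a)%N * r%:C ^+ (b - a) * (sarea R 2)%:C else 0); last first.
      apply/funext => j; have -> : (j + a == b)%N = (j == b - a)%N by rewrite -{1}(subnK ab) eqn_add2r.
      by case: eqP => [->//|_]; rewrite mulr0.
    rewrite gsum_single.
    have h : circ (fun z => g z * z^-1 ^+ (b - a)) r = (sarea R 2)%:C * c (b - a)%N := tcoef_const gd (b - a) z1 zr.
    rewrite mulrAC mulrC [c _ * _]mulrC -h -sphere_intCZ.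
      apply: eq_sphere_intC => w Hw; rewrite /T -{1}(subnK ab) exprD.
      have n1 : zof w ^+ a * (zof w)^-1 ^+ a = 1 by rewrite -exprMn divff ?zof_neq0// expr1n.
      have n2 : r%:C ^+ (b - a) * r%:C^-1 ^+ (b - a) = 1 :> R[i] by rewrite -exprMn divff// expr1n.
      rewrite invfM exprMn [zof w ^+ a * _]mulrCA n1 mulr1 [RHS]mulrCA [X in _ = _ * X]mulrA n2 mul1r.
      by [].
    apply: (@cdiff_sccts _ (fun z => g z * z^-1 ^+ (b - a)) r) => y; rewrite gtr0_norm// => yr; apply: cdiffM; first by apply: gd; rewrite yr.
    by apply: (@cdiffX _ (fun z => z^-1)); apply: cdiffV; rewrite -cabs_gt0 yr.
  rewrite (_ : (fun j => _) = fun j => if j == 0%N then 0 else 0); last first.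
    apply/funext => j; have -> : (j + a == b)%N = false by rewrite gtn_eqF// ltn_addl.
    by rewrite mulr0 if_same.
  rewrite gsum_single.
  have h := circ_pos_eq0 r00 gd (a - b).-1 z1 zr.
  rewrite prednK ?subn_gt0// in h.
  rewrite -[RHS](mulr0 (r%:C^-1 ^+ (a - b))) -h -sphere_intCZ.
    apply: eq_sphere_intC => w Hw; rewrite /T -{1}(subnK (ltnW ab)) exprD.
    have n1 : zof w ^+ b * (zof w)^-1 ^+ b = 1 by rewrite -exprMn divff ?zof_neq0// expr1n.
    have n2 : r%:C^-1 ^+ (a - b) * r%:C ^+ (a - b) = 1 :> R[i] by rewrite -exprMn mulVf// expr1n.
    by rewrite exprMn -mulrA n1 mulr1 [RHS]mulrCA [X in _ = _ * X]mulrA n2 mul1r.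
  apply: (@cdiff_sccts _ (fun z => g z * z ^+ (a - b)) r) => y; rewrite gtr0_norm// => yr; apply: cdiffM; first by apply: gd; rewrite yr.
  by apply: cdiffX; exact: cdiff_id.
apply: (cpeak ds Hth) => N.
have Id a b : sphere_intC (fun w => d w * T a b w) = 0.
  transitivity (sphere_intC (fun w => g (r%:C * zof w) * T a b w + (-1) * (gsum (fun j => u j (nrm w)) * T a b w))).
    by apply: eq_sphere_intC => w _; rewrite /d; ring.
  have s1 : sccts (fun w => gsum (fun j => u j (nrm w)) * T a b w) := scctsM uu (Ts a b).
  rewrite (sphere_intCD (scctsM gs (Ts a b)) (scctsZ (-1) s1)) (sphere_intCZ (-1) s1).
  by rewrite I1 I2 mulN1r subrr.
(* By the binomial theorem the [N]-th power of the kernel is a combination of the [T i N] with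
   [i <= 2 N]. *)
transitivity (sphere_intC (fun w => \sum_(i < (2 * N).+1) (zof th ^+ (2 * N - i) *+ 'C(2 * N, i) * (4 * zof th)^-1 ^+ N) * (d w * T i N w))).
  apply: eq_sphere_intC => w Hw.
  have -> : (((1 + sdot w th) / 2) ^+ N)%:C = (((1 + sdot w th) / 2)%:C) ^+ N by rewrite rmorphXn.
  rewrite zof_kernel//.
  have E (p q t : R[i]) : (p ^+ 2 * q * t) ^+ N = p ^+ (2 * N) * q ^+ N * t ^+ N.
    by rewrite exprMn exprMn -exprM.
  rewrite E addrC exprDn mulr_suml mulr_suml mulr_sumr.
  have F (p q t s v : R[i]) m : v * (p * q *+ m * t * s) = (p *+ m * s) * (v * (q * t)).
    by rewrite !mulrnAl !mulrnAr; congr (_ *+ _); ring.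
  by apply: eq_bigr => i _; exact: F.
rewrite sphere_intC_sum => [|i]; last exact: (scctsZ _ (scctsM ds (Ts i N))).
by apply: big1 => i _; rewrite (sphere_intCZ _ (scctsM ds (Ts i N))) Id mulr0.
Qed.
End Taylor.

Lemma ps_cdiff (c : nat -> R[i]) (r0 : R) :
  (forall r, 0 < r -> r < r0 -> exists M, forall j, cabs (c j) <= M * r^-1 ^+ j) ->
  forall z, cabs z < r0 -> exists d, cdiff (fun z => gsum (fun j => c j * z ^+ j)) z d.
Proof.
move=> H z zr; have z0 := cabs_ge0 z.
set a := cabs z in z0 zr *.
have [||M HM] := H ((a + r0) / 2); [by lra|by lra|].
set r := (a + r0) / 2 in HM.
have r1 : 0 < r by rewrite /r; lra.
(* With this [s] the sum [a + s] stays below [r], so the series remains geometric on the disc of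
   radius [s] around [z]. *)
set s := (r - a) / 2; have s0 : 0 < s by rewrite /s /r; lra.
set x := (a + s) / r.
have x0 : 0 <= x by rewrite divr_ge0// ?addr_ge0// ltW.
have x1 : x < 1 by rewrite ltr_pdivrMr// mul1r /s /r; lra.
have M0 : 0 <= M by have := HM 0%N; rewrite expr0 mulr1; apply: le_trans; exact: cabs_ge0.
pose D j := (z ^+ j.-1) *+ j.
(* Binomial expansion with the terms of order >= 2 rescaled to |w| = s. *)
have bin j w : cabs w <= s -> cabs ((z + w) ^+ j - z ^+ j - D j * w) <= (cabs w / s) ^+ 2 * (a + s) ^+ j.
  move=> ws; have w0 := cabs_ge0 w; have s1 := ltW s0.
  case: j => [|[|j]]; rewrite /D.
  - by rewrite !expr0 mulr0n mul0r subrr subr0 cabs0 mulr1 exprn_ge0// divr_ge0.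
  - by rewrite !expr1 expr0 mulr1n mul1r addrAC addrK subrr cabs0 mulr_ge0 ?addr_ge0// exprn_ge0// divr_ge0.
  rewrite !exprDn big_ord_recl [in X in _ <= X]big_ord_recl /= subn0 expr0 mulr1 bin0 mulr1n.
  rewrite big_ord_recl [in X in _ <= X]big_ord_recl /= /bump /= expr1 bin1 subn1 /=.
  set S := \sum_(i < j.+1) _.
  rewrite (_ : _ - _ - _ = S); last by rewrite -mulrnAl; ring.
  apply: (le_trans (cabs_sum _ _ _)).
  apply: (@le_trans _ _ (\sum_(i < j.+1) (cabs w / s) ^+ 2 * (a ^+ (j.+2 - (1 + (1 + i))) * s ^+ (1 + (1 + i)) *+ 'C(j.+2, 1 + (1 + i))))).
    apply: ler_sum => i _; rewrite cabsMn cabsM !cabsX -/a mulrnAr ler_wMn2r//.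
    rewrite [leRHS]mulrCA ler_wpM2l ?exprn_ge0//.
    have -> : cabs w ^+ (1 + (1 + i)) = (cabs w / s) ^+ (1 + (1 + i)) * s ^+ (1 + (1 + i)).
      by rewrite -exprMn divfK// gt_eqF.
    rewrite ler_wpM2r ?exprn_ge0//; apply: ler_wiXn2l => //; first by rewrite divr_ge0.
    by rewrite ler_pdivrMr// mul1r.
  rewrite -mulr_sumr; apply: ler_wpM2l; first by rewrite exprn_ge0// (divr_ge0 w0 s1).
  rewrite addrA lerDr; apply: addr_ge0; apply: mulrn_wge0; exact: (mulr_ge0 (exprn_ge0 _ z0) (exprn_ge0 _ s1)).
have D1 j : cabs (D j) <= s^-1 * (a + s) ^+ j.
  have s1 := ltW s0; case: j => [|j].
    by rewrite /D mulr0n cabs0 mulr_ge0 ?exprn_ge0 ?invr_ge0 ?addr_ge0.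
  rewrite mulrC ler_pdivlMr// /D /= exprDn (bigD1 (lift ord0 ord0))//= /bump /= expr1 bin1 subn1 /=.
  rewrite cabsMn cabsX -/a mulrnAl lerDl; apply: sumr_ge0 => i _.
  by apply: mulrn_wge0; exact: (mulr_ge0 (exprn_ge0 _ z0) (exprn_ge0 _ s1)).
have cb j : cabs (c j) * (a + s) ^+ j <= M * x ^+ j.
  by rewrite /x exprMn mulrCA [leRHS]mulrC ler_wpM2r// exprn_ge0// addr_ge0// ltW.
have geo w : cabs w <= s -> forall j, cabs (c j * (z + w) ^+ j) <= M * x ^+ j.
  move=> ws j; rewrite cabsM cabsX; apply: le_trans (cb j).
  rewrite ler_wpM2l ?cabs_ge0// lerXn2r ?nnegrE ?cabs_ge0 ?addr_ge0 ?(ltW s0)//.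
  by apply: (le_trans (cabsD _ _)); rewrite lerD2l.
have geoD j : cabs (c j * D j) <= s^-1 * M * x ^+ j.
  rewrite cabsM -mulrA; apply: (le_trans (ler_wpM2l (cabs_ge0 _) (D1 j))).
  by rewrite mulrCA ler_wpM2l// invr_ge0 ltW.
exists (gsum (fun j => c j * D j)) => e e0.
have K0 : 0 < 1 + M / (1 - x) / s ^+ 2 by rewrite ltr_wpDr// !divr_ge0 ?exprn_ge0 ?subr_ge0// ltW.
exists (Num.min s (e / (1 + M / (1 - x) / s ^+ 2))); first by rewrite lt_min s0 divr_gt0.
move=> w; rewrite le_min => /andP[ws we].
have g0 : forall j, cabs (c j * z ^+ j) <= M * x ^+ j.
  by move=> j; have := geo 0 _ j; rewrite addr0; apply; rewrite cabs0 ltW.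
have gDw j : cabs (w * (c j * D j)) <= (cabs w * (s^-1 * M)) * x ^+ j.
  by rewrite cabsM -[leRHS]mulrA ler_wpM2l ?cabs_ge0.
have g1 j : cabs (c j * (z + w) ^+ j - c j * z ^+ j) <= (M + M) * x ^+ j.
  apply: (le_trans (cabsD _ _)); rewrite cabsN mulrDl lerD// geo//.
rewrite [gsum _ * w]mulrC -(gsumZ w x0 x1 geoD) -(gsumB x0 x1 (geo w ws) g0) -(gsumB x0 x1 g1 gDw).
have fin j : cabs (c j * (z + w) ^+ j - c j * z ^+ j - w * (c j * D j)) <= ((cabs w / s) ^+ 2 * M) * x ^+ j.
  rewrite (_ : _ - _ = c j * ((z + w) ^+ j - z ^+ j - D j * w)); last by ring.
  rewrite cabsM; apply: (le_trans (ler_wpM2l (cabs_ge0 _) (bin j w ws))).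
  by rewrite mulrCA -mulrA ler_wpM2l// exprn_ge0// divr_ge0 ?cabs_ge0// ltW.
apply: (le_trans (gsum_le x0 x1 fin)).
move: we; rewrite ler_pdivlMr// => we; have w0 := cabs_ge0 w.
rewrite (_ : (cabs w / s) ^+ 2 * M / (1 - x) = cabs w * (cabs w * (M / (1 - x) / s ^+ 2))); last first.
  by field; rewrite gt_eqF// subr_eq0 gt_eqF.
rewrite [e * _]mulrC ler_wpM2l//; apply: le_trans we; rewrite ler_wpM2l// lerDr//.
Qed.
End PowerSeries.


(** * Harmonic polynomials on the sphere *)

Section Wallis.
Variable R : realType.

Definition wallis (a b : nat) : R := rint 0 pi (fun t => cos t ^+ a * sin t ^+ b).

Lemma is_derive_pow (f : R -> R) (t d : R) k : is_derive t (1 : R) f d ->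
  is_derive t (1 : R) (fun x => f x ^+ k) (k%:R * f t ^+ k.-1 * d).
Proof.
move=> H; elim: k => [|k IH].
  rewrite mul0r mul0r; exact: (is_derive_cst (1 : R) t (1 : R)).
rewrite (_ : (fun x => _) = (fun x => f x * f x ^+ k)); last by apply/funext => x; rewrite exprS.
have := @is_deriveM R R f (fun x => f x ^+ k) t 1 _ _ H IH.
move=> K; apply: is_derive_eq; rewrite /GRing.scale /=.
by case: (k) => [|k']; rewrite ?expr0 ?exprS ?mulrSr /=; ring.
Qed.

Lemma wallis_cts a b : @cts_on R 0 pi (fun t => cos t ^+ a * sin t ^+ b).
Proof. by move=> t _; apply: contM; apply: contX; [exact: continuous_cos|exact: continuous_sin]. Qed.

Lemma is_derive_wallis a b (t : R) : is_derive t (1 : R) (fun x => cos x ^+ a * sin x ^+ b)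
  (b%:R * (cos t ^+ a.+1 * sin t ^+ b.-1) - a%:R * (cos t ^+ a.-1 * sin t ^+ b.+1)).
Proof.
have K := @is_deriveM R R _ _ t 1 _ _ (is_derive_pow a (is_derive_cos t)) (is_derive_pow b (is_derive_sin t)).
apply: is_derive_eq; rewrite /GRing.scale /= !exprS; ring.
Qed.

(** [cos t ^+ a * sin t ^+ s.+1] vanishes at 0 and [pi], so its derivative integrates to 0. When
    [a = 0] the truncated [a.-1] comes with the factor 0. *)
Lemma wallis_cos a s : (a + s).+1%:R * wallis a.+1 s = a%:R * wallis a.-1 s.
Proof.
have E t : (s.+1%:R * (cos t ^+ a.+1 * sin t ^+ s) - a%:R * (cos t ^+ a.-1 * sin t ^+ s.+2)) =
   ((a + s).+1%:R * (cos t ^+ a.+1 * sin t ^+ s) - a%:R * (cos t ^+ a.-1 * sin t ^+ s) : R).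
  have := sin2cos2 t; case: (a) => [|a']; rewrite /= ?mul0r ?subr0 ?add0n// => h.
  rewrite -[s.+2]addn2 exprD h !exprS -[(a'.+1 + s).+1]addn1 -[s.+1]addn1 !natrD; ring.
have cZ (k : nat) a' b' : @cts_on R 0 pi (fun t => k%:R * (cos t ^+ a' * sin t ^+ b')).
  by move=> t Ht; apply: contM; [exact: cont_cst|exact: wallis_cts].
have := @rint_FTC R 0 pi _ _ (pi_gt0 R) _ (is_derive_wallis a s.+1).
rewrite sinpi sin0 !exprS !mul0r !mulr0 subr0 => /(_ _)/wrap[].
  by move=> t Ht; apply: (@cvgB R R); [exact: cZ|exact: cZ].
under eq_rint do rewrite /= E.
rewrite rintB; [|exact: cZ|exact: cZ].
rewrite !rintZ; [|exact: wallis_cts|exact: wallis_cts].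
by move/eqP; rewrite subr_eq0 => /eqP.
Qed.

Lemma wallis_sin a s : (0 < s)%N -> (a + s).+1%:R * wallis a s.+1 = s%:R * wallis a s.-1.
Proof.
case: s => // s _ /=.
have E t : (s.+1%:R * (cos t ^+ a.+2 * sin t ^+ s) - a.+1%:R * (cos t ^+ a * sin t ^+ s.+2)) =
   (s.+1%:R * (cos t ^+ a * sin t ^+ s) - (a + s.+1).+1%:R * (cos t ^+ a * sin t ^+ s.+2) : R).
  have := cos2sin2 t => h.
  rewrite -[a.+2]addn2 exprD h !exprS -[(a + s.+1).+1]addn1 -addSnnS -[a.+1]addn1 -[s.+1]addn1 !natrD; ring.
have cZ (k : nat) a' b' : @cts_on R 0 pi (fun t => k%:R * (cos t ^+ a' * sin t ^+ b')).
  by move=> t Ht; apply: contM; [exact: cont_cst|exact: wallis_cts].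
have := @rint_FTC R 0 pi _ _ (pi_gt0 R) _ (is_derive_wallis a.+1 s.+1).
rewrite sinpi sin0 [0 ^+ s.+1]exprS mul0r !mulr0 subr0 => /(_ _)/wrap[].
  by move=> t Ht; apply: (@cvgB R R); [exact: cZ|exact: cZ].
under eq_rint do rewrite /= E.
rewrite rintB; [|exact: cZ|exact: cZ].
rewrite !rintZ; [|exact: wallis_cts|exact: wallis_cts].
by move/eqP; rewrite subr_eq0 => /eqP.
Qed.
End Wallis.

Section Monomials.
Variable R : realType.

Definition mono n (al : 'I_n -> nat) (w : 'rV[R]_n) : R := \prod_i w ord0 i ^+ al i.
Definition tl n (al : 'I_n.+1 -> nat) : 'I_n -> nat := fun i => al (lift ord0 i).
Definition incr n (al : 'I_n -> nat) i : 'I_n -> nat := fun j => (al j + (j == i))%N.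
(** Truncated at 0; in [mono_int_rec] the factor [al i] is then 0. *)
Definition decr n (al : 'I_n -> nat) i : 'I_n -> nat := fun j => (al j - (j == i))%N.

Lemma mono_scont n (al : 'I_n -> nat) : scont (mono al).
Proof.
move=> w _; rewrite /mono.
have : forall r : seq 'I_n, {for w, continuous (fun v : 'rV[R]_n => \prod_(i <- r) v ord0 i ^+ al i)}.
  elim=> [|i r IH].
    by under [X in {for _, continuous X}]eq_fun do rewrite big_nil; exact: cont_cst.
  rewrite (_ : (fun v => _) = (fun v : 'rV[R]_n => v ord0 i ^+ al i * \prod_(j <- r) v ord0 j ^+ al j)).
    have h1 : {for w, continuous (fun v : 'rV[R]_n => v ord0 i ^+ al i)} by apply: contX; exact: cont_coord.
    exact: (contM h1 IH).
  by apply/funext => v; rewrite big_cons.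
exact.
Qed.
Lemma mono_slice m (al : 'I_m.+2 -> nat) t (w : 'rV[R]_m.+1) :
  mono al (slice t w) = cos t ^+ al ord0 * sin t ^+ (\sum_i tl al i) * mono (tl al) w.
Proof.
rewrite /mono big_ord_recl slice0 -mulrA; congr (_ * _).
rewrite (eq_bigr (fun i => sin t ^+ tl al i * w ord0 i ^+ tl al i)); last first.
  by move=> i _; rewrite sliceS exprMn.
by rewrite big_split /= expr_sum.
Qed.
Lemma mono_int m (al : 'I_m.+2 -> nat) : sphere_int (mono al) =
  wallis R (al ord0) (\sum_i tl al i + m) * sphere_int (mono (tl al)).
Proof.
rewrite sphere_intS mulrC -rintZ; last exact: wallis_cts.
apply: eq_rint => t _.
transitivity (sin t ^+ m * (cos t ^+ al ord0 * sin t ^+ (\sum_i tl al i) * sphere_int (mono (tl al)))).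
  congr (_ * _); rewrite -sphere_intZ; last exact: mono_scont.
  by apply: eq_sphere_int => w _; exact: mono_slice.
by rewrite exprD; ring.
Qed.

Lemma sum_incr n (al : 'I_n -> nat) i : (\sum_j incr al i j = (\sum_j al j).+1)%N.
Proof.
rewrite /incr big_split /=; have -> : (\sum_j (j == i) = 1)%N; last by rewrite addn1.
by rewrite (bigD1 i)//= eqxx big1// => j /negbTE ->.
Qed.
Lemma sum_decr n (al : 'I_n -> nat) i : (0 < al i)%N -> (\sum_j decr al i j = (\sum_j al j).-1)%N.
Proof.
move=> ai; have E : incr (decr al i) i = al.
  by apply/funext => j; rewrite /incr /decr; case: eqP => [->|_]; rewrite ?subn0 ?addn0// subnK.
by rewrite -{2}E sum_incr.
Qed.

(** The divergence theorem on the sphere for monomials, by induction on the dimension through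
    [mono_int] and the Wallis recursions. The vanishing clause is separate because on the sphere of
    R^1 with [al] zero the factor on the left is 0 and the identity says nothing. *)
Lemma mono_int_rec n (al : 'I_n.+1 -> nat) i :
  (al i = 0%N -> @sphere_int R _ (mono (incr al i)) = 0) /\
  (\sum_j al j + n)%:R * @sphere_int R _ (mono (incr al i)) = (al i)%:R * sphere_int (mono (decr al i)).
Proof.
elim: n al i => [|m IH] al i.
  have E (be : 'I_1 -> nat) : sphere_int (mono be) = 1 + (-1) ^+ be ord0 :> R.
    by rewrite /= /mono !big_ord1 !mxE expr1n.
  rewrite !E big_ord1 addn0 /incr /decr !ord1 eqxx.
  split=> [->|]; first by rewrite expr1 subrr.
  case: (al 0) => [|a]; first by rewrite !mul0r.
  by rewrite addn1 subn1 /= !exprS; congr (_ * _); ring.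
rewrite !mono_int; case: (unliftP ord0 i) => [j ->|->].
- have t1 : tl (incr al (lift ord0 j)) = incr (tl al) j.
    by apply/funext => k; rewrite /tl /incr (inj_eq lift_inj).
  have t2 : tl (decr al (lift ord0 j)) = decr (tl al) j.
    by apply/funext => k; rewrite /tl /decr (inj_eq lift_inj).
  have i0 : incr al (lift ord0 j) ord0 = al ord0 by rewrite /incr addn0.
  have d0 : decr al (lift ord0 j) ord0 = al ord0 by rewrite /decr subn0.
  rewrite t1 t2 i0 d0 sum_incr; have [Z M] := IH (tl al) j.
  have [a0|a0] := posnP (al (lift ord0 j)).
    by rewrite Z// a0; split => //; rewrite !(mulr0, mul0r).
  split; first by move=> h; rewrite h in a0.
  rewrite sum_decr// big_ord_recl -/(tl al _).
  set b := (\sum_j0 tl al j0)%N in M *.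
  have b0 : (0 < b)%N.
    by rewrite /b (bigD1 j)//= ltn_addr.
  have W := @wallis_sin R (al ord0) (b + m) _.
  rewrite ltn_addr// in W; have {}W := W isT.
  have -> : (b.-1 + m = (b + m).-1)%N by lia.
  have -> : (al ord0 + b + m.+1 = (al ord0 + (b + m)).+1)%N by lia.
  by rewrite mulrA W mulrAC M /tl; ring.
- have t1 : tl (incr al ord0) = tl al by apply/funext => k; rewrite /tl /incr addn0.
  have t2 : tl (decr al ord0) = tl al by apply/funext => k; rewrite /tl /decr subn0.
  rewrite t1 t2 /incr /decr eqxx addn1 subn1.
  have -> : (\sum_j al j = al ord0 + \sum_j tl al j)%N by rewrite big_ord_recl.
  set b := (\sum_j tl al j)%N.
  have W := @wallis_cos R (al ord0) (b + m).
  split=> [a0|].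
    rewrite a0 add0n mul0r in W *; move/eqP : W.
    by rewrite mulf_eq0 pnatr_eq0 /= => /eqP ->; rewrite mul0r.
  have -> : (al ord0 + b + m.+1 = (al ord0 + (b + m)).+1)%N by lia.
  by rewrite mulrA W mulrA.
Qed.
End Monomials.

(** * Orthogonality of harmonic polynomials and the Fischer decomposition *)

Section PolyInt.
Variables (R : realType) (n : nat).
Let N := n.+2.
Implicit Types P Q H : mpoly N R[i].

Definition pint P : R[i] := sphere_intC (mpoly_at P).
Definition Xi (i : 'I_N) : mpoly N R[i] := mpolyX R[i] (mnm1 i).
Definition lap P : mpoly N R[i] := \sum_i mderiv i (mderiv i P).
Definition r2 : mpoly N R[i] := \sum_i Xi i ^+ 2.

Lemma mpoly_atX (m : multinom N) w : mpoly_at (mpolyX R[i] m) w = (mono m w)%:C.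
Proof. by rewrite /mpoly_at mevalX /mono rmorph_prod; apply: eq_bigr => i _; rewrite rmorphXn. Qed.
Lemma mpoly_atD P Q w : mpoly_at (P + Q) w = mpoly_at P w + mpoly_at Q w.
Proof. exact: mevalD. Qed.
Lemma mpoly_atM P Q w : mpoly_at (P * Q) w = mpoly_at P w * mpoly_at Q w.
Proof. exact: mevalM. Qed.
Lemma mpoly_atZ c P w : mpoly_at (c *: P) w = c * mpoly_at P w.
Proof. exact: mevalZ. Qed.
Lemma mpoly_at_sum (I : Type) (r : seq I) (F : I -> mpoly N R[i]) w :
  mpoly_at (\sum_(i <- r) F i) w = \sum_(i <- r) mpoly_at (F i) w.
Proof. by rewrite /mpoly_at raddf_sum. Qed.
Lemma mpoly_at_sccts P : sccts (mpoly_at P).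
Proof.
rewrite [P]mpolyE => w Hw.
rewrite (_ : mpoly_at _ = fun w => \sum_(m <- msupp P) mcoeff m P * (mono m w)%:C).
  apply: ccts_sum => m; apply: cctsM; first exact: ccts_cst.
  by apply: ccts_real; exact: mono_scont.
by apply/funext => v; rewrite mpoly_at_sum; apply: eq_bigr => m _; rewrite mpoly_atZ mpoly_atX.
Qed.
Lemma pintD P Q : pint (P + Q) = pint P + pint Q.
Proof.
rewrite /pint -sphere_intCD; try exact: mpoly_at_sccts.
by apply: eq_sphere_intC => w _; exact: mpoly_atD.
Qed.
Lemma pintZ c P : pint (c *: P) = c * pint P.
Proof.
rewrite /pint -sphere_intCZ; last exact: mpoly_at_sccts.
by apply: eq_sphere_intC => w _; exact: mpoly_atZ.
Qed.
Lemma pint0 : pint 0 = 0.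
Proof. by rewrite -(scale0r (0 : mpoly N R[i])) pintZ mul0r. Qed.
Lemma pint_sum (I : Type) (r : seq I) (F : I -> mpoly N R[i]) :
  pint (\sum_(i <- r) F i) = \sum_(i <- r) pint (F i).
Proof. by elim: r => [|i r IH]; rewrite ?big_nil ?pint0// !big_cons pintD IH. Qed.

Definition hom d P := P \is ishomog1 d (@mdeg N).

Lemma homP d P : hom d P <-> forall m, m \in msupp P -> mdeg m = d.
Proof. by split=> [/dhomogP H m /H|H]//; apply/dhomogP => m /H. Qed.
Lemma hom0 d : hom d 0. Proof. exact: dhomog0. Qed.
Lemma homD d P Q : hom d P -> hom d Q -> hom d (P + Q).
Proof. exact: dhomogD. Qed.
Lemma homZ d c P : hom d P -> hom d (c *: P). Proof. exact: dhomogZ. Qed.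
Lemma homM d e P Q : hom d P -> hom e Q -> hom (d + e) (P * Q). Proof. exact: dhomogM. Qed.
Lemma hom_sum d (I : Type) (r : seq I) (F : I -> mpoly N R[i]) :
  (forall i, hom d (F i)) -> hom d (\sum_(i <- r) F i).
Proof. by move=> H; elim: r => [|i r IH]; rewrite ?big_nil ?big_cons; [exact: hom0|exact: homD]. Qed.
Lemma homX (m : multinom N) : hom (mdeg m) (mpolyX R[i] m).
Proof. by rewrite /hom dhomogX. Qed.
Lemma hom_Xi i : hom 1 (Xi i).
Proof. by have := homX (mnm1 i); rewrite mdeg1. Qed.
Lemma hom_deriv d i P : hom d.+1 P -> hom d (mderiv i P).
Proof.
move=> /homP H; apply/homP => m; rewrite mcoeff_msupp mcoeff_deriv => h.
have : mnm_add m (mnm1 i) \in msupp P.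
  by rewrite mcoeff_msupp; apply: contraNneq h => ->; rewrite mul0rn.
by move=> /H; rewrite mdegD mdeg1 addn1 => -[].
Qed.
Lemma hom0_deriv i P : hom 0 P -> mderiv i P = 0.
Proof.
move=> /homP H; apply/mpolyP => m; rewrite mcoeff_deriv mcoeff0.
have [h|h] := boolP (mnm_add m (mnm1 i) \in msupp P).
  by have := H _ h; rewrite mdegD mdeg1 addn1.
by rewrite mcoeff_msupp negbK in h; rewrite (eqP h) mul0rn.
Qed.

(** [mono_int_rec] extended by linearity: homogeneity gives all monomials the same factor, the
    degree plus the dimension minus one. *)
Lemma pint_Xi d i P : hom d P -> (d + n.+1)%:R * pint (Xi i * P) = pint (mderiv i P).
Proof.
move=> /homP H.
have -> : pint (mderiv i P) = \sum_(m <- msupp P) pint (mderiv i (mcoeff m P *: mpolyX R[i] m)).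
  by rewrite {1}[P]mpolyE raddf_sum pint_sum.
rewrite {1}[P]mpolyE mulr_sumr pint_sum mulr_sumr.
rewrite big_seq [RHS]big_seq; apply: eq_bigr => m Hm.
have e1 c : Xi i * (c *: mpolyX R[i] m) = c *: mpolyX R[i] (mnm_add (mnm1 i) m).
  by rewrite -scalerAr /Xi -mpolyXD.
have e2 c : mderiv i (c *: mpolyX R[i] m) = c *: ((m i)%:R *: mpolyX R[i] (mnm_sub m (mnm1 i))).
  by rewrite mderivZ mderivX.
suff K : (d + n.+1)%:R * pint (mpolyX R[i] (mnm_add (mnm1 i) m)) =
    (m i)%:R * pint (mpolyX R[i] (mnm_sub m (mnm1 i))).
  by rewrite e1 e2 pintZ pintZ pintZ [LHS]mulrCA K.
rewrite /pint.
have E (m' : multinom N) (be : 'I_N -> nat) : (forall j, m' j = be j) ->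
    sphere_intC (mpoly_at (mpolyX R[i] m')) = (sphere_int (mono be))%:C.
  move=> he; rewrite -sphere_intC_real; apply: eq_sphere_intC => w _; rewrite mpoly_atX; congr _%:C.
  by apply: eq_bigr => j _; rewrite he.
rewrite (E _ (incr m i)); last by move=> j; rewrite mnmDE mnm1E /incr addnC eq_sym.
rewrite (E _ (decr m i)); last by move=> j; rewrite mnmBE mnm1E /decr eq_sym.
have [_ K] := mono_int_rec R m i; rewrite -mdegE (H m Hm) in K.
by rewrite -!(rmorph_nat (real_complex R)) -!rmorphM K.
Qed.

Lemma euler d P : hom d P -> \sum_i Xi i * mderiv i P = d%:R *: P.
Proof.
move=> /homP H.
transitivity (\sum_(m <- msupp P) (mcoeff m P * d%:R) *: mpolyX R[i] m); last first.
  rewrite {3}[P]mpolyE scaler_sumr; apply: eq_bigr => m _; by rewrite scalerA mulrC.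
transitivity (\sum_i \sum_(m <- msupp P) Xi i * mderiv i (mcoeff m P *: mpolyX R[i] m)).
  by apply: eq_bigr => i _; rewrite {1}[P]mpolyE raddf_sum mulr_sumr.
rewrite exchange_big /= big_seq [RHS]big_seq; apply: eq_bigr => m Hm.
rewrite -(H m Hm) mdegE natr_sum mulr_sumr scaler_suml; apply: eq_bigr => i _.
rewrite mderivZ mderivX scalerA -scalerAr -mpolyXD.
have [->|mi] := posnP (m i); first by rewrite mulr0 !scale0r.
congr (_ *: mpolyX _ _); apply/mnmP => j; rewrite mnmDE mnmBE mnm1E.
by case: eqP => [<-|_]; rewrite ?add0n ?subn0// addnC subnK.
Qed.

(** Replace [k%:R *: H] by Euler's sum and apply [pint_Xi] to each [mderiv i H * Q]; the product
    rule yields both terms on the right. *)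
Lemma pint_euler k j H Q : hom k H -> hom j Q ->
  k%:R * ((k + j + n)%:R * pint (H * Q)) = pint (lap H * Q) + pint (\sum_i mderiv i H * mderiv i Q).
Proof.
move=> hH hQ; rewrite -pintD; case: k hH => [|k] hH.
  rewrite mul0r (_ : _ + _ = 0) ?pint0// /lap !big1 ?mul0r ?addr0// => i _.
    by rewrite hom0_deriv// mul0r.
  by rewrite (hom0_deriv i hH) mderiv0.
rewrite mulrCA -pintZ scalerAl -(euler hH) mulr_suml pint_sum mulr_sumr.
rewrite /lap mulr_suml -big_split /= pint_sum; apply: eq_bigr => i _.
rewrite -mulrA -mderivM (_ : k.+1 + j + n = k + j + n.+1)%N; last by lia.
by apply: pint_Xi; apply: homM => //; exact: hom_deriv.
Qed.

Lemma hom_lap d P : hom d.+2 P -> hom d (lap P).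
Proof. by move=> h; apply: hom_sum => i; do 2 apply: hom_deriv. Qed.
Lemma lap_small d P : (d < 2)%N -> hom d P -> lap P = 0.
Proof.
move=> d2 h; rewrite /lap big1// => i _; case: d d2 h => [|[|//]] _ h.
  by rewrite (hom0_deriv i h) mderiv0.
by apply: hom0_deriv; exact: hom_deriv.
Qed.

(* For harmonic [H], Euler's identity and [pint_Xi] turn [pint (H * Q)] into a
   multiple of [pint (H * lap Q)]; hence the induction on the degree of [Q]. *)
Lemma pint_ortho k j H Q : harmonic_homog k H -> hom j Q -> (j < k)%N || odd (j + k) -> pint (H * Q) = 0.
Proof.
move=> [hH lH]; elim/ltn_ind: j Q => j IH Q hQ hjk.
have e1 := pint_euler hH hQ; have e2 := pint_euler hQ hH.
rewrite -/(lap H) in lH; rewrite lH mul0r pint0 add0r in e1.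
have l0 : pint (lap Q * H) = 0.
  case: j IH hQ hjk {e1 e2} => [|[|j]] IH hQ hjk.
  - by rewrite (lap_small _ hQ)// mul0r pint0.
  - by rewrite (lap_small _ hQ)// mul0r pint0.
  - rewrite mulrC; apply: (IH j) => //; first exact: hom_lap.
    by move: hjk; rewrite !addSn /= negbK => /orP[h|->]; rewrite ?orbT// (ltn_trans _ h).
rewrite l0 add0r in e2.
have E : pint (\sum_i mderiv i H * mderiv i Q) = pint (\sum_i mderiv i Q * mderiv i H).
  by congr pint; apply: eq_bigr => i _; rewrite mulrC.
rewrite E -e2 [Q * H]mulrC [(j + k)%N]addnC in e1.
have kj : k != j.
  by apply: contraTneq hjk => ->; rewrite ltnn /= addnn odd_double.
move/eqP: e1; rewrite -subr_eq0 -mulrBl mulf_eq0 subr_eq0 eqr_nat (negbTE kj) /= mulf_eq0 pnatr_eq0.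
have -> : ((k + j + n)%N == 0%N) = false by apply/negbTE; move: kj; lia.
by move=> /eqP.
Qed.

Lemma lapD P Q : lap (P + Q) = lap P + lap Q.
Proof. by rewrite /lap -big_split; apply: eq_bigr => i _; rewrite !mderivD. Qed.
Lemma lapZ c P : lap (c *: P) = c *: lap P.
Proof. by rewrite /lap scaler_sumr; apply: eq_bigr => i _; rewrite !mderivZ. Qed.
Lemma lap_sum (I : Type) (r : seq I) (F : I -> mpoly N R[i]) :
  lap (\sum_(i <- r) F i) = \sum_(i <- r) lap (F i).
Proof.
elim: r => [|i r IH]; last by rewrite !big_cons lapD IH.
by rewrite !big_nil /lap big1// => i _; rewrite !mderiv0.
Qed.
Lemma hom_r2 m : hom m.*2 (r2 ^+ m).
Proof.
have h : hom 2 r2 by apply: hom_sum => i; rewrite expr2; exact: (homM (hom_Xi i) (hom_Xi i)).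
elim: m => [|m IH]; first by rewrite expr0 /hom; exact: dhomog1.
by rewrite exprS doubleS -[m.*2.+2]/(2 + m.*2)%N; exact: homM.
Qed.
Lemma deriv_Xi i j : mderiv i (Xi j) = (i == j)%:R.
Proof.
rewrite /Xi mderivX mnm1E [j == i]eq_sym; case: eqP => [->|_]; last by rewrite scale0r.
rewrite scale1r (_ : mnm_sub _ _ = @mnm0 N) ?mpolyX0//.
by apply/mnmP => k; rewrite mnmBE mnm0E subnn.
Qed.
Lemma deriv_r2 i : mderiv i r2 = 2 *: Xi i.
Proof.
rewrite /r2 raddf_sum (bigD1 i)//= big1 ?addr0.
  by rewrite expr2 mderivM deriv_Xi eqxx mul1r mulr1 scaler_nat mulr2n.
by move=> j ji; rewrite expr2 mderivM deriv_Xi [i == j]eq_sym (negbTE ji) mul0r mulr0 addr0.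
Qed.
Lemma deriv_r2X i m : mderiv i (r2 ^+ m.+1) = (2 * m.+1)%:R *: (Xi i * r2 ^+ m).
Proof.
elim: m => [|m IH]; first by rewrite expr1 deriv_r2 expr0 mulr1 muln1.
rewrite exprS mderivM IH deriv_r2 -scalerAr -scalerAl.
rewrite [r2 * (_ * _)]mulrCA -exprS -scalerDl -natrD; congr (_%:R *: _); lia.
Qed.
(** The classical formula for the Laplacian of an even power of the radius times [G], with [n] the
    dimension minus 2. Its scalar is positive, so that [fischer] can invert it. *)
Lemma lap_r2M m d G : hom d G ->
  lap (r2 ^+ m.+1 * G) = (2 * m.+1 * (2 * m.+1 + n + 2 * d))%:R *: (r2 ^+ m * G) + r2 ^+ m.+1 * lap G.
Proof.
move=> hG.
have E i : mderiv i (mderiv i (r2 ^+ m.+1 * G)) =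
   mderiv i (mderiv i (r2 ^+ m.+1)) * G + 2 *: (mderiv i (r2 ^+ m.+1) * mderiv i G) + r2 ^+ m.+1 * mderiv i (mderiv i G).
  by rewrite mderivM mderivD !mderivM scaler_nat mulr2n !addrA.
rewrite /lap; under eq_bigr do rewrite E.
rewrite !big_split /= -mulr_sumr -mulr_suml; congr (_ + _).
have -> : \sum_i 2 *: (mderiv i (r2 ^+ m.+1) * mderiv i G) = (2 * (2 * m.+1) * d)%:R *: (r2 ^+ m * G).
  under eq_bigr do rewrite deriv_r2X -scalerAl scalerA -natrM [Xi _ * _]mulrC -mulrA.
  rewrite -scaler_sumr -mulr_sumr (euler hG) -scalerAr scalerA -natrM.
  by congr (_%:R *: _).
have -> : \sum_i mderiv i (mderiv i (r2 ^+ m.+1)) = (2 * m.+1 * (2 * m.+1 + n))%:R *: r2 ^+ m.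
  under eq_bigr do rewrite deriv_r2X mderivZ mderivM deriv_Xi eqxx mul1r.
  rewrite -scaler_sumr big_split /= sumr_const card_ord.
  have -> : \sum_(i < N) Xi i * mderiv i (r2 ^+ m) = (2 * m)%:R *: r2 ^+ m.
    by rewrite (euler (hom_r2 m)) -mul2n.
  rewrite -[r2 ^+ m *+ N]scaler_nat -scalerDl scalerA -natrD -natrM; congr (_%:R *: _); rewrite /N; lia.
rewrite -scalerAl -scalerDl -natrD; congr (_%:R *: _); lia.
Qed.

(* A decomposition of [lap P] is lifted with the inverse of the scalars of [lap_r2M]. *)
Lemma fischer j P : hom j P -> exists H : nat -> mpoly N R[i],
  (forall i, (i.*2 <= j)%N -> harmonic_homog (j - i.*2) (H i)) /\
  P = \sum_(i < j./2.+1) r2 ^+ i * H i.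
Proof.
elim/ltn_ind: j P => j IH P hP.
have [j2|j2] := ltnP j 2.
  exists (fun=> P); split; last first.
    have -> : j./2 = 0%N by lia.
    by rewrite big_ord1 expr0 mul1r.
  move=> i ij; have -> : (j - i.*2 = j)%N by lia.
  by split => //; exact: lap_small hP.
case: j j2 IH hP => [|[|j]] // _ IH hP.
have [|H [hH LE]] := IH j _ _ (hom_lap hP); first by lia.
pose c i := (2 * i.+1 * (2 * i.+1 + n + 2 * (j - i.*2)))%:R : R[i].
have c0 i : c i != 0 by rewrite pnatr_eq0 !muln_eq0; lia.
pose H0 := P - \sum_(i < j./2.+1) (c i)^-1 *: (r2 ^+ i.+1 * H i).
have ij (i : 'I_(j./2.+1)) : (i.*2 <= j)%N by have := ltn_ord i; lia.
exists (fun i => if i is i'.+1 then (c i')^-1 *: H i' else H0); split.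
  case=> [_|i ij2]; last first.
    have [h1 h2] : harmonic_homog (j - i.*2) (H i) by apply: hH; lia.
    have -> : (j.+2 - i.+1.*2 = j - i.*2)%N by lia.
    split; first exact: homZ.
    by rewrite -/(lap _) lapZ [lap _]h2 scaler0.
  split.
    rewrite subn0 /H0 -scaleN1r; apply: homD => //; apply: homZ; apply: hom_sum => i; apply: homZ.
    have := homM (hom_r2 i.+1) (hH i (ij i)).1.
    by have -> : (i.+1.*2 + (j - i.*2) = j.+2)%N by have := ij i; lia.
  rewrite -/(lap _) /H0 -scaleN1r lapD lapZ lap_sum LE scaleN1r; apply/eqP; rewrite subr_eq0; apply/eqP.
  apply: eq_bigr => i _; rewrite lapZ (lap_r2M i (hH i (ij i)).1).
  have [_ h2] := hH i (ij i); rewrite [lap _]h2 mulr0 addr0 scalerA.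
  by rewrite -/(c i) mulVf// scale1r.
have -> : j.+2./2 = (j./2).+1 by [].
rewrite big_ord_recl expr0 mul1r /= /H0.
under [X in _ = _ + X]eq_bigr do rewrite -scalerAr /bump /= add1n.
by rewrite subrK.
Qed.
End PolyInt.


(** * Taylor polynomials and Laplace-Fourier coefficients *)

Section Rays.
Variable R : realType.

Lemma is_derive_ray n (g : 'rV[R]_n -> R) (x : 'rV[R]_n) (s0 : R) :
  derivable (g : 'rV[R]_n -> R^o) (s0 *: x) x ->
  is_derive s0 (1 : R) (fun s => g (s *: x)) ('D_x (g : 'rV[R]_n -> R^o) (s0 *: x)).
Proof.
move=> H; have E : (fun h : R => h^-1 *: (((fun s => g (s *: x)) \o shift s0) (h *: (1 : R)) - g (s0 *: x))) =
  (fun h : R => h^-1 *: ((g \o shift (s0 *: x)) (h *: x) - g (s0 *: x))).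
  by apply/funext => h; rewrite /= [h *: 1]mulr1 scalerDl.
split.
- by rewrite /derivable E.
- by rewrite /derive E.
Qed.

Lemma derive_coord n (g : 'rV[R]_n -> R) (x y : 'rV[R]_n) :
  differentiable (g : 'rV[R]_n -> R^o) y ->
  'D_x (g : 'rV[R]_n -> R^o) y = \sum_i x ord0 i * 'D_(delta_mx ord0 i) (g : 'rV[R]_n -> R^o) y.
Proof.
move=> H; rewrite deriveE// {1}[x]row_sum_delta linear_sum; apply: eq_bigr => i _.
by rewrite linearZ deriveE.
Qed.

Lemma enormZ n (a : R) (x : 'rV[R]_n) : enorm (a *: x) = `|a| * enorm x.
Proof.
rewrite /enorm -sqrtr_sqr -sqrtrM ?sqr_ge0//; congr Num.sqrt.
by rewrite mulr_sumr; apply: eq_bigr => i _; rewrite mxE exprMn.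
Qed.
Lemma enorm_coord n (x : 'rV[R]_n) i : `|x ord0 i| <= enorm x.
Proof.
rewrite -(ler_pXn2r (n:=2)) ?nnegrE ?enorm_ge0// enorm_sq (bigD1 i)//= real_normK ?num_real// lerDl.
by apply: sumr_ge0 => j _; exact: sqr_ge0.
Qed.
End Rays.

Section Taylor.
Variables (R : realType) (n : nat).
Let N := n.+2.
Definition rev (P : mpoly N R) (x : 'rV[R]_N) : R := meval (fun i => x ord0 i) P.

Lemma rev_ray d (P : mpoly N R) s x : P \is ishomog1 d (@mdeg N) -> rev P (s *: x) = s ^+ d * rev P x.
Proof.
move=> /dhomogP H; rewrite /rev !mevalE mulr_sumr big_seq [RHS]big_seq; apply: eq_bigr => m Hm.
have -> : s ^+ d = \prod_i s ^+ m i by rewrite -expr_sum -mdegE (H m Hm).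
rewrite mulrCA; congr (_ * _); rewrite -big_split /=.
by apply: eq_bigr => i _; rewrite mxE exprMn.
Qed.

Lemma is_derive_psum (c : nat -> R) K (s : R) :
  is_derive s (1 : R) (fun s => \sum_(j < K.+1) c j * s ^+ j) (\sum_(j < K) (j.+1)%:R * c j.+1 * s ^+ j).
Proof.
elim: K => [|K IH].
  rewrite big_ord0 (_ : (fun s => _) = fun=> c 0%N); first exact: (is_derive_cst (c 0%N) s (1 : R)).
  by apply/funext => t; rewrite big_ord1 mulr1.
pose u (s : R) := \sum_(j < K.+1) c j * s ^+ j; pose v (s : R) := c K.+1 * s ^+ K.+1.
rewrite (_ : (fun s => _) = u + v); last first.
  by apply/funext => t; rewrite big_ord_recr.
have h : is_derive s (1 : R) v ((K.+1)%:R * c K.+1 * s ^+ K).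
  have h := @is_deriveM R R (fun=> c K.+1) (fun s => s ^+ K.+1) s 1 _ _ (is_derive_cst (c K.+1) s (1 : R)) (is_derive_pow K.+1 (is_derive_id s (1 : R))).
  apply: is_derive_eq h _.
  by rewrite /GRing.scale /= mulr0 addr0 mulr1; ring.
by rewrite big_ord_recr /=; apply: is_deriveD.
Qed.

(** Induction on [K]: the expansions of the partial derivatives, integrated along rays, give that of
    [g], and the mean value theorem on the ray carries the remainder. *)
Lemma taylor_mv (r0 : R) K (g : 'rV[R]_N -> R) : 0 < r0 -> diff_upto K.+1 (eball N r0) g ->
  exists (T : nat -> mpoly N R) (C r1 : R), [/\ forall j, T j \is ishomog1 j (@mdeg N), 0 <= C, 0 < r1, r1 < r0 &
  forall x, enorm x <= r1 -> `|g x - \sum_(j < K) rev (T j) x| <= C * enorm x ^+ K].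
Proof.
move=> r00; elim: K g => [|K IH] g [gd gp].
  have e00 : enorm (0 : 'rV[R]_N) = 0 by rewrite -(scale0r (0 : 'rV[R]_N)) enormZ normr0 mul0r.
  have : {for (0 : 'rV[R]_N), continuous (g : 'rV[R]_N -> R^o)}.
    by apply: differentiable_continuous; apply: gd; rewrite /eball /= e00.
  move=> /cvgrPdistC_lt /(_ _ ltr01) /rV_near [d [d0 [d1 Hd]]].
  exists (fun=> 0), (`|g 0| + 1), (Num.min d (r0 / 2)); split.
  - by move=> j; exact: dhomog0.
  - by rewrite addr_ge0.
  - by rewrite lt_min d0 divr_gt0.
  - by rewrite gt_min ltr_pdivrMr// ltr_pMr// ltr1n orbT.
  move=> x; rewrite le_min => /andP[x1 x2]; rewrite big_ord0 subr0 expr0 mulr1.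
  have : `|g x - g 0| < 1.
    by apply: Hd => i; rewrite mxE subr0; apply: le_trans x1; exact: enorm_coord.
  move=> h; have := ler_normD (g x - g 0) (g 0); rewrite subrK => /le_trans; apply.
  by rewrite addrC lerD2l ltW.
have /choice [T hT] : forall i : 'I_N, exists T : nat -> mpoly N R, exists C r1 : R, [/\ forall j, T j \is ishomog1 j (@mdeg N), 0 <= C, 0 < r1, r1 < r0 &
  forall x, enorm x <= r1 -> `|'D_(delta_mx ord0 i) (g : 'rV[R]_N -> R^o) x - \sum_(j < K) rev (T j) x| <= C * enorm x ^+ K].
  by move=> i; apply: IH; exact: gp.
have {hT}/choice [C hC] := hT.
have {hC}/choice [r1 hr] := hC.
(* Integration along the ray divides the part of degree [j'.+1] by [j'.+1]. *)
pose S j := if j is j'.+1 then (j'.+1%:R)^-1 *: \sum_i mpolyX R (mnm1 i) * T i j' else mpolyC N (g 0).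
have hS j : S j \is ishomog1 j (@mdeg N).
  case: j => [|j]; first by rewrite /S -[mpolyC _ _]mulr1 mul_mpolyC; apply: dhomogZ; exact: dhomog1.
  apply: dhomogZ; elim/big_ind: _ => [|p q hp hq|i _]; [exact: dhomog0|exact: dhomogD|].
  have [h _ _ _ _] := hr i.
  have hX : mpolyX R (mnm1 i) \is ishomog1 1 (@mdeg N) by rewrite dhomogX /= mdeg1.
  exact: (dhomogM hX (h j)).
pose rr := \big[Num.min/(r0 / 2)]_i r1 i.
have rr0 : 0 < rr.
  by rewrite /rr; elim/big_ind: _ => [|a b a0 b0|i _]; [exact: divr_gt0|rewrite lt_min a0|have [] := hr i].
have rri i : rr <= r1 i by exact: bigmin_le.
have rr1 : rr < r0.
  have := rri ord0; have [_ _ _ h _] := hr ord0; move=> h2; exact: le_lt_trans h2 h.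
exists S, (\sum_i C i), rr; split => //.
  by apply: sumr_ge0 => i _; have [] := hr i.
move=> x xr.
(* The remainder along the ray: it vanishes at [s = 0], and its derivative [dphi] is a combination
   of the remainders of the partial derivatives. *)
pose phi s := g (s *: x) - \sum_(j < K.+1) rev (S j) x * s ^+ j.
pose dphi s := 'D_x (g : 'rV[R]_N -> R^o) (s *: x) - \sum_(j < K) j.+1%:R * rev (S j.+1) x * s ^+ j.
have sball (s : R) : 0 <= s <= 1 -> enorm (s *: x) <= rr.
  move=> /andP[s0 s1]; rewrite enormZ ger0_norm//; apply: le_trans xr.
  by rewrite ler_piMl// enorm_ge0.
have sU (s : R) : 0 <= s <= 1 -> eball N r0 (s *: x).
  by move=> /sball h; rewrite /eball /=; exact: le_lt_trans rr1.
have dd (s : R) : 0 <= s <= 1 -> is_derive s (1 : R) phi (dphi s).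
  move=> hs; have h1 : is_derive s (1 : R) (fun s => g (s *: x)) ('D_x (g : 'rV[R]_N -> R^o) (s *: x)).
    by apply: is_derive_ray; apply: diff_derivable; exact: gd (sU s hs).
  exact: (is_deriveB h1 (is_derive_psum (fun j => rev (S j) x) K s)).
have dphi_le (s : R) : 0 <= s <= 1 -> `|dphi s| <= (\sum_i C i) * enorm x ^+ K.+1.
  move=> hs; have -> : dphi s = \sum_i x ord0 i * ('D_(delta_mx ord0 i) (g : 'rV[R]_N -> R^o) (s *: x) - \sum_(j < K) rev (T i j) (s *: x)).
    rewrite /dphi derive_coord; last exact: gd (sU s hs).
    under [RHS]eq_bigr do rewrite mulrBr.
    rewrite sumrB; congr (_ - _).
    under [RHS]eq_bigr do rewrite mulr_sumr.
    rewrite exchange_big /=; apply: eq_bigr => j _.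
    rewrite /rev mevalZ mulrA divff ?pnatr_eq0// mul1r raddf_sum mulr_suml; apply: eq_bigr => i _.
    have [h _ _ _ _] := hr i.
    rewrite -/(rev _ _) -/(rev _ (s *: x)) (rev_ray s x (h j)) /rev /= mevalM mevalXU; ring.
  apply: (le_trans (ler_norm_sum _ _ _)); rewrite mulr_suml; apply: ler_sum => i _.
  have [_ C0 _ _ h] := hr i.
  rewrite normrM exprS mulrCA; apply: ler_pM => //; first exact: enorm_coord.
  apply: (le_trans (h _ (le_trans (sball s hs) (rri i)))).
  apply: ler_wpM2l => //; apply: lerXn2r; rewrite ?nnegrE ?enorm_ge0//.
  by move: hs => /andP[s0 s1]; rewrite enormZ ger0_norm// ler_piMl// enorm_ge0.
have [||c] := @MVT_segment R phi dphi 0 1 ler01 _ _.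
- by move=> s; rewrite in_itv /= => /andP[s0 s1]; apply: dd; rewrite !ltW.
- apply: derivable_within_continuous => s; rewrite in_itv /= => hs.
  exact: (@ex_derive _ _ _ _ _ _ _ (dd s hs)).
rewrite in_itv /= => hc; rewrite subr0 mulr1 => E.
have p0 : phi 0 = 0.
  rewrite /phi scale0r big_ord_recl expr0 mulr1 big1 ?addr0.
    by rewrite /rev mevalC subrr.
  by move=> j _; rewrite /= expr0n mulr0.
have p1 : phi 1 = g x - \sum_(j < K.+1) rev (S j) x.
  by rewrite /phi scale1r; congr (_ - _); apply: eq_bigr => j _; rewrite expr1n mulr1.
have {}E : g x - \sum_(j < K.+1) rev (S j) x = dphi c by rewrite -p1 -E p0 subr0.
by rewrite E; exact: dphi_le.
Qed.
End Taylor.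

Section MapMpoly.
Variables (A B : comNzRingType) (f : {rmorphism A -> B}) (n : nat).
Lemma meval_rmorph v (P : mpoly n A) : meval (fun i => f (v i)) (map_mpoly f P) = f (meval v P).
Proof.
have -> : map_mpoly f P = \sum_(m <- msupp P) f (mcoeff m P) *: mpolyX B m.
  by rewrite {1}[P]mpolyE raddf_sum; apply: eq_bigr => m _; rewrite /= map_mpolyZ map_mpolyX.
rewrite (mevalE v P) [RHS]raddf_sum raddf_sum /=; apply: eq_bigr => m _.
rewrite mevalZ mevalX rmorphM rmorph_prod; congr (_ * _).
by apply: eq_bigr => i _; rewrite rmorphXn.
Qed.
Lemma dhomog_map_mpoly d (P : mpoly n A) : P \is ishomog1 d (@mdeg n) -> map_mpoly f P \is ishomog1 d (@mdeg n).
Proof.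
move=> /dhomogP H; apply/dhomogP => m; rewrite mcoeff_msupp mcoeff_map_mpoly => h; apply: H.
by rewrite mcoeff_msupp; apply: contraNneq h => ->; rewrite raddf0.
Qed.
Lemma mderiv_map_mpoly i (P : mpoly n A) : mderiv i (map_mpoly f P) = map_mpoly f (mderiv i P).
Proof. by apply/mpolyP => m; rewrite mcoeff_deriv !mcoeff_map_mpoly mcoeff_deriv raddfMn. Qed.
End MapMpoly.

Section Parity.
Variables (R : realType) (n : nat).
Let N := n.+2.
Implicit Types P Q Y : mpoly N R[i].

Definition cpoly P : mpoly N R[i] := map_mpoly (conjc : {rmorphism R[i] -> R[i]}) P.

Lemma cpoly_at P w : mpoly_at (cpoly P) w = (mpoly_at P w)^*.
Proof.
rewrite /mpoly_at -(meval_rmorph (conjc : {rmorphism R[i] -> R[i]})).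
by apply: meval_eq => i; rewrite /= oppr0.
Qed.
Lemma hom_cpoly d P : hom d P -> hom d (cpoly P).
Proof. exact: dhomog_map_mpoly. Qed.
Lemma harmonic_cpoly d P : harmonic_homog d P -> harmonic_homog d (cpoly P).
Proof.
move=> [h1 h2]; split; first exact: hom_cpoly.
transitivity (cpoly (\sum_(i < N) mderiv i (mderiv i P))); last by rewrite h2 /cpoly raddf0.
by rewrite /cpoly raddf_sum; apply: eq_bigr => i _; rewrite !mderiv_map_mpoly.
Qed.

Lemma mpoly_at_ray d P (s : R) x : hom d P -> mpoly_at P (s *: x) = s%:C ^+ d * mpoly_at P x.
Proof.
move=> /homP H; rewrite /mpoly_at !mevalE mulr_sumr big_seq [RHS]big_seq; apply: eq_bigr => m Hm.
have -> : s%:C ^+ d = \prod_i s%:C ^+ m i by rewrite -expr_sum -mdegE (H m Hm).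
rewrite mulrCA; congr (_ * _); rewrite -big_split /=.
by apply: eq_bigr => i _; rewrite mxE -exprMn -rmorphM.
Qed.

Lemma taylor_mvC (r0 : R) K (f : 'rV[R]_N -> R[i]) : 0 < r0 -> smooth_on (eball N r0) f ->
  exists (T : nat -> mpoly N R[i]) (C r1 : R), [/\ forall j, hom j (T j), 0 <= C, 0 < r1, r1 < r0 &
  forall x, enorm x <= r1 -> cabs (f x - \sum_(j < K) mpoly_at (T j) x) <= C * enorm x ^+ K].
Proof.
move=> r00 hf; have [h1 h2] := hf K.+1.
have [T1 [C1 [r1 [a1 a2 a3 a4 a5]]]] := taylor_mv r00 h1.
have [T2 [C2 [r2 [b1 b2 b3 b4 b5]]]] := taylor_mv r00 h2.
have [cx [cxE cxh]] : exists cx : mpoly N R -> mpoly N R[i], (forall (P : mpoly N R) w, mpoly_at (cx P) w = (rev P w)%:C) /\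
    (forall d (P : mpoly N R), P \is ishomog1 d (@mdeg N) -> hom d (cx P)).
  exists (fun P : mpoly N R => map_mpoly (real_complex R : {rmorphism R -> R[i]}) P); split.
    by move=> P w; exact: (meval_rmorph (real_complex R : {rmorphism R -> R[i]})).
  by move=> d P; exact: dhomog_map_mpoly.
exists (fun j => cx (T1 j) + 'i *: cx (T2 j)), (C1 + C2), (Num.min r1 r2); split.
- by move=> j; apply: homD; [exact: cxh|apply: homZ; exact: cxh].
- exact: addr_ge0.
- by rewrite lt_min a3.
- by rewrite gt_min a4.
move=> x; rewrite le_min => /andP[x1 x2]; apply: (le_trans (cabs_le_ReIm _)).
have eT j : mpoly_at (cx (T1 j) + 'i *: cx (T2 j)) x = rev (T1 j) x +i* rev (T2 j) x.
  rewrite mpoly_atD mpoly_atZ !cxE.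
  by apply: ceqP; rewrite ?cReD ?cImD ?cReM ?cImM /=; ring.
rewrite mulrDl; apply: lerD.
- apply: le_trans (a5 x x1); rewrite cReD cReN cRe_sum le_eqVlt; apply/orP; left; apply/eqP; congr `|_ - _|.
  by apply: eq_bigr => j _; rewrite eT.
- apply: le_trans (b5 x x2); rewrite cImD cImN cIm_sum le_eqVlt; apply/orP; left; apply/eqP; congr `|_ - _|.
  by apply: eq_bigr => j _; rewrite eT.
Qed.

Lemma smooth_ccts (r0 : R) (f : 'rV[R]_N -> R[i]) : smooth_on (eball N r0) f ->
  forall x, enorm x < r0 -> ccts f x.
Proof.
move=> hf x xr; have [[h1 _] [h2 _]] := hf 1%N.
by split; apply: (@differentiable_continuous R 'rV[R]_N R^o); [exact: h1|exact: h2].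
Qed.
Lemma scale_cont (c : R) (w : 'rV[R]_N) : {for w, continuous (fun v : 'rV[R]_N => c *: v)}.
Proof.
apply: cvg_rV => i; rewrite (_ : (fun s => _) = (fun s : 'rV[R]_N => c * s ord0 i)).
  by apply: contM; [exact: cont_cst|exact: cont_coord].
by apply/funext => s; rewrite mxE.
Qed.
Lemma smooth_sccts (r0 r : R) (f : 'rV[R]_N -> R[i]) : smooth_on (eball N r0) f -> 0 <= r -> r < r0 ->
  sccts (fun w => f (r *: w)).
Proof.
move=> hf r1 r2 w Hw; apply: (@ccts_comp _ _ _ (fun v : 'rV[R]_N => r *: v) f); first exact: scale_cont.
by apply: (smooth_ccts hf); rewrite enormZ ger0_norm// Hw mulr1.
Qed.

(** Pairing the Taylor polynomial of [f] with [Y] degree by degree gives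
    [c j = pint (cpoly Y * T j)]. The conjugate of [Y] is again harmonic, so [pint_ortho] kills the
    excluded degrees. *)
Lemma lf_coef_taylor (r0 : R) (f : 'rV[R]_N -> R[i]) k Y K : 0 < r0 -> smooth_on (eball N r0) f ->
  harmonic_homog k Y -> exists (c : nat -> R[i]) (C r1 : R), [/\ forall j, (j < k)%N || odd (j + k) -> c j = 0,
  0 < r1, r1 < r0 & forall r, 0 <= r -> r < r1 -> cabs (lf_coef f Y r - \sum_(j < K) c j * r%:C ^+ j) <= C * r ^+ K].
Proof.
move=> r00 hf hY; have [T [C [r1 [hT C0 r10 r11 H]]]] := taylor_mvC K r00 hf.
have Ys := @mpoly_at_sccts R n (cpoly Y).
exists (fun j => pint (cpoly Y * T j)), (C * sphere_int (fun w => cabs (mpoly_at (cpoly Y) w))), r1; split => //.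
  by move=> j hj; apply: (pint_ortho (harmonic_cpoly hY) (hT j)).
move=> r rr0 rr1.
have fs := smooth_sccts hf rr0 (lt_trans rr1 r11).
have -> : \sum_(j < K) pint (cpoly Y * T j) * r%:C ^+ j =
    sphere_intC (fun w => \sum_(j < K) (r%:C ^+ j) * (mpoly_at (cpoly Y * T j) w)).
  rewrite sphere_intC_sum; last by move=> j; apply: scctsZ; exact: mpoly_at_sccts.
  apply: eq_bigr => j _; rewrite mulrC /pint -sphere_intCZ//; exact: mpoly_at_sccts.
have -> : lf_coef f Y r = sphere_intC (fun w => f (r *: w) * mpoly_at (cpoly Y) w).
  by apply: eq_sphere_intC => w _; rewrite cpoly_at.
have s1 : sccts (fun w => f (r *: w) * mpoly_at (cpoly Y) w) by exact: scctsM.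
have s2 : sccts (fun w => \sum_(j < K) (r%:C ^+ j) * (mpoly_at (cpoly Y * T j) w)).
  by apply: sccts_sum => j; apply: scctsZ; exact: mpoly_at_sccts.
rewrite -(sphere_intCB s1 s2).
have s3 : scont (fun w => cabs (mpoly_at (cpoly Y) w)) by move=> w Hw; apply: ccts_cabs; exact: Ys.
rewrite [X in _ <= X]mulrAC -(sphere_intZ (C * r ^+ K) s3); apply: sphere_intC_abs.
- by apply: (scctsD s1); exact: scctsN.
- exact: scontZ.
move=> w Hw.
have -> : f (r *: w) * mpoly_at (cpoly Y) w - \sum_(j < K) r%:C ^+ j * mpoly_at (cpoly Y * T j) w =
   (f (r *: w) - \sum_(j < K) mpoly_at (T j) (r *: w)) * mpoly_at (cpoly Y) w.
  rewrite mulrBl mulr_suml; congr (_ - _); apply: eq_bigr => j _.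
  by rewrite mpoly_atM (mpoly_at_ray r w (hT j)); ring.
have er : enorm (r *: w) = r by rewrite enormZ ger0_norm// Hw mulr1.
by rewrite cabsM ler_wpM2r ?cabs_ge0//; have := H (r *: w); rewrite er; apply; exact: ltW.
Qed.
End Parity.


Section PowerSeries.
Variable R : realType.
Implicit Types (c u : nat -> R[i]).

Lemma geo_term c M r s j z : 0 < r -> cabs (c j) <= M * r^-1 ^+ j -> cabs z <= s ->
  cabs (c j * z ^+ j) <= M * (s / r) ^+ j.
Proof.
move=> r0 hc hz; have s0 : 0 <= s := le_trans (cabs_ge0 z) hz.
rewrite cabsM cabsX exprMn mulrCA mulrC; apply: ler_pM => //; rewrite ?cabs_ge0 ?exprn_ge0 ?cabs_ge0//.
by apply: lerXn2r; rewrite ?nnegrE ?cabs_ge0.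
Qed.

Lemma ps_eq c c' (M M' r dl : R) : 0 < r -> (forall j, cabs (c j) <= M * r^-1 ^+ j) ->
  (forall j, cabs (c' j) <= M' * r^-1 ^+ j) -> 0 < dl ->
  (forall s : R, 0 < s -> s < dl -> gsum (fun j => c j * s%:C ^+ j) = gsum (fun j => c' j * s%:C ^+ j)) ->
  forall j, c j = c' j.
Proof.
move=> r0 hc hc' dl0 H j; apply/eqP; rewrite -subr_eq0; apply/eqP.
have e0 i : cabs (c i - c' i) <= (M + M') * r^-1 ^+ i.
  by apply: (le_trans (cabsD _ _)); rewrite cabsN mulrDl lerD.
have rV : 0 <= r^-1 by rewrite invr_ge0 ltW.
apply: (@ps_vanish R (fun j => c j - c' j) (M + M') r^-1 j.+1 0 (Num.min dl (r / 2)) rV e0) => //.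
  by rewrite lt_min dl0 divr_gt0.
move=> s s0; rewrite lt_min => /andP[s1 s2]; rewrite mul0r.
have x0 : 0 <= s / r by rewrite divr_ge0 // ltW.
have x1 : s / r < 1.
  by rewrite ltr_pdivrMr// mul1r; apply: (lt_trans s2); rewrite ltr_pdivrMr// ltr_pMr// ltr1n.
have cs : cabs s%:C <= s by rewrite cabsR gtr0_norm.
rewrite (gsum_eq (v := fun i => c i * s%:C ^+ i - c' i * s%:C ^+ i)); last by move=> i; rewrite mulrBl.
rewrite (gsumB x0 x1 (fun i => geo_term r0 (hc i) cs) (fun i => geo_term r0 (hc' i) cs)) H// subrr.
by rewrite cabsR normr0.
Qed.

Lemma gsum_reindex u k (M x : R) : 0 <= x -> x < 1 -> (forall j, cabs (u j) <= M * x ^+ j) ->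
  (forall j, (j < k)%N || odd (j + k) -> u j = 0) -> gsum u = gsum (fun m => u (k + m.*2)%N).
Proof.
move=> x0 x1 hu hz; have M0 : 0 <= M by have := hu 0%N; rewrite expr0 mulr1; apply: le_trans; exact: cabs_ge0.
apply: (@gsum_unique R (fun m => u (k + m.*2)%N) M x) => //.
  move=> m; apply: (le_trans (hu _)); apply: ler_wpM2l => //.
  by apply: ler_wiXn2l => //; [exact: ltW|rewrite -addnn addnA leq_addl].
have part K : \sum_(m < K) u (k + m.*2)%N = \sum_(j < k + K.*2) u j.
  elim: K => [|K IH]; first by rewrite big_ord0 addn0 big1// => i _; apply: hz; rewrite ltn_ord.
  rewrite big_ord_recr /= IH doubleS !addnS !big_ord_recr /= (hz (k + K.*2).+1) ?addr0//.
  by rewrite /= oddD !oddD odd_double; case: (odd k); rewrite ?orbT.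
move=> e e0; have d0 : 0 < e * (1 - x) / (M + 1).
  by rewrite divr_gt0 ?mulr_gt0 ?subr_gt0// ltr_wpDl.
have [K0 hK] := geo_small x0 x1 d0; exists K0 => m hm; rewrite part.
apply: (le_trans (gsumP _ x0 x1 hu)).
have hm2 : (K0 <= k + m.*2)%N by apply: (leq_trans hm); rewrite -addnn addnA leq_addl.
have := ltW (hK _ hm2); rewrite ler_pdivlMr ?ltr_wpDl// => h.
rewrite ler_pdivrMr ?subr_gt0//; apply: le_trans h.
by rewrite mulrC ler_wpM2l ?exprn_ge0// lerDl ler01.
Qed.
End PowerSeries.

(** * From the coefficients f_kl to the radial functions p_kl *)

Section Radial.
Variables (R : realType) (n : nat) (r0 : R) (f : 'rV[R]_n.+2 -> R[i]) (k : nat) (Y : mpoly n.+2 R[i]) (g : R[i] -> R[i]).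
Hypotheses (r00 : 0 < r0) (hf : smooth_on (eball n.+2 r0) f) (hY : harmonic_homog k Y).
Hypothesis hg : coef_ext r0 (lf_coef f Y) g.
Let gam := tcoef g (r0 / 2).

Lemma coef_ext_cdiff z : cabs z < r0 -> exists d, cdiff g z d.
Proof. by case: hg => h _ /h /derivable_cdiff. Qed.

Lemma lf_ps (r : R) : 0 <= r -> r < r0 -> lf_coef f Y r = gsum (fun j => gam j * r%:C ^+ j).
Proof.
move=> a b; case: hg => _ <-; last by rewrite a.
by rewrite (taylor r00 coef_ext_cdiff)// cabsR ger0_norm.
Qed.

(* The homogeneous parts of the Taylor polynomial of [f] in the degrees excluded
   here are orthogonal to [Y] on the sphere. *)
Lemma gam_parity j : (j < k)%N || odd (j + k) -> gam j = 0.
Proof.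
move=> hj; have [c [C [r1 [hc r10 r11 H]]]] := lf_coef_taylor j.+1 r00 hf hY.
pose r := r0 / 2; have rp : 0 < r by rewrite divr_gt0.
have rr : r < r0 by rewrite ltr_pdivrMr// ltr_pMr// ltr1n.
have [M hM] := tcoef_geo coef_ext_cdiff rp rr.
(* Seen as a finitely supported series, the polynomial can be subtracted from the expansion of [g];
   [ps_vanish] then compares coefficients up to order [j]. *)
pose c' i := if (i < j.+1)%N then c i else 0.
have [M' hM'] : exists M', forall i, cabs (c' i) <= M' * r^-1 ^+ i.
  exists (\sum_(i < j.+1) cabs (c i) * r ^+ i) => i; rewrite /c'; case: ifP => hi.
    rewrite exprVn ler_pdivlMr ?exprn_gt0// (bigD1 (Ordinal hi))//= lerDl.
    by apply: sumr_ge0 => l _; rewrite mulr_ge0 ?cabs_ge0// exprn_ge0// ltW.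
  rewrite cabsR normr0; apply: mulr_ge0; last by rewrite exprn_ge0// invr_ge0 ltW.
  by apply: sumr_ge0 => l _; rewrite mulr_ge0 ?cabs_ge0// exprn_ge0// ltW.
have e0 i : cabs (gam i - c' i) <= (M + M') * r^-1 ^+ i.
  by apply: (le_trans (cabsD _ _)); rewrite cabsN mulrDl lerD// hM.
have rV : 0 <= r^-1 by rewrite invr_ge0 ltW.
have := @ps_vanish R (fun j => gam j - c' j) (M + M') r^-1 j.+1 C (Num.min r1 (r / 2)) rV e0.
have dl0 : 0 < Num.min r1 (r / 2) by rewrite lt_min r10 divr_gt0.
move=> /(_ dl0) H1; suff H2 : forall r : R, 0 < r -> r < Num.min r1 (r0 / 2 / 2) -> cabs (gsum (fun i => (gam i - c' i) * r%:C ^+ i)) <= C * r ^+ j.+1.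
  by have := H1 H2 _ (ltnSn j); rewrite /c' ltnSn hc// subr0.
move=> s s0; rewrite lt_min => /andP[s1 s2].
have x0 : 0 <= s / r by rewrite divr_ge0 // ltW.
have sr : s < r by apply: (lt_trans s2); rewrite ltr_pdivrMr// ltr_pMr// ltr1n.
have x1 : s / r < 1 by rewrite ltr_pdivrMr// mul1r.
have cs : cabs s%:C <= s by rewrite cabsR gtr0_norm.
rewrite (gsum_eq (v := fun i => gam i * s%:C ^+ i - c' i * s%:C ^+ i)); last by move=> i; rewrite mulrBl.
rewrite (gsumB x0 x1 (fun i => geo_term rp (hM i) cs) (fun i => geo_term rp (hM' i) cs)).
rewrite -lf_ps; [|exact: ltW|exact: lt_trans rr].
rewrite (@gsum_fin _ (fun i => c' i * s%:C ^+ i) j.+1); last first.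
  by move=> i hi; rewrite /c' ltnNge hi /= mul0r.
rewrite (eq_bigr (fun i : 'I_j.+1 => c i * s%:C ^+ i)); last by move=> i _; rewrite /c' ltn_ord.
by apply: H => //; exact: ltW.
Qed.

Lemma gam_geo (r : R) : 0 < r -> r < r0 -> exists M, forall j, cabs (gam j) <= M * r^-1 ^+ j.
Proof. by move=> a b; exact: (tcoef_geo coef_ext_cdiff a b). Qed.

(** Cauchy's estimate for [gam] at the radius [Num.sqrt s]; the contribution of the first [k]
    degrees goes into [M]. *)
Lemma radial_geo (s : R) : 0 < s -> s < r0 ^+ 2 -> exists M, forall m, cabs (gam (k + m.*2)) <= M * s^-1 ^+ m.
Proof.
move=> s0 s1; have q0 : 0 < Num.sqrt s by rewrite sqrtr_gt0.
have q1 : Num.sqrt s < r0.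
  by rewrite -(ltr_pXn2r (n:=2)) ?nnegrE ?sqrtr_ge0 ?ltW// sqr_sqrtr ?ltW.
have [M hM] := gam_geo q0 q1; exists (M * (Num.sqrt s)^-1 ^+ k) => m.
apply: (le_trans (hM _)); rewrite exprD mulrA -mul2n exprM.
by rewrite (_ : (Num.sqrt s)^-1 ^+ 2 = s^-1)// exprVn sqr_sqrtr ?ltW.
Qed.

Lemma lf_radial (r : R) : 0 < r -> r < r0 ->
  gsum (fun m => gam (k + m.*2) * (r ^+ 2)%:C ^+ m) = (r ^- k)%:C * lf_coef f Y r.
Proof.
move=> rp rr; rewrite lf_ps//; last exact: ltW.
pose r1 := (r + r0) / 2.
have r1r : r < r1 by rewrite ltr_pdivlMr// mulr_natr mulr2n ltrD2l.
have r1p : 0 < r1 := lt_trans rp r1r.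
have r11 : r1 < r0 by rewrite ltr_pdivrMr// mulr_natr mulr2n ltrD2r.
have [M hM] := gam_geo r1p r11.
have x0 : 0 <= r / r1 by rewrite divr_ge0 // ltW.
have x1 : r / r1 < 1 by rewrite ltr_pdivrMr// mul1r.
have cs : cabs r%:C <= r by rewrite cabsR gtr0_norm.
have hu j := geo_term r1p (hM j) cs.
rewrite (@gsum_reindex _ _ k _ _ x0 x1 hu); last by move=> j /gam_parity ->; rewrite mul0r.
have M0 : 0 <= M by have := hu 0%N; rewrite !expr0 !mulr1; apply: le_trans; exact: cabs_ge0.
rewrite -(@gsumZ _ _ _ M (r / r1))//; last first.
  move=> m; apply: (le_trans (hu _)); apply: ler_wpM2l => //.
  by apply: ler_wiXn2l => //; [exact: ltW|rewrite -addnn addnA leq_addl].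
apply: gsum_eq => m.
have e1 : r%:C ^+ (k + m.*2) = (r ^+ k)%:C * (r ^+ 2)%:C ^+ m.
  by rewrite exprD -mul2n exprM !rmorphXn.
have e2 : (r ^- k)%:C * (r ^+ k)%:C = 1 by rewrite -rmorphM mulVf// expf_neq0// gt_eqF.
have aux (a b c d : R[i]) : a * b = 1 -> c * d = a * (c * (b * d)).
  by move=> ab; rewrite -[LHS]mul1r -ab; ring.
by rewrite e1; exact: aux e2.
Qed.

Lemma radial_ex : exists p, radial_ext r0 k (lf_coef f Y) p.
Proof.
exists (fun z => gsum (fun m => gam (k + m.*2) * z ^+ m)); split.
  by move=> z hz; apply/derivable_cdiff; apply: (ps_cdiff (r0 := r0 ^+ 2)) => //; exact: radial_geo.
by move=> r /andP[a b]; exact: lf_radial.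
Qed.

(** The values of an extension at the squares [r ^+ 2] are prescribed, which fixes its power series.
    So a bound on an arbitrary [p], as in (b), is a bound on the [gam (k + m.*2)]. *)
Lemma radial_coef p m : radial_ext r0 k (lf_coef f Y) p -> tcoef p (r0 ^+ 2 / 2) m = gam (k + m.*2).
Proof.
move=> [h1 h2]; have pd z : cabs z < r0 ^+ 2 -> exists d, cdiff p z d by move=> /h1 /derivable_cdiff.
have R0 : 0 < r0 ^+ 2 by rewrite exprn_gt0.
have rp : 0 < r0 ^+ 2 / 2 by rewrite divr_gt0.
have rr : r0 ^+ 2 / 2 < r0 ^+ 2 by rewrite ltr_pdivrMr// ltr_pMr// ltr1n.
have [M hM] := radial_geo rp rr; have [M' hM'] := tcoef_geo pd rp rr.
apply: (ps_eq rp hM' hM R0) => s s0 s1.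
rewrite -(taylor R0 pd); last by rewrite cabsR gtr0_norm.
have q0 : 0 < Num.sqrt s by rewrite sqrtr_gt0.
have q1 : Num.sqrt s < r0.
  by rewrite -(ltr_pXn2r (n:=2)) ?nnegrE ?sqrtr_ge0 ?ltW// sqr_sqrtr ?ltW.
have := h2 (Num.sqrt s); rewrite q0 q1 sqr_sqrtr ?(ltW s0)// => /(_ isT) ->; rewrite -(lf_radial q0 q1).
by rewrite sqr_sqrtr// ltW.
Qed.

(** Splitting [rho^-1 ^+ (k + m.*2)] pulls out the factor [rho ^- k]; the rest is a geometric series
    of ratio [(tau / rho) ^+ 2]. *)
Lemma radial_bound p (C tau rho : R) : radial_ext r0 k (lf_coef f Y) p -> 0 < tau -> tau < rho -> rho < r0 ->
  (forall j, cabs (gam j) <= C * rho^-1 ^+ j) ->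
  forall z, cabs z <= tau ^+ 2 -> cabs (p z) <= C * (1 - (tau / rho) ^+ 2)^-1 * (1 / rho ^+ k).
Proof.
move=> hp t0 tr rr0 hC z hz; have rho0 : 0 < rho := lt_trans t0 tr.
have [h1 _] := hp; have pd w : cabs w < r0 ^+ 2 -> exists d, cdiff p w d by move=> /h1 /derivable_cdiff.
have R0 : 0 < r0 ^+ 2 by rewrite exprn_gt0.
have zr : cabs z < r0 ^+ 2.
  by apply: (le_lt_trans hz); rewrite ltr_pXn2r// ?nnegrE ?ltW//; exact: lt_trans rr0.
rewrite (taylor R0 pd zr).
have tq : tau / rho < 1 by rewrite ltr_pdivrMr// mul1r.
have tq0 : 0 <= tau / rho by rewrite divr_ge0 // ltW.
have x0 : 0 <= (tau / rho) ^+ 2 by rewrite exprn_ge0.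
have x1 : (tau / rho) ^+ 2 < 1 by rewrite expr_lt1.
have -> : C * (1 - (tau / rho) ^+ 2)^-1 * (1 / rho ^+ k) = C * rho^-1 ^+ k / (1 - (tau / rho) ^+ 2).
  by rewrite exprVn mul1r mulrAC.
apply: (gsum_le x0 x1) => m; rewrite (radial_coef m hp).
have r20 : 0 < rho ^+ 2 by rewrite exprn_gt0.
have := @geo_term R (fun m => gam (k + m.*2)) (C * rho^-1 ^+ k) (rho ^+ 2) (tau ^+ 2) m z r20.
rewrite -expr_div_n; apply => //; apply: (le_trans (hC _)).
by rewrite exprD mulrA -mul2n exprM -(exprVn rho 2).
Qed.

(** Cauchy's estimate on the circle of radius [tau ^+ 2] gives the factor [tau ^- m.*2], and
    [rho ^- k] is weakened to [tau ^- k] to reach a bound in the total degree. *)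
Lemma radial_gam_bound p (C tau rho : R) : radial_ext r0 k (lf_coef f Y) p -> 0 < tau -> tau < rho -> rho < r0 ->
  0 < C -> (forall z, cabs z <= tau ^+ 2 -> cabs (p z) <= C * (1 / rho ^+ k)) ->
  forall j, cabs (gam j) <= C * tau^-1 ^+ j.
Proof.
move=> hp t0 tr rr0 C0 H j; have rho0 : 0 < rho := lt_trans t0 tr.
have [hj|hj] := boolP ((j < k)%N || odd (j + k)).
  by rewrite gam_parity// cabsR normr0 mulr_ge0 ?exprn_ge0 ?invr_ge0 ?ltW.
have [m ->] : exists m, j = (k + m.*2)%N.
  move: hj; rewrite negb_or -leqNgt => /andP[kj od]; exists (j - k)./2.
  by rewrite -[RHS]addnC -{1}(subnK kj) even_halfK// oddB// -oddD.
rewrite -(radial_coef m hp).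
have [h1 _] := hp; have pd w : cabs w < r0 ^+ 2 -> exists d, cdiff p w d by move=> /h1 /derivable_cdiff.
have t20 : 0 < tau ^+ 2 by rewrite exprn_gt0.
have tr0 : tau < r0 by exact: lt_trans rr0.
have t2r : tau ^+ 2 < r0 ^+ 2 by rewrite ltr_pXn2r// ?nnegrE ?ltW.
have := @tcoef_bound R p (r0 ^+ 2) pd (tau ^+ 2) (C * (1 / rho ^+ k)) m t20 t2r (fun z hz => H z (eq_ind_r (fun x => x <= _) (lexx _) hz)).
rewrite -ler_pdivlMr ?exprn_gt0// => /le_trans; apply.
rewrite -mulrA; apply: ler_wpM2l; first exact: ltW.
rewrite exprD -mul2n exprM !exprVn mul1r; apply: ler_wpM2r; first by rewrite invr_ge0 exprn_ge0// ltW.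
by rewrite lef_pV2 ?posrE ?exprn_gt0//; apply: lerXn2r; rewrite ?nnegrE ltW.
Qed.
End Radial.


(** * Holomorphic functions of several variables *)

Lemma differentiable_linear (K : numFieldType) (V W : normedModType K) (f : V -> W) (df : {linear V -> W}) x :
  continuous df -> (forall e, 0 < e -> \forall h \near (0 : V), `|f (h + x) - f x - df h| <= e * `|h|) ->
  differentiable f x.
Proof.
move=> dc H; have E : f \o shift x = cst (f x) + df +o_ 0 id.
  apply/eqaddoP => e e0; apply: filterS (H e e0) => h /=.
  by rewrite -addrA -opprD.
have D := diff_unique dc E.
by apply/diff_locallyP; rewrite D.
Qed.

Section MxNorm.
Variables (K : numFieldType) (n : nat).
Implicit Types h : 'rV[K]_n.

Lemma coord_le_norm h i : `|h ord0 i| <= `|h|.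
Proof.
rewrite -[leRHS]/(mx_norm h) mx_normE -[leLHS]nngE num_le.
exact: (le_bigmax _ (fun i : 'I_1 * 'I_n => `|h i.1 i.2|%:nng) (ord0, i)).
Qed.
Lemma norm_le_sum h : `|h| <= \sum_i `|h ord0 i|.
Proof.
have [->|h0] := eqVneq h 0; first by rewrite normr0; apply: sumr_ge0 => i _; exact: normr_ge0.
have [|[a i] Hi] := @mx_norm_neq0 _ _ _ h; first by rewrite -[mx_norm h]/(`|h|) normr_eq0.
rewrite -[`|h|]/(mx_norm h) Hi /= ord1 (bigD1 i)//= lerDl; apply: sumr_ge0 => j _; exact: normr_ge0.
Qed.

(** Coordinates replace the abstract derivative: it is given by its values on the standard basis,
    and the sup norm is compared with the sum of the moduli. *)
Lemma differentiable_eps (F : 'rV[K]_n -> K) (z : 'rV[K]_n) : differentiable (F : 'rV[K]_n -> K^o) z <->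
  exists A : 'I_n -> K, forall e, 0 < e -> exists2 r, 0 < r &
    forall h, (forall i, `|h ord0 i| < r) -> `|F (z + h) - F z - \sum_i h ord0 i * A i| <= e * \sum_i `|h ord0 i|.
Proof.
split=> [/diff_locallyP[_ H]|[A H]].
  exists (fun i => 'd (F : 'rV[K]_n -> K^o) z (delta_mx ord0 i)) => e e0.
  move/eqaddoP: H => /(_ e e0) /nbhs_norm0P[r r0 Hr].
  exists r => // h hr; have hn : `|h| < r.
    have [->|h0] := eqVneq h 0; first by rewrite normr0.
    have [|[a i] Hi] := @mx_norm_neq0 _ _ _ h; first by rewrite -[mx_norm h]/(`|h|) normr_eq0.
    by rewrite -[`|h|]/(mx_norm h) Hi /= ord1.
  have := Hr h hn; rewrite /= => Hh.
  have E : 'd (F : 'rV[K]_n -> K^o) z h = \sum_i h ord0 i * 'd (F : 'rV[K]_n -> K^o) z (delta_mx ord0 i).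
    by rewrite {1}[h]row_sum_delta linear_sum; apply: eq_bigr => i _; rewrite linearZ.
  rewrite -E (addrC z) -addrA -opprD; apply: (le_trans Hh).
  by apply: ler_wpM2l; [exact: ltW|exact: norm_le_sum].
pose L (h : 'rV[K]_n) : K^o := \sum_i h ord0 i * A i.
have Llin : linear L.
  move=> a u v; rewrite /L scaler_sumr -big_split /=; apply: eq_bigr => i _.
  by rewrite !mxE mulrDl /GRing.scale /= mulrA.
pose Lm := GRing.isLinear.Build K 'rV[K]_n K^o *:%R L Llin.
pose Ll : {linear 'rV[K]_n -> K^o} := HB.pack L Lm.
have Lc : continuous Ll.
  have H1 : forall i, continuous (fun h : 'rV[K]_n => (h ord0 i * A i) : K^o).
    move=> i h; apply: (@continuous_comp _ _ _ (fun h : 'rV[K]_n => h ord0 i) (fun x : K => (x * A i) : K^o)).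
      exact: coord_continuous.
    by apply: (@mulrr_continuous K).
  suff Hs (s : seq 'I_n) : continuous (fun h : 'rV[K]_n => (\sum_(i <- s) h ord0 i * A i) : K^o) by exact: Hs.
  elim: s => [|i s IH] h.
    have -> : (fun h : 'rV[K]_n => (\sum_(i <- [::]) h ord0 i * A i) : K^o) = (fun=> 0 : K^o).
      by apply/funext => v; rewrite big_nil.
    exact: (@cst_continuous _ K^o).
  rewrite (_ : (fun h => _) = (fun h : 'rV[K]_n => (h ord0 i * A i) : K^o) + (fun h : 'rV[K]_n => (\sum_(i <- s) h ord0 i * A i) : K^o)).
    exact: (continuousD (H1 i h) (IH h)).
  by apply/funext => v; rewrite big_cons.
apply: (@differentiable_linear K 'rV[K]_n K^o F Ll z Lc) => e e0.
have n0 : 0 < n.+1%:R :> K by rewrite ltr0n.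
have [r r0 Hr] := H (e / n.+1%:R) (divr_gt0 e0 n0).
apply/nbhs_norm0P; exists r => // h /= hr.
  have hi i : `|h ord0 i| < r by apply: le_lt_trans hr; exact: coord_le_norm.
rewrite (addrC h); apply: (le_trans (Hr h hi)).
rewrite -mulrA; apply: ler_wpM2l; first exact: ltW.
rewrite mulrC ler_pdivrMr//; apply: (@le_trans _ _ (\sum_(i < n) `|h|)).
  by apply: ler_sum => i _; exact: coord_le_norm.
by rewrite sumr_const card_ord -[X in X <= _]mulr_natr ler_wpM2l ?normr_ge0// ler_nat.
Qed.
End MxNorm.

Section Mvdiff.
Variables (R : realType) (n : nat).
Implicit Types (F : 'rV[R[i]]_n -> R[i]) (z w h : 'rV[R[i]]_n).

Definition mvgrad F z (A : 'I_n -> R[i]) := forall e : R, 0 < e -> exists2 r : R, 0 < r &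
  forall h, (forall i, cabs (h ord0 i) <= r) ->
    cabs (F (z + h) - F z - \sum_i h ord0 i * A i) <= e * \sum_i cabs (h ord0 i).
Definition mvdiff F z := exists A, mvgrad F z A.

Lemma holomorphic_mvP (U : set 'rV[R[i]]_n) F : holomorphic_mv U F <-> forall z, U z -> mvdiff F z.
Proof.
suff D z : (exists A : 'I_n -> R[i], forall e : R[i], 0 < e -> exists2 r : R[i], 0 < r &
    forall h, (forall i, `|h ord0 i| < r) -> `|F (z + h) - F z - \sum_i h ord0 i * A i| <= e * \sum_i `|h ord0 i|)
    <-> mvdiff F z.
  by split=> H z Uz; [apply/D/differentiable_eps|apply/differentiable_eps/D]; exact: H.
have sE h : \sum_i `|h ord0 i| = (\sum_i cabs (h ord0 i))%:C.
  by rewrite rmorph_sum; apply: eq_bigr => i _; rewrite cabsE.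
split=> -[A H]; exists A => e e0.
- have [|r r0 Hr] := H e%:C; first by rewrite ltcR.
  have Er : r = (complex.Re r)%:C by rewrite RRe_real// ger0_real// ltW.
  rewrite Er ltcR in r0; exists (complex.Re r / 2); first by rewrite divr_gt0.
  move=> h hr; have := Hr h; rewrite sE cabsE -rmorphM lecR; apply => i.
  by rewrite cabsE Er ltcR; apply: (le_lt_trans (hr i)); lra.
- have Ee : e = (complex.Re e)%:C by rewrite RRe_real// ger0_real// ltW.
  rewrite Ee ltcR in e0; have [r r0 Hr] := H _ e0.
  exists r%:C; first by rewrite ltcR.
  move=> h hr; rewrite sE cabsE Ee -rmorphM lecR; apply: Hr => i.
  by have := hr i; rewrite cabsE ltcR => /ltW.
Qed.

Lemma mvdiff_cont F z : mvdiff F z -> forall e : R, 0 < e -> exists2 r : R, 0 < r &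
  forall h, (forall i, cabs (h ord0 i) <= r) -> cabs (F (z + h) - F z) <= e.
Proof.
move=> [A H] e e0; have [r r0 Hr] := H 1 ltr01.
pose M := \sum_i (cabs (A i) + 1); have M0 : 0 <= M.
  by apply: sumr_ge0 => i _; rewrite addr_ge0 ?cabs_ge0.
exists (Num.min r (e / (M + 1))); first by rewrite lt_min r0 divr_gt0// ltr_wpDl.
move=> h hr; have h1 i : cabs (h ord0 i) <= r by have := hr i; rewrite le_min => /andP[].
have h2 i : cabs (h ord0 i) <= e / (M + 1) by have := hr i; rewrite le_min => /andP[].
have -> : F (z + h) - F z = (F (z + h) - F z - \sum_i h ord0 i * A i) + \sum_i h ord0 i * A i by rewrite subrK.
apply: (le_trans (cabsD _ _)); have := Hr h h1; rewrite mul1r => H1.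
have H2 : cabs (\sum_i h ord0 i * A i) <= \sum_i cabs (h ord0 i) * cabs (A i).
  by apply: (le_trans (cabs_sum _ _ _)); apply: ler_sum => i _; rewrite cabsM.
apply: (le_trans (lerD H1 H2)); rewrite -big_split /=.
apply: (@le_trans _ _ (\sum_i (e / (M + 1)) * (cabs (A i) + 1))).
  apply: ler_sum => i _; rewrite -[X in X + _]mulr1 -mulrDr addrC.
  by apply: ler_wpM2r; rewrite ?addr_ge0 ?cabs_ge0.
rewrite -mulr_sumr -/M mulrAC ler_pdivrMr ?ltr_wpDl//.
by apply: ler_wpM2l; [exact: ltW|rewrite lerDl].
Qed.

Lemma mvdiff_ccts (T : topologicalType) F (phi : T -> 'rV[R[i]]_n) t : mvdiff F (phi t) ->
  (forall i, ccts (fun s => phi s ord0 i) t) -> ccts (fun s => F (phi s)) t.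
Proof.
move=> /mvdiff_cont H hp; apply/cctsP => e e0; have [|r r0 Hr] := H (e / 2); first exact: divr_gt0.
have Hi : \forall s \near t, forall i, cabs (phi s ord0 i - phi t ord0 i) <= r.
  by apply: filter_forall => i; have /cctsP /(_ r r0) := hp i; apply: filterS => s /ltW.
apply: filterS Hi => s Hs; have -> : phi s = phi t + (phi s - phi t) by rewrite addrC subrK.
apply: (@le_lt_trans _ _ (e / 2)); last by rewrite ltr_pdivrMr// ltr_pMr// ltr1n.
by apply: Hr => i; rewrite !mxE; exact: Hs.
Qed.

Lemma mvgrad_line F z w (s : R[i]) A : mvgrad F (z + s *: w) A ->
  cdiff (fun s => F (z + s *: w)) s (\sum_i w ord0 i * A i).
Proof.
move=> H e e0.
pose M := \sum_i cabs (w ord0 i); have M0 : 0 <= M by apply: sumr_ge0 => i _; exact: cabs_ge0.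
have M1 : 0 < M + 1 by rewrite ltr_wpDl.
have [r r0 Hr] := H (e / (M + 1)) (divr_gt0 e0 M1).
exists (r / (M + 1)); first exact: divr_gt0.
move=> t ht; have := Hr (t *: w); rewrite -(addrA z) -scalerDl.
have -> : \sum_i (t *: w) ord0 i * A i = (\sum_i w ord0 i * A i) * t.
  by rewrite mulr_suml; apply: eq_bigr => i _; rewrite mxE; ring.
have -> : \sum_i cabs ((t *: w) ord0 i) = cabs t * M.
  by rewrite /M mulr_sumr; apply: eq_bigr => i _; rewrite mxE cabsM.
move=> /(_ _)/le_trans; apply.
  move=> i; rewrite mxE cabsM; rewrite ler_pdivlMr// in ht; apply: le_trans ht.
  apply: ler_wpM2l; first exact: cabs_ge0.
  rewrite /M (bigD1 i)//= -addrA lerDl addr_ge0//; apply: sumr_ge0 => j _; exact: cabs_ge0.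
rewrite (mulrC (cabs t)) mulrA ler_wpM2r ?cabs_ge0// mulrAC ler_pdivrMr//.
by apply: ler_wpM2l; [exact: ltW|rewrite lerDl].
Qed.
Lemma mvdiff_line F w (s : R[i]) : mvdiff F (s *: w) -> exists d, cdiff (fun s => F (s *: w)) s d.
Proof.
move=> [A H]; exists (\sum_i w ord0 i * A i).
have -> : (fun s => F (s *: w)) = (fun s => F (0 + s *: w)) by apply/funext => t; rewrite add0r.
by apply: mvgrad_line; rewrite add0r.
Qed.
End Mvdiff.


(** * The coefficients of a holomorphic function on the Lie ball *)

Section Forward.
Variables (R : realType) (n : nat).
Let N := n.+2.
Variables (r0 : R) (F : 'rV[R[i]]_N -> R[i]).
Hypotheses (r00 : 0 < r0) (hF : forall z, lie_ball N r0 z -> mvdiff F z).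

(** For a complex multiple of a real vector the modulus of [qform] equals the square of [hnorm], so
    the inner root vanishes and the Lie norm is [cabs z * enorm w]. *)
Lemma lie_ball_line (z : R[i]) (w : 'rV[R]_N) : cabs z * enorm w < r0 -> lie_ball N r0 (z *: complexify w).
Proof.
move=> H.
have e1 : hnorm (z *: complexify w) ^+ 2 = (cabs z * enorm w) ^+ 2.
  rewrite /hnorm sqr_sqrtr; last by apply: sumr_ge0 => i _; exact: sqr_ge0.
  rewrite exprMn enorm_sq mulr_sumr; apply: eq_bigr => i _.
  by rewrite !mxE cabsM exprMn cabsR real_normK// num_real.
have e2 : qform (z *: complexify w) = z ^+ 2 * (enorm w ^+ 2)%:C.
  rewrite /qform enorm_sq rmorph_sum mulr_sumr; apply: eq_bigr => i _.
  by rewrite !mxE exprMn rmorphXn.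
rewrite /lie_ball /= e2 cabsM cabsX cabsR (ger0_norm (sqr_ge0 _)) -exprMn.
rewrite (_ : hnorm (z *: complexify w) ^+ 4 = (hnorm (z *: complexify w) ^+ 2) ^+ 2); last by rewrite -exprM.
rewrite e1 subrr sqrtr0 addr0 ltr_pXn2r ?nnegrE ?mulr_ge0 ?cabs_ge0 ?enorm_ge0//; exact: ltW.
Qed.

Let g (w : 'rV[R]_N) (z : R[i]) := F (z *: complexify w).

Lemma g_cdiff w : sph w -> forall z, cabs z < r0 -> exists d, cdiff (g w) z d.
Proof. by move=> Hw z zr; apply: mvdiff_line; apply: hF; apply: lie_ball_line; rewrite Hw mulr1. Qed.

Lemma F_ccts (r : R) (w : 'rV[R]_N) (v : 'rV[R]_2) : 0 <= r -> r * enorm w < r0 -> sph v ->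
  ccts (fun p : 'rV[R]_N * 'rV[R]_2 => F ((r%:C * zof p.2) *: complexify p.1)) (w, v).
Proof.
move=> r1 rw Hv; apply: (mvdiff_ccts (phi := fun p : 'rV[R]_N * 'rV[R]_2 => (r%:C * zof p.2) *: complexify p.1)).
  change (mvdiff F ((r%:C * zof v) *: complexify w)); apply: hF; apply: lie_ball_line.
  by rewrite cabsM (zof_sph Hv) mulr1 cabsR ger0_norm.
move=> i; rewrite (_ : (fun s => _) = (fun p : 'rV[R]_N * 'rV[R]_2 => (r%:C * zof p.2) * (p.1 ord0 i)%:C)); last first.
  by apply/funext => p; rewrite !mxE.
apply: cctsM.
  apply: cctsM; first exact: ccts_cst.
  apply: (@ccts_comp _ _ _ (fun p : 'rV[R]_N * 'rV[R]_2 => p.2) (@zof R)); last exact: zof_cont.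
  exact: cvg_snd.
apply: ccts_real; apply: (@cont_fst 'rV[R]_N 'rV[R]_2 R (fun v : 'rV[R]_N => v ord0 i)).
exact: cont_coord.
Qed.

Lemma near_enorm (r : R) (w : 'rV[R]_N) : r * enorm w < r0 -> \forall v \near w, r * enorm v < r0.
Proof.
move=> H; have c : {for w, continuous (fun v : 'rV[R]_N => r * enorm v)}.
  by apply: contM; [exact: cont_cst|exact: enorm_cont].
have /cvgrPdistC_lt /(_ (r0 - r * enorm w)) := c; rewrite subr_gt0 => /(_ H).
apply: filterS => v /= /(le_lt_trans (ler_norm _)).
by rewrite ltrD2r.
Qed.

Lemma tcoef_sccts j : sccts (fun w => tcoef (g w) (r0 / 2) j).
Proof.
move=> w Hw; have rp : 0 < r0 / 2 by rewrite divr_gt0.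
have rr : r0 / 2 < r0 by rewrite ltr_pdivrMr// ltr_pMr// ltr1n.
rewrite /tcoef; apply: cctsM; first exact: ccts_cst.
apply: (sphere_intC_param (H := fun (w : 'rV[R]_N) (v : 'rV[R]_2) => g w ((r0 / 2)%:C * zof v) * ((r0 / 2)%:C * zof v)^-1 ^+ j)).
have Hw1 : r0 / 2 * enorm w < r0 by rewrite Hw mulr1.
apply: filterS (near_enorm Hw1) => u Hu v Hv; apply: cctsM; first exact: (F_ccts (ltW rp) Hu Hv).
apply: cctsX; rewrite (_ : (fun s => _) = (fun p : 'rV[R]_N * 'rV[R]_2 => ((r0 / 2)%:C)^-1 * (zof p.2)^-1)); last first.
  by apply/funext => p; rewrite invfM.
apply: cctsM; first exact: ccts_cst.
apply: (@ccts_comp _ _ _ (fun p : 'rV[R]_N * 'rV[R]_2 => p.2) (fun v : 'rV[R]_2 => (zof v)^-1)); first exact: cvg_snd.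
exact: zofV_sccts.
Qed.

(* The circle means of |F| depend continuously on the direction, hence are bounded on the sphere. *)
Lemma tcoef_unif (r : R) : 0 < r -> r < r0 ->
  exists2 M, 0 < M & forall j w, sph w -> cabs (tcoef (g w) (r0 / 2) j) <= M * r^-1 ^+ j.
Proof.
move=> rp rr; pose h (w : 'rV[R]_N) := sphere_int (fun v : 'rV[R]_2 => cabs (g w (r%:C * zof v))).
have hc : scont h.
  move=> w Hw; have Hw1 : r * enorm w < r0 by rewrite Hw mulr1.
  apply: (sphere_int_param (H := fun (w : 'rV[R]_N) (v : 'rV[R]_2) => cabs (g w (r%:C * zof v)))).
    by move=> v Hv; apply: ccts_cabs; exact: (F_ccts (ltW rp) Hw1 Hv).
  apply: filterS (near_enorm Hw1) => u Hu v Hv.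
  apply: (@cont_pair2 _ _ _ (fun (w : 'rV[R]_N) (v : 'rV[R]_2) => cabs (g w (r%:C * zof v))) u v).
  by apply: ccts_cabs; exact: (F_ccts (ltW rp) Hu Hv).
have [th Hth Hmax] := sph_max hc.
have S0 := sarea_gt0 R 1.
have h0 : 0 <= h th.
  have := @sphere_int_le R 1 (fun=> 0) (fun v : 'rV[R]_2 => cabs (g th (r%:C * zof v))).
  rewrite sphere_int0; apply; first exact: scont_cst.
    move=> v Hv; apply: ccts_cabs.
    apply: (@cdiff_sccts _ (g th) r) => // z zr; apply: g_cdiff => //; by rewrite zr gtr0_norm.
  by move=> v _; exact: cabs_ge0.
exists (h th / sarea R 2 + 1); first by rewrite ltr_wpDl// divr_ge0// ltW.
move=> j w Hw; have gd := g_cdiff Hw.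
have E := @tcoef_const _ _ _ gd r j rp rr.
have gs : sccts (fun v : 'rV[R]_2 => g w (r%:C * zof v)).
  by apply: (@cdiff_sccts _ (g w) r) => z zr; apply: gd; rewrite zr gtr0_norm.
have B : cabs (circ (fun z => g w z * z^-1 ^+ j) r) <= r^-1 ^+ j * h w.
  have gsc : scont (fun v : 'rV[R]_2 => cabs (g w (r%:C * zof v))) by move=> v Hv; apply: ccts_cabs; exact: gs.
  rewrite -[_ * h w]sphere_intZ//; apply: sphere_intC_abs.
  - apply: scctsM => // v Hv; apply: cctsX.
    rewrite (_ : (fun s => _) = (fun v : 'rV[R]_2 => (r%:C)^-1 * (zof v)^-1)); last first.
      by apply/funext => p; rewrite invfM.
    by apply: cctsM; [exact: ccts_cst|exact: zofV_sccts].
  - exact: scontZ.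
  - move=> v Hv; rewrite cabsM cabsX cabsV cabsM zof_sph// mulr1 cabsR gtr0_norm//.
    by rewrite mulrC.
rewrite E cabsM cabsR gtr0_norm// in B.
have {}B : cabs (tcoef (g w) (r0 / 2) j) <= r^-1 ^+ j * h w / sarea R 2.
  by rewrite ler_pdivlMr// mulrC.
apply: (le_trans B); rewrite -mulrA mulrC; apply: ler_wpM2r; first by rewrite exprn_ge0// invr_ge0 ltW.
apply: (@le_trans _ _ (h th / sarea R 2)); last by rewrite lerDl.
by apply: ler_wpM2r; [rewrite invr_ge0 ltW|exact: Hmax].
Qed.

Definition lfc (Q : mpoly N R[i]) j := sphere_intC (fun w => tcoef (g w) (r0 / 2) j * (mpoly_at Q w)^*).

Lemma conj_sccts (Q : mpoly N R[i]) : sccts (fun w => (mpoly_at Q w)^*).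
Proof. by apply: scctsJ; exact: mpoly_at_sccts. Qed.

(** From [x <= x ^+ 2 + 1] pointwise. The bound is the same for every normalized [Q], as uniformity
    in [k] and [l] demands. *)
Lemma unit_L1 (Q : mpoly N R[i]) : sphere_dot Q Q = 1 -> sphere_int (fun w => cabs (mpoly_at Q w)) <= sarea R N + 1.
Proof.
move=> H; have Qs : scont (fun w : 'rV[R]_N => cabs (mpoly_at Q w)).
  by move=> w Hw; apply: ccts_cabs; exact: mpoly_at_sccts.
have E : sphere_int (fun w => cabs (mpoly_at Q w) ^+ 2) = 1.
  have h : (sphere_int (fun w => cabs (mpoly_at Q w) ^+ 2))%:C = 1.
    by rewrite -sphere_intC_real -H; apply: eq_sphere_intC => w _; rewrite mulcJE rmorphXn.
  by have := congr1 (@complex.Re R) h.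
have s2 : scont (fun w : 'rV[R]_N => cabs (mpoly_at Q w) ^+ 2).
  by move=> w Hw; apply: contX; exact: Qs.
rewrite -E -[X in X + _]mul1r -sphere_int_cst -sphere_intD//; last exact: scont_cst.
apply: sphere_int_le => //.
  by apply: (@scontD _ _ (fun=> 1)) => //; exact: scont_cst.
move=> w _; set x := cabs _.
have := sqr_ge0 (x - 1); have := sqr_ge0 (x + 1); nra.
Qed.

Lemma lfc_bound (r : R) : 0 < r -> r < r0 -> exists2 M, 0 < M &
  forall Q, sphere_dot Q Q = 1 -> forall j, cabs (lfc Q j) <= M * r^-1 ^+ j.
Proof.
move=> rp rr; have [M M0 HM] := tcoef_unif rp rr.
have S0 := sarea_gt0 R n.+1; have S1 : 0 < sarea R N + 1 by rewrite ltr_wpDl// ltW.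
exists (M * (sarea R N + 1)); first exact: mulr_gt0.
move=> Q HQ j; have Qs : scont (fun w : 'rV[R]_N => cabs (mpoly_at Q w)).
  by move=> w Hw; apply: ccts_cabs; exact: mpoly_at_sccts.
apply: (@le_trans _ _ (sphere_int (fun w => (M * r^-1 ^+ j) * cabs (mpoly_at Q w)))).
  apply: sphere_intC_abs; first by apply: scctsM; [exact: tcoef_sccts|exact: conj_sccts].
    exact: scontZ.
  by move=> w Hw; rewrite cabsM cabsJ ler_wpM2r ?cabs_ge0// HM.
rewrite sphere_intZ// [X in _ <= X]mulrAC; apply: ler_wpM2l; last exact: unit_L1.
by rewrite mulr_ge0 ?exprn_ge0 ?invr_ge0// ltW.
Qed.

Variable f : 'rV[R]_N -> R[i].
Hypothesis fF : forall x, eball N r0 x -> F (complexify x) = f x.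

Lemma lf_lfc Q (r : R) : sphere_dot Q Q = 1 -> 0 <= r -> r < r0 ->
  lf_coef f Q r = gsum (fun j => lfc Q j * r%:C ^+ j).
Proof.
move=> HQ r1 rr; pose rho := (r + r0) / 2.
have rr1 : r < rho by rewrite ltr_pdivlMr// mulr_natr mulr2n ltrD2l.
have rho0 : 0 < rho := le_lt_trans r1 rr1.
have rho1 : rho < r0 by rewrite ltr_pdivrMr// mulr_natr mulr2n ltrD2r.
have x0 : 0 <= r / rho by rewrite divr_ge0 // ltW.
have x1 : r / rho < 1 by rewrite ltr_pdivrMr// mul1r.
have cr : cabs r%:C <= r by rewrite cabsR ger0_norm.
have [M M0 HM] := tcoef_unif rho0 rho1.
have Qs : scont (fun w : 'rV[R]_N => cabs (mpoly_at Q w)).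
  by move=> w Hw; apply: ccts_cabs; exact: mpoly_at_sccts.
have [th Hth Hmax] := sph_max Qs; pose B := cabs (mpoly_at Q th).
pose u j (w : 'rV[R]_N) := (mpoly_at Q w)^* * (tcoef (g w) (r0 / 2) j * r%:C ^+ j).
have ub j w : sph w -> cabs (u j w) <= (B * M) * (r / rho) ^+ j.
  move=> Hw; rewrite /u cabsM cabsJ -mulrA; apply: ler_pM; rewrite ?cabs_ge0//; first exact: Hmax.
  exact: (geo_term rho0 (HM j w Hw) cr).
have us j : sccts (u j).
  apply: scctsM; first exact: conj_sccts.
  by apply: scctsM; [exact: tcoef_sccts|move=> w _; exact: ccts_cst].
transitivity (sphere_intC (fun w => gsum (fun j => u j w))).
  apply: eq_sphere_intC => w Hw; rewrite /u.
  have zr : cabs r%:C < r0 by exact: le_lt_trans rr.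
  rewrite (@gsumZ _ _ _ M (r / rho))//; last by move=> j; exact: (geo_term rho0 (HM j w Hw) cr).
  rewrite mulrC -(taylor r00 (g_cdiff Hw) zr); congr (_ * _).
  rewrite /g -fF; last by rewrite /eball /= enormZ ger0_norm// Hw mulr1.
  by congr F; apply/rowP => i; rewrite !mxE rmorphM.
rewrite (sphere_intC_gsum x0 x1 us ub); apply: gsum_eq => j.
rewrite mulrC /lfc -sphere_intCZ; last by apply: scctsM; [exact: tcoef_sccts|exact: conj_sccts].
by apply: eq_sphere_intC => w _; rewrite /u; ring.
Qed.

Lemma forward_coef Q : sphere_dot Q Q = 1 -> exists g, coef_ext r0 (lf_coef f Q) g.
Proof.
move=> HQ; exists (fun z => gsum (fun j => lfc Q j * z ^+ j)); split.
  move=> z zr; apply/derivable_cdiff; apply: (ps_cdiff (r0 := r0)) => // r r1 rr.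
  by have [M _ HM] := lfc_bound r1 rr; exists M; exact: HM.
by move=> r /andP[a b]; rewrite -lf_lfc.
Qed.

Lemma forward_bound (tau rho : R) : smooth_on (eball N r0) f -> 0 < tau -> tau < rho -> rho < r0 ->
  exists2 C, 0 < C & forall k Q p, harmonic_homog k Q -> sphere_dot Q Q = 1 -> radial_ext r0 k (lf_coef f Q) p ->
    forall z, cabs z <= tau ^+ 2 -> cabs (p z) <= C * (1 / rho ^+ k).
Proof.
move=> hf t0 tr rr; have rho0 : 0 < rho := lt_trans t0 tr.
have [M M0 HM] := lfc_bound rho0 rr.
have tq : tau / rho < 1 by rewrite ltr_pdivrMr// mul1r.
have tq0 : 0 <= tau / rho by rewrite divr_ge0 // ltW.
have x1 : (tau / rho) ^+ 2 < 1 by rewrite expr_lt1.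
exists (M * (1 - (tau / rho) ^+ 2)^-1); first by rewrite mulr_gt0// invr_gt0 subr_gt0.
move=> k Q p hQ uQ hp z zt; have [g1 hg] := forward_coef uQ.
apply: (radial_bound r00 hf hQ hg hp t0 tr rr) => // j.
have rp : 0 < r0 / 2 by rewrite divr_gt0.
have rr2 : r0 / 2 < r0 by rewrite ltr_pdivrMr// ltr_pMr// ltr1n.
have [M1 HM1] := gam_geo hg rp rr2; have [M2 _ HM2] := lfc_bound rp rr2.
(* The coefficients of the extension [g1] coincide with the [lfc Q j], since both series sum to
   [lf_coef f Q] on the radii; so the uniform bound applies to them. *)
rewrite (ps_eq rp HM1 (HM2 Q uQ) r00) ?HM// => s s0 s1.
by rewrite -(lf_ps r00 hg) ?lf_lfc// ltW.
Qed.
End Forward.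


(** * Homogeneous polynomials on the Lie ball *)

Section Bihom.
Variable R : realType.
Implicit Types (f g : R[i] -> R[i] -> R[i]) (q : nat -> R[i]).

(** Binary forms of degree [d], with the coefficients [q] kept visible because they are what gets
    estimated. *)
Definition bihom_with d q f := forall s t, f s t = \sum_(m < d.+1) q m * s ^+ (d - m) * t ^+ m.
Definition bihom d f := exists q, bihom_with d q f.

Lemma bihomZ d f c : bihom d f -> bihom d (fun s t => c * f s t).
Proof.
move=> [q H]; exists (fun m => c * q m) => s t; rewrite H mulr_sumr; apply: eq_bigr => m _.
by rewrite !mulrA.
Qed.
Lemma bihom_sum d (I : Type) (r : seq I) (F : I -> R[i] -> R[i] -> R[i]) :
  (forall i, bihom d (F i)) -> bihom d (fun s t => \sum_(i <- r) F i s t).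
Proof.
move=> /choice[q H]; exists (fun m => \sum_(i <- r) q i m) => s t.
transitivity (\sum_(i <- r) \sum_(m < d.+1) q i m * s ^+ (d - m) * t ^+ m).
  by apply: eq_bigr => i _; exact: H.
by rewrite exchange_big; apply: eq_bigr => m _; rewrite !mulr_suml.
Qed.
Lemma bihom_lin d f a b : bihom d f -> bihom d.+1 (fun s t => (s * a + t * b) * f s t).
Proof.
move=> [q H]; pose q1 m := if (m <= d)%N then a * q m else 0.
pose q2 m := if m is m'.+1 then b * q m' else 0.
exists (fun m => q1 m + q2 m) => s t; rewrite H mulrDl.
transitivity (\sum_(m < d.+2) q1 m * s ^+ (d.+1 - m) * t ^+ m + \sum_(m < d.+2) q2 m * s ^+ (d.+1 - m) * t ^+ m); last first.
  by rewrite -big_split; apply: eq_bigr => m _; rewrite /= !mulrDl.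
congr (_ + _).
- have q1e : q1 d.+1 = 0 by rewrite /q1 ltnn.
  rewrite [RHS]big_ord_recr /= q1e !mul0r addr0 mulr_sumr; apply: eq_bigr => m _.
  have md : (m <= d)%N by rewrite -ltnS.
  by rewrite /q1 md subSn// exprS; ring.
- rewrite [RHS]big_ord_recl /= !mul0r add0r mulr_sumr; apply: eq_bigr => m _.
  by rewrite /bump /= add1n subSS exprS; ring.
Qed.

(** On the unit circle [t] is the inverse of [s], so [q m] multiplies the power [d - 2 m]: the
    coefficients are Fourier coefficients of a function bounded by [A]. *)
Lemma bihom_bound d q f A : bihom_with d q f ->
  (forall w, sph w -> cabs (f (zof w) (zof w)^-1) <= A) -> forall m, (m < d.+1)%N -> cabs (q m) <= A.
Proof.
move=> H HA m md.
have S0 := sarea_gt0 R 1.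
(* The added factor, the power [2 m - d] of [zof w], has modulus 1 and moves the coefficient [q m]
   to frequency 0. *)
pose h (w : 'rV[R]_2) := f (zof w) (zof w)^-1 * (zof w)^-1 ^+ d * zof w ^+ m.*2.
have hE (w : 'rV[R]_2) : sph w -> h w = \sum_(i < d.+1) q i * (zof w ^+ m.*2 * (zof w)^-1 ^+ i.*2).
  move=> Hw; rewrite /h H mulr_suml mulr_suml; apply: eq_bigr => i _.
  have z0 := zof_neq0 Hw.
  have e1 : zof w ^+ (d - i) * (zof w)^-1 ^+ d = (zof w)^-1 ^+ i.
    have -> : (zof w)^-1 ^+ d = (zof w)^-1 ^+ (d - i) * (zof w)^-1 ^+ i by rewrite -exprD subnK// -ltnS.
    by rewrite mulrA -exprMn divff// expr1n mul1r.
  have -> : (zof w)^-1 ^+ i.*2 = (zof w ^+ (d - i) * (zof w)^-1 ^+ d) * (zof w)^-1 ^+ i by rewrite e1 -exprD addnn.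
  ring.
have aux (i : nat) : sccts (fun w : 'rV[R]_2 => zof w ^+ m.*2 * (zof w)^-1 ^+ i.*2).
  move=> w Hw; apply: cctsM; apply: cctsX; first exact: zof_cont.
  exact: zofV_sccts.
have E : sphere_intC h = q m * (sarea R 2)%:C.
  rewrite (eq_sphere_intC hE) sphere_intC_sum; last by move=> i; apply: scctsZ; exact: aux.
  rewrite (bigD1 (Ordinal md))//= big1 ?addr0.
    by rewrite sphere_intCZ ?circ_pow ?eqxx//; exact: aux.
  move=> i im; rewrite sphere_intCZ ?circ_pow; last exact: aux.
  rewrite ifF ?mulr0//; apply: contraNF im => /eqP /double_inj e.
  by apply/eqP/val_inj.
have B : cabs (sphere_intC h) <= A * sarea R 2.
  rewrite (eq_sphere_intC hE); apply: sphere_intC_bound.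
    by apply: sccts_sum => i; apply: scctsZ; exact: aux.
  by move=> w Hw; rewrite -hE// /h !cabsM !cabsX cabsV zof_sph// invr1 !expr1n !mulr1; exact: HA.
by rewrite E cabsM cabsR gtr0_norm// ler_pM2r// in B.
Qed.
End Bihom.

Section PolyBounds.
Variables (R : realType) (n : nat).
Let N := n.+2.
Implicit Types (P : mpoly N R[i]) (x y w : 'rV[R]_N).

(** By induction on the degree: Euler's identity writes [P] through its partial derivatives, each
    multiplied by a linear form. *)
Lemma bihom_meval d P (a b : 'I_N -> R[i]) : hom d P -> bihom d (fun s t => meval (fun i => s * a i + t * b i) P).
Proof.
elim: d P => [|d IH] P hP.
  exists (fun=> \sum_(m <- msupp P) mcoeff m P) => s t.
  rewrite big_ord1 !mulr1 mevalE big_seq [RHS]big_seq; apply: eq_bigr => m Hm.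
  have /eqP := (homP 0 P).1 hP m Hm; rewrite mdeg_eq0 => /eqP ->.
  by rewrite big1 ?mulr1// => i _; rewrite mnmE.
have E v : meval v P = (d.+1%:R)^-1 * \sum_i v i * meval v (mderiv i P).
  have := congr1 (meval v) (euler hP); rewrite mevalZ => H.
  have nz : d.+1%:R != 0 :> R[i] by rewrite pnatr_eq0.
  rewrite -[LHS](mulKf nz) -H raddf_sum; congr (_ * _); apply: eq_bigr => i _.
  by rewrite /= mevalM mevalXU.
have [q Hq] : bihom d.+1 (fun s t => (d.+1%:R)^-1 * \sum_i (s * a i + t * b i) * meval (fun i => s * a i + t * b i) (mderiv i P)).
  apply: bihomZ; apply: bihom_sum => i; apply: bihom_lin; apply: IH; exact: hom_deriv.
by exists q => s t; rewrite E; exact: Hq.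
Qed.

Lemma enorm_polar x : exists2 u, sph u & x = enorm x *: u.
Proof.
have [x0|x0] := eqVneq (enorm x) 0.
  have [u Hu] := sph_inhabited R n.+1; exists u => //; rewrite x0 scale0r; apply/rowP => i.
  by have := enorm_coord x i; rewrite x0 normr_le0 mxE => /eqP.
by exists (nrm x); [exact: sph_nrm|rewrite /nrm scalerA divff// scale1r].
Qed.
Lemma hom_bound d P M : hom d P -> (forall w, sph w -> cabs (mpoly_at P w) <= M) ->
  forall x, cabs (mpoly_at P x) <= M * enorm x ^+ d.
Proof.
move=> hP HM x; have [u Hu E] := enorm_polar x.
rewrite {1}E (mpoly_at_ray _ _ hP) cabsM cabsX cabsR ger0_norm ?enorm_ge0// mulrC.
by apply: ler_wpM2r; [rewrite exprn_ge0 ?enorm_ge0|exact: HM].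
Qed.

(* For [w] on the unit circle, [zof w * cdir x y + conjugate] is the real vector
   [w 0 x + w 1 y]. *)
Definition cdir x y (i : 'I_N) : R[i] := (x ord0 i / 2) -i* (y ord0 i / 2).

(** On the unit circle the form takes values of [P] at real vectors of norm at most [B], where
    homogeneity gives the bound; [bihom_bound] passes it to the coefficients. *)
Lemma hom_plane d P M B x y : hom d P -> (forall w, sph w -> cabs (mpoly_at P w) <= M) ->
  (forall v : 'rV[R]_2, sph v -> enorm (v ord0 ord0 *: x + v ord0 (lift ord0 ord0) *: y) <= B) ->
  exists q, (forall m, (m < d.+1)%N -> cabs (q m) <= M * B ^+ d) /\
    bihom_with d q (fun s t => meval (fun i => s * cdir x y i + t * (cdir x y i)^*) P).
Proof.
move=> hP HM HB; have [q Hq] := bihom_meval (cdir x y) (fun i => (cdir x y i)^*) hP.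
exists q; split => //; apply: (bihom_bound Hq) => v Hv; rewrite zofV//.
pose u := v ord0 ord0 *: x + v ord0 (lift ord0 ord0) *: y.
have -> : meval (fun i => zof v * cdir x y i + (zof v)^* * (cdir x y i)^*) P = mpoly_at P u.
  apply: meval_eq => i; apply: ceqP; rewrite /u !mxE /zof /cdir /=; field; by [].
have M0 : 0 <= M by have [w Hw] := sph_inhabited R n.+1; exact: le_trans (cabs_ge0 _) (HM w Hw).
apply: (le_trans (hom_bound hP HM u)); apply: ler_wpM2l => //.
apply: lerXn2r; rewrite ?nnegrE ?enorm_ge0//; last exact: HB.
exact: le_trans (enorm_ge0 _) (HB v Hv).
Qed.

Definition lie_norm (z : 'rV[R[i]]_N) : R := Num.sqrt (hnorm z ^+ 2 + Num.sqrt (hnorm z ^+ 4 - cabs (qform z) ^+ 2)).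

(* A rotation of the phase makes [qform z] nonnegative, that is, the real and
   imaginary parts of [z] orthogonal. *)
Lemma lie_norm_axes (z : 'rV[R[i]]_N) : exists (lam : R[i]) x y, [/\ cabs lam = 1, z = lam *: \row_i (x ord0 i +i* y ord0 i),
  \sum_i x ord0 i * y ord0 i = 0, enorm y <= enorm x & lie_norm z = enorm x + enorm y].
Proof.
(* [lam] is a square root of the phase of [qform z]; when [qform z] vanishes any phase will do. *)
have [lam l1 lq] : exists2 lam : R[i], cabs lam = 1 & qform z = lam ^+ 2 * (cabs (qform z))%:C.
  have [q0|q0] := eqVneq (qform z) 0.
    exists 1; first by rewrite cabsR normr1.
    by rewrite q0 (_ : cabs 0 = 0) ?mulr0// cabsR normr0.
  pose mu := sqrtc (qform z); have mE : mu ^+ 2 = qform z by exact: sqr_sqrtc.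
  have m0 : mu != 0 by apply: contraNneq q0 => m0; rewrite -mE m0 expr0n.
  have cm : 0 < cabs mu by rewrite cabs_gt0.
  exists (mu / (cabs mu)%:C); first by rewrite cabsM cabsV cabsR gtr0_norm// divff// gt_eqF.
  have c0 : (cabs mu)%:C != 0 :> R[i] by rewrite -cabs_gt0 cabsR gtr0_norm.
  rewrite -mE cabsX expr_div_n rmorphXn mulfVK// expf_neq0//.
have l0 : lam != 0 by rewrite -cabs_gt0 l1.
pose x : 'rV[R]_N := \row_i complex.Re (lam^-1 * z ord0 i).
pose y : 'rV[R]_N := \row_i complex.Im (lam^-1 * z ord0 i).
have zE i : lam^-1 * z ord0 i = x ord0 i +i* y ord0 i by rewrite !mxE; case: (lam^-1 * _).
have hE : hnorm z ^+ 2 = enorm x ^+ 2 + enorm y ^+ 2.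
  rewrite /hnorm sqr_sqrtr; last by apply: sumr_ge0 => i _; exact: sqr_ge0.
  rewrite !enorm_sq -big_split; apply: eq_bigr => i _ /=.
  have -> : cabs (z ord0 i) = cabs (lam^-1 * z ord0 i) by rewrite cabsM cabsV l1 invr1 mul1r.
  by rewrite zE cabs_sqr.
have qE : (cabs (qform z))%:C = \sum_i (x ord0 i +i* y ord0 i) ^+ 2.
  have -> : (cabs (qform z))%:C = (lam^-1) ^+ 2 * qform z by rewrite {2}lq mulrA -exprMn mulVf// expr1n mul1r.
  by rewrite /qform mulr_sumr; apply: eq_bigr => i _; rewrite -zE exprMn.
have q1 : cabs (qform z) = enorm x ^+ 2 - enorm y ^+ 2.
  have := congr1 (@complex.Re R) qE; rewrite cRe_sum /= => ->.
  by rewrite !enorm_sq -sumrB; apply: eq_bigr => i _; rewrite -!expr2.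
have q2 : \sum_i x ord0 i * y ord0 i = 0.
  have := congr1 (@complex.Im R) qE; rewrite cIm_sum /= => /esym H.
  have : \sum_i x ord0 i * y ord0 i *+ 2 = 0.
    rewrite -[RHS]H; apply: eq_bigr => i _; rewrite /=; ring.
  by rewrite sumrMnl => /eqP; rewrite mulrn_eq0 => /eqP.
have yx : enorm y <= enorm x.
  rewrite -(ler_pXn2r (n:=2)) ?nnegrE ?enorm_ge0// -subr_ge0 -q1; exact: cabs_ge0.
exists lam, x, y; split => //.
  by apply/rowP => i; rewrite mxE [X in lam * X]mxE -zE mulrA divff// mul1r.
have s0 : 0 <= enorm x + enorm y by rewrite addr_ge0 ?enorm_ge0.
rewrite /lie_norm (_ : hnorm z ^+ 4 = (hnorm z ^+ 2) ^+ 2); last by rewrite -exprM.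
(* The squares of [|x|^2 + |y|^2] and [|x|^2 - |y|^2] differ by the square of [2 |x| |y|], so the
   outer root is taken of the square of [|x| + |y|]. *)
rewrite hE q1 (_ : _ - _ = (2 * (enorm x * enorm y)) ^+ 2); last by ring.
rewrite sqrtr_sqr ger0_norm ?mulr_ge0 ?enorm_ge0// (_ : _ + _ = (enorm x + enorm y) ^+ 2); last by ring.
by rewrite sqrtr_sqr ger0_norm.
Qed.

(** The factor [d.+1] counts the coefficients of the binary form; each is at most [M], and both
    parameters are at most the Lie norm in modulus. *)
Lemma lie_bound d P M (z : 'rV[R[i]]_N) : hom d P -> (forall w, sph w -> cabs (mpoly_at P w) <= M) ->
  cabs (meval (fun i => z ord0 i) P) <= d.+1%:R * M * lie_norm z ^+ d.
Proof.
move=> hP HM; have M0 : 0 <= M by have [w Hw] := sph_inhabited R n.+1; exact: le_trans (cabs_ge0 _) (HM w Hw).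
have [lam [x [y [l1 zE xy yx ->]]]] := lie_norm_axes z.
(* The phase [lam] factors out by homogeneity, read off from [bihom_meval] with second direction
   0. *)
have E : cabs (meval (fun i => z ord0 i) P) = cabs (meval (fun i => x ord0 i +i* y ord0 i) P).
  have [q Hq] := bihom_meval (fun i => x ord0 i +i* y ord0 i) (fun=> 0) hP.
  have e1 : meval (fun i => z ord0 i) P = lam ^+ d * q 0%N.
    transitivity (meval (fun i => lam * (x ord0 i +i* y ord0 i) + 0 * 0) P).
      by apply: meval_eq => i; rewrite zE !mxE mulr0 addr0.
    rewrite Hq big_ord_recl big1 ?addr0; last by move=> i _; rewrite /= exprS mul0r mulr0.
    by rewrite subn0 mulr1 mulrC.
  have e2 : meval (fun i => x ord0 i +i* y ord0 i) P = q 0%N.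
    transitivity (meval (fun i => 1 * (x ord0 i +i* y ord0 i) + 0 * 0) P).
      by apply: meval_eq => i; rewrite mul1r mulr0 addr0.
    rewrite Hq big_ord_recl big1 ?addr0; last by move=> i _; rewrite /= exprS mul0r mulr0.
    by rewrite expr1n !mulr1.
  by rewrite e1 e2 cabsM cabsX l1 expr1n mul1r.
(* When [y] vanishes there is no second axis to normalize, and the bound at real points suffices. *)
rewrite E; have [y0|y0] := eqVneq (enorm y) 0.
  have -> : meval (fun i => x ord0 i +i* y ord0 i) P = mpoly_at P x.
    apply: meval_eq => i; have := enorm_coord y i; rewrite y0 normr_le0 => /eqP ->.
    by [].
  rewrite y0 addr0; apply: (le_trans (hom_bound hP HM x)).
  apply: ler_wpM2r; first by rewrite exprn_ge0 ?enorm_ge0.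
  by rewrite ler_peMl// ler1n.
have yp : 0 < enorm y by rewrite lt_neqAle eq_sym y0 enorm_ge0.
have xp : 0 < enorm x := lt_le_trans yp yx.
pose u := nrm x; pose v := nrm y.
have HB (t : 'rV[R]_2) : sph t -> enorm (t ord0 ord0 *: u + t ord0 (lift ord0 ord0) *: v) <= 1.
  move=> /sphE; rewrite big_ord_recl big_ord1 => Ht.
  have uv : \sum_i u ord0 i * v ord0 i = 0.
    transitivity ((enorm x)^-1 * (enorm y)^-1 * \sum_i x ord0 i * y ord0 i); last by rewrite xy mulr0.
    by rewrite mulr_sumr; apply: eq_bigr => i _; rewrite !mxE; ring.
  have hu : \sum_i u ord0 i ^+ 2 = 1 by apply/sphE; apply: sph_nrm; rewrite gt_eqF.
  have hv : \sum_i v ord0 i ^+ 2 = 1 by apply/sphE; apply: sph_nrm; rewrite gt_eqF.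
  rewrite -(ler_pXn2r (n:=2)) ?nnegrE ?enorm_ge0// enorm_sq expr1n.
  set a := t ord0 ord0 in Ht *; set b := t ord0 (lift ord0 ord0) in Ht *.
  have -> : \sum_i (a *: u + b *: v) ord0 i ^+ 2 = a ^+ 2 * (\sum_i u ord0 i ^+ 2) + b ^+ 2 * (\sum_i v ord0 i ^+ 2) + 2 * a * b * \sum_i u ord0 i * v ord0 i.
    by rewrite !mulr_sumr -!big_split; apply: eq_bigr => i _; rewrite !mxE /=; ring.
  by rewrite uv hu hv mulr0 addr0 !mulr1 Ht.
have [q [qb Hq]] := hom_plane hP HM HB.
(* [cdir u v] is [(u - i v) / 2]; the two parameters are chosen so that the combination is
   [|x| u + i |y| v], that is, [x + i y]. *)
have -> : meval (fun i => x ord0 i +i* y ord0 i) P =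
   meval (fun i => (enorm x - enorm y)%:C * cdir u v i + (enorm x + enorm y)%:C * (cdir u v i)^*) P.
  apply: meval_eq => i; apply: ceqP; rewrite /cdir /u /v !mxE /=; field; rewrite ?gt_eqF//.
rewrite Hq; apply: (le_trans (cabs_sum _ _ _)).
rewrite -mulrA mulr_natl -[in X in _ <= X](card_ord d.+1) -sumr_const; apply: ler_sum => m _.
have md := ltn_ord m.
have -> : M * (enorm x + enorm y) ^+ d = M * (enorm x + enorm y) ^+ (d - m) * (enorm x + enorm y) ^+ m.
  by rewrite -mulrA -exprD subnK// -ltnS.
have s1 : 0 <= enorm x - enorm y by rewrite subr_ge0.
have s2 : 0 <= enorm x + enorm y by rewrite addr_ge0 ?enorm_ge0.
rewrite !cabsM !cabsX !cabsR (ger0_norm s1) (ger0_norm s2).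
apply: ler_wpM2r; first exact: exprn_ge0.
have := qb m md; rewrite expr1n mulr1 => qm.
apply: ler_pM; rewrite ?cabs_ge0 ?exprn_ge0//.
by apply: lerXn2r; rewrite ?nnegrE//; apply: lerD => //; apply: (@le_trans _ _ 0); rewrite ?oppr_le0 enorm_ge0.
Qed.
End PolyBounds.


(** * From mean-square bounds to sup bounds for polynomials on the sphere *)

Section Nikolskii.
Variables (R : realType) (n : nat).
Let N := n.+2.
Implicit Types (P : mpoly N R[i]) (x y w : 'rV[R]_N).

Lemma sqr_le (a b : R) : 0 <= a -> a <= b -> a ^+ 2 <= b ^+ 2.
Proof. by move=> a0 ab; apply: lerXn2r; rewrite ?nnegrE// (le_trans a0). Qed.
Lemma expr1D_le (x : R) j : 0 <= x -> j%:R * x <= 1 / 2 -> (1 + x) ^+ j <= 1 + 2 * (j%:R * x).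
Proof.
move=> x0; elim: j => [|j IH] h; first by rewrite mul0r mulr0 addr0.
have j0 : 0 <= j%:R * x by rewrite mulr_ge0.
rewrite -[j.+1]addn1 natrD (mulrDl _ _ x) (mul1r x) in h *.
have h1 : j%:R * x <= 1 / 2 by apply: le_trans h; rewrite lerDl.
have h2 := IH h1; rewrite addn1 exprS mulrC.
apply: (@le_trans _ _ ((1 + 2 * (j%:R * x)) * (1 + x))); first by apply: ler_wpM2r => //; rewrite addr_ge0.
move: (j%:R * x) j0 h h1 => y y0 h h1; nra.
Qed.

(** The distance of a complex number to 1 is dominated by that of a real number above 1, a relation
    stable under products and hence under powers. *)
Lemma near1M (u v : R[i]) (a b : R) : cabs (u - 1) <= a - 1 -> cabs (v - 1) <= b - 1 -> cabs (u * v - 1) <= a * b - 1.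
Proof.
move=> hu hv; have -> : u * v - 1 = (u - 1) * (v - 1) + ((u - 1) + (v - 1)) by ring.
apply: (le_trans (cabsD _ _)); rewrite cabsM.
have := cabsD (u - 1) (v - 1); have := cabs_ge0 (u - 1); have := cabs_ge0 (v - 1); nra.
Qed.
Lemma near1X (u : R[i]) (a : R) j : cabs (u - 1) <= a - 1 -> cabs (u ^+ j - 1) <= a ^+ j - 1.
Proof.
move=> h; elim: j => [|j IH]; first by rewrite !expr0 !subrr cabsR normr0.
by rewrite !exprS; exact: near1M.
Qed.

Lemma enorm_plane x y (a b : R) : sph x -> a ^+ 2 + b ^+ 2 = 1 -> enorm (a *: x + b *: y) <= 1 + enorm y.
Proof.
move=> /sphE hx hab; have y0 := enorm_ge0 y.
rewrite -(ler_pXn2r (n:=2)) ?nnegrE ?enorm_ge0 ?addr_ge0//.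
pose c := \sum_i x ord0 i * y ord0 i.
have E (s t : R) : \sum_i (s * x ord0 i + t * y ord0 i) ^+ 2 = s ^+ 2 + 2 * s * t * c + t ^+ 2 * enorm y ^+ 2.
  transitivity (s ^+ 2 * (\sum_i x ord0 i ^+ 2) + 2 * s * t * c + t ^+ 2 * enorm y ^+ 2); last by rewrite hx mulr1.
  rewrite enorm_sq /c !mulr_sumr -!big_split.
  by apply: eq_bigr => i _; rewrite /=; ring.
(* Cauchy-Schwarz, from the nonnegativity of the squared norm of [y - c x]. *)
have c2 : c ^+ 2 <= enorm y ^+ 2.
  have : 0 <= \sum_i ((- c) * x ord0 i + 1 * y ord0 i) ^+ 2 by apply: sumr_ge0 => i _; exact: sqr_ge0.
  rewrite E; nra.
have c1 : `|c| <= enorm y by rewrite -(ler_pXn2r (n:=2)) ?nnegrE// real_normK// num_real.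
rewrite enorm_sq (eq_bigr (fun i => (a * x ord0 i + b * y ord0 i) ^+ 2)); last by move=> i _; rewrite !mxE.
rewrite E; have := ler_norm c; have := ler_norm (- c); rewrite normrN.
have := sqr_ge0 (a - b); have := sqr_ge0 (a + b); have := sqr_ge0 a; have := sqr_ge0 b.
move: (enorm y) y0 c1 => Y Y0 c1 b0 a0 h1 h2 h3 h4.
have h5 : 2 * a * b * c <= Y.
  have [cp|cn] := leP 0 c; nra.
nra.
Qed.

(* [P] is restricted to the complexified plane spanned by [th] and a large multiple
   [y] of [w - th], so that [th] and [w] correspond to nearby parameters [(s, t)]. *)
Lemma poly_cap d P th (M : R) : hom d P -> sph th -> (forall w, sph w -> cabs (mpoly_at P w) <= M) -> cabs (mpoly_at P th) = M ->
  forall w, sph w -> (forall i, `|w ord0 i - th ord0 i| <= (16 * N%:R * d.+1%:R ^+ 3)^-1) -> M / 2 <= cabs (mpoly_at P w).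
Proof.
move=> hP Hth HM EM w Hw hw.
have M0 : 0 <= M by rewrite -EM cabs_ge0.
set J : R := d.+1%:R in hw *; have J1 : 1 <= J by rewrite ler1n.
have J0 : 0 < J by exact: lt_le_trans J1.
have dJ : d%:R <= J by rewrite ler_nat.
have N0 : 0 < N%:R :> R by rewrite ltr0n.
(* With [y = (w - th) / ep], the point [th] has parameters [(1, 1)] and [w] has
   [(1 + i ep, 1 - i ep)]. The cube in the hypothesis gives [enorm y <= (2 * J)^-1], so the [d]-th
   power of the radius stays below 2; and [ep] is small enough for the [d.+1] terms, each off by at
   most [4 M d ep], to add up to at most [M / 2]. *)
pose ep : R := (8 * J ^+ 2)^-1; have ep0 : 0 < ep by rewrite invr_gt0 mulr_gt0// exprn_gt0.
pose y := (8 * J ^+ 2) *: (w - th).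
have yY : enorm y <= (2 * J)^-1.
  have Y0 : 0 <= (2 * J)^-1 by rewrite invr_ge0 mulr_ge0// ltW.
  rewrite -(ler_pXn2r (n:=2)) ?nnegrE ?enorm_ge0// enorm_sq.
  apply: (@le_trans _ _ (\sum_(i < N) ((2 * J)^-1 / N%:R) ^+ 2)).
    apply: ler_sum => i _; rewrite /y !mxE -real_normK ?num_real//; apply: lerXn2r; rewrite ?nnegrE ?normr_ge0 ?divr_ge0//.
    rewrite normrM gtr0_norm; last by rewrite mulr_gt0// exprn_gt0.
    apply: (@le_trans _ _ (8 * J ^+ 2 * (16 * N%:R * J ^+ 3)^-1)); first by apply: ler_wpM2l => //; rewrite mulr_ge0// exprn_ge0// ltW.
    rewrite le_eqVlt; apply/orP; left; apply/eqP.
    by move: (N%:R : R) N0 => NN N0; field; rewrite !gt_eqF.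
  rewrite sumr_const card_ord -[X in X <= _]mulr_natr expr_div_n -mulrA; apply: ler_piMr; first exact: exprn_ge0.
  rewrite expr2 invfM -mulrA mulVf ?gt_eqF// mulr1 invf_le1// ler1n//.
have HB (v : 'rV[R]_2) : sph v -> enorm (v ord0 ord0 *: th + v ord0 (lift ord0 ord0) *: y) <= 1 + (2 * J)^-1.
  move=> /sphE; rewrite big_ord_recl big_ord1 => Hv; apply: (le_trans (enorm_plane y Hth Hv)).
  by rewrite lerD2l.
have [q [qb Hq]] := hom_plane hP HM HB.
have B2 : (1 + (2 * J)^-1) ^+ d <= 2.
  have h : d%:R * (2 * J)^-1 <= 1 / 2.
    by rewrite invfM mulrCA mulrC mul1r ler_piMl ?invr_ge0// ler_pdivrMr// mul1r.
  have := @expr1D_le (2 * J)^-1 d; rewrite invr_ge0 mulr_ge0 ?(ltW J0)// => /(_ isT h) /le_trans; apply.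
  by rewrite -[X in _ <= X]/(1 + 1) lerD2l mulrC -ler_pdivlMr.
have ew : mpoly_at P w = \sum_(m < d.+1) q m * (1 +i* ep) ^+ (d - m) * (1 -i* ep) ^+ m.
  rewrite -Hq; apply: meval_eq => i; apply: ceqP; rewrite /cdir /y !mxE /ep /=; field; by rewrite gt_eqF.
have et : mpoly_at P th = \sum_(m < d.+1) q m.
  transitivity (\sum_(m < d.+1) q m * 1 ^+ (d - m) * 1 ^+ m); last by apply: eq_bigr => m _; rewrite !expr1n !mulr1.
  rewrite -Hq; apply: meval_eq => i; apply: ceqP; rewrite /cdir !mxE /=; field; by [].
have de : d%:R * ep <= 1 / 2.
  rewrite /ep ler_pdivrMr ?mulr_gt0 ?exprn_gt0//; move: (d%:R : R) (ler0n R d) dJ => D D0 dJ; nra.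
have ee : (1 + ep) ^+ d - 1 <= 2 * (d%:R * ep).
  by rewrite lerBlDl; apply: expr1D_le de; exact: ltW.
have nearb (m : 'I_d.+1) : cabs ((1 +i* ep) ^+ (d - m) * (1 -i* ep) ^+ m - 1) <= 2 * (d%:R * ep).
  apply: le_trans ee; have -> : (1 + ep) ^+ d = (1 + ep) ^+ (d - m) * (1 + ep) ^+ m by rewrite -exprD subnK// -ltnS.
  have u1 : (1 +i* ep) - 1 = 0 +i* ep by apply: ceqP; rewrite /=; ring.
  have u2 : (1 -i* ep) - 1 = 0 -i* ep by apply: ceqP; rewrite /=; ring.
  have ce (s : R) : `|s| = ep -> cabs (0 +i* s) = ep.
    by move=> se; rewrite /Normc.normc expr0n add0r sqrtr_sqr.
  apply: near1M; apply: near1X; rewrite addrAC subrr add0r.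
    by rewrite u1 ce// gtr0_norm.
  by rewrite u2 ce// normrN gtr0_norm.
have diff : cabs (mpoly_at P w - mpoly_at P th) <= M / 2.
  rewrite ew et -sumrB; apply: (le_trans (cabs_sum _ _ _)).
  apply: (@le_trans _ _ (\sum_(m < d.+1) (M * 2) * (2 * (d%:R * ep)))).
    apply: ler_sum => m _; have -> : q m * (1 +i* ep) ^+ (d - m) * (1 -i* ep) ^+ m - q m =
      q m * ((1 +i* ep) ^+ (d - m) * (1 -i* ep) ^+ m - 1) by ring.
    rewrite cabsM; apply: ler_pM; rewrite ?cabs_ge0//.
    by apply: (le_trans (qb m (ltn_ord m))); exact: ler_wpM2l.
  rewrite sumr_const card_ord -[X in X <= _]mulr_natr -/J /ep.
  have -> : M * 2 * (2 * (d%:R * (8 * J ^+ 2)^-1)) * J = (M / 2) * (d%:R / J).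
    by move: (d%:R : R) => D; field; rewrite gt_eqF.
  by apply: ler_piMr; [exact: divr_ge0|rewrite ler_pdivrMr// mul1r].
have h := cabs_distD (mpoly_at P th) (mpoly_at P th - mpoly_at P w).
have e1 : mpoly_at P th - (mpoly_at P th - mpoly_at P w) = mpoly_at P w by rewrite subKr.
rewrite e1 EM cabsB in h; apply: le_trans h.
by move: (cabs _) diff => D hD; lra.
Qed.

(** Around a maximum of the modulus, [poly_cap] keeps half of it on a cap whose radius is of order
    [d.+1%:R ^- 3], and [sphere_int_cap] bounds the integral over that cap from below; the loss is
    polynomial in the degree. *)
Lemma nikolskii : exists (A : R) (E : nat), 0 < A /\ forall d P, hom d P -> forall w, sph w ->
  cabs (mpoly_at P w) ^+ 2 <= A * d.+1%:R ^+ E * sphere_int (fun w => cabs (mpoly_at P w) ^+ 2).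
Proof.
have [K0 [e [K00 cap]]] := @sphere_int_cap R n.+1.
have N0 : 0 < 16 * N%:R :> R by rewrite mulr_gt0// ltr0n.
exists (4 / K0 * (16 * N%:R) ^+ e), (3 * e)%N; split; first by rewrite mulr_gt0 ?divr_gt0// exprn_gt0.
move=> d P hP w Hw.
have Ps : scont (fun w : 'rV[R]_N => cabs (mpoly_at P w)).
  by move=> v Hv; apply: ccts_cabs; exact: mpoly_at_sccts.
have [th Hth Hmax] := sph_max Ps; pose M := cabs (mpoly_at P th).
have M0 : 0 <= M by exact: cabs_ge0.
have J0 : 0 < d.+1%:R :> R by rewrite ltr0n.
pose dl : R := (16 * N%:R * d.+1%:R ^+ 3)^-1.
have dl0 : 0 < dl by rewrite invr_gt0 mulr_gt0// exprn_gt0.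
have dl1 : dl <= 1.
  rewrite invf_le1 ?mulr_gt0 ?exprn_gt0//; apply: (@le_trans _ _ (1 * 1)); first by rewrite mulr1.
  apply: ler_pM => //; last by apply: exprn_ege1; rewrite ler1n.
  by rewrite -natrM ler1n.
have s2 : scont (fun w : 'rV[R]_N => cabs (mpoly_at P w) ^+ 2) by move=> v Hv; apply: contX; exact: Ps.
have C0 : 0 <= (M / 2) ^+ 2 by exact: sqr_ge0.
have := cap th dl (fun w => cabs (mpoly_at P w) ^+ 2) ((M / 2) ^+ 2) Hth dl0 dl1 s2 (fun w _ => sqr_ge0 _) C0.
have H1 : forall w, sph w -> (forall i, `|w ord0 i - th ord0 i| <= dl) -> (M / 2) ^+ 2 <= cabs (mpoly_at P w) ^+ 2.
  move=> v Hv hv; apply: sqr_le; first exact: divr_ge0.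
  by have := @poly_cap d P th M hP Hth Hmax erefl v Hv; apply.
move=> /(_ H1); set I := sphere_int _ => H2.
have mw : cabs (mpoly_at P w) ^+ 2 <= M ^+ 2 by apply: sqr_le; [exact: cabs_ge0|exact: Hmax].
apply: (le_trans mw); have d0 : 0 < dl ^+ e by exact: exprn_gt0.
have E1 : dl ^+ e = ((16 * N%:R) ^+ e)^-1 * (d.+1%:R ^+ (3 * e))^-1.
  by rewrite /dl exprVn exprMn invfM exprM.
have p1 : 0 < (16 * N%:R) ^+ e :> R by exact: exprn_gt0.
have p2 : 0 < d.+1%:R ^+ (3 * e) :> R by exact: exprn_gt0.
rewrite E1 in H2; move: ((16 * N%:R) ^+ e : R) p1 (d.+1%:R ^+ (3 * e) : R) p2 H2 => a a0 b b0 H2.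
have -> : M ^+ 2 = (4 / K0 * a * b) * ((M / 2) ^+ 2 * K0 * (a^-1 * b^-1)).
  by field; rewrite !gt_eqF.
by apply: ler_wpM2l => //; rewrite !mulr_ge0// ?invr_ge0 ltW.
Qed.

Lemma sphere_int_sq P : (sphere_int (fun w => cabs (mpoly_at P w) ^+ 2))%:C = sphere_dot P P.
Proof. by rewrite -sphere_intC_real; apply: eq_sphere_intC => w _; rewrite mulcJE rmorphXn. Qed.

(** The sum of the squared moduli, the diagonal of the reproducing kernel, is bounded through
    [nikolskii]. Its integral is the dimension [a], which is thereby bounded too, and
    [x <= 1 + x ^+ 2] passes to the sum of the moduli. *)
Lemma orthonormal_bound : exists (A : R) (E : nat), 0 < A /\ forall k a (Y : 'I_a -> mpoly N R[i]),
  (forall l, hom k (Y l)) -> (forall l l', sphere_dot (Y l) (Y l') = (l == l')%:R) ->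
  forall w, sph w -> \sum_l cabs (mpoly_at (Y l) w) <= A * k.+1%:R ^+ E.
Proof.
have [A [E [A0 HA]]] := nikolskii.
have S0 := sarea_gt0 R n.+1.
exists (A * sarea R N + A), E; split; first by rewrite addr_gt0// mulr_gt0.
move=> k a Y hY oY.
have Ys l : sccts (mpoly_at (Y l)) by exact: mpoly_at_sccts.
(* [nikolskii] is applied to [\sum_l (Y l w)^* Y l], whose value at [w] is also
   its squared norm. *)
have L2 w : sph w -> \sum_l cabs (mpoly_at (Y l) w) ^+ 2 <= A * k.+1%:R ^+ E.
  move=> Hw; pose c l := Num.conj (mpoly_at (Y l) w); pose P := \sum_l c l *: Y l.
  pose S := \sum_l cabs (mpoly_at (Y l) w) ^+ 2; rewrite -/S.
  have S1 : 0 <= S by apply: sumr_ge0 => l _; exact: sqr_ge0.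
  have hP : hom k P by apply: hom_sum => l; exact: homZ.
  have EP : mpoly_at P w = S%:C.
    rewrite mpoly_at_sum rmorph_sum; apply: eq_bigr => l _.
    have e (z : R[i]) : Num.conj z * z = (cabs z ^+ 2)%:C by rewrite mulrC mulcJE rmorphXn.
    by rewrite mpoly_atZ; exact: e.
  have EI : sphere_int (fun v => cabs (mpoly_at P v) ^+ 2) = S.
    have : (sphere_int (fun v => cabs (mpoly_at P v) ^+ 2))%:C = S%:C.
      rewrite sphere_int_sq /sphere_dot.
      rewrite (eq_sphere_intC (h2 := fun v => \sum_l \sum_l' (c l * Num.conj (c l')) * (mpoly_at (Y l) v * Num.conj (mpoly_at (Y l') v)))); last first.
        move=> v _; rewrite mpoly_at_sum rmorph_sum mulr_suml; apply: eq_bigr => l _.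
        rewrite mulr_sumr; apply: eq_bigr => l' _; rewrite !mpoly_atZ.
        rewrite rmorphM; exact: mulrACA.
      have s1 l l' : sccts (fun v => mpoly_at (Y l) v * Num.conj (mpoly_at (Y l') v)) by apply: scctsM => //; exact: scctsJ.
      rewrite sphere_intC_sum; last by move=> l; apply: sccts_sum => l'; exact: scctsZ.
      rewrite rmorph_sum; apply: eq_bigr => l _.
      rewrite sphere_intC_sum; last by move=> l'; exact: scctsZ.
      rewrite (bigD1 l)//= big1 ?addr0.
        rewrite sphere_intCZ// -[sphere_intC _]/(sphere_dot (Y l) (Y l)) oY eqxx mulr1.
        have e : cabs (c l) = cabs (mpoly_at (Y l) w) by exact: cabsJ.
        by rewrite mulcJE e rmorphXn.
      move=> l' ll'; rewrite sphere_intCZ// -[sphere_intC _]/(sphere_dot (Y l) (Y l')) oY eq_sym (negbTE ll') mulr0//.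
    by move=> /complexI.
  have := HA k P hP w Hw; rewrite EI EP cabsR ger0_norm//.
  have [->|Sn] := eqVneq S 0; first by move=> _; rewrite mulr_ge0 ?exprn_ge0// ltW.
  by rewrite expr2 ler_pM2r// lt_neqAle eq_sym Sn.
have s2 l : scont (fun w : 'rV[R]_N => cabs (mpoly_at (Y l) w) ^+ 2).
  by move=> v Hv; apply: contX; apply: ccts_cabs; exact: Ys.
have La : a%:R <= A * k.+1%:R ^+ E * sarea R N.
  rewrite -sphere_int_cst.
  have -> : a%:R = sphere_int (fun w : 'rV[R]_N => \sum_l cabs (mpoly_at (Y l) w) ^+ 2).
    apply: complexI; rewrite -sphere_intC_real rmorph_nat.
    rewrite (eq_sphere_intC (h2 := fun w => \sum_l (cabs (mpoly_at (Y l) w) ^+ 2)%:C)); last by move=> w _; rewrite rmorph_sum.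
    rewrite sphere_intC_sum; last by move=> l w Hw; apply: ccts_real; exact: s2.
    rewrite (eq_bigr (fun=> 1)); first by rewrite sumr_const card_ord.
    by move=> l _; rewrite sphere_intC_real sphere_int_sq oY eqxx.
  apply: sphere_int_le; last by move=> w Hw; exact: L2.
    by move=> w Hw; apply: cont_sum => l; exact: s2.
  exact: scont_cst.
move=> w Hw; have := L2 w Hw.
have : \sum_l cabs (mpoly_at (Y l) w) <= \sum_(l < a) (1 + cabs (mpoly_at (Y l) w) ^+ 2).
  apply: ler_sum => l _; move: (cabs _) (cabs_ge0 (mpoly_at (Y l) w)) => x x0; have := sqr_ge0 (x - 1); nra.
rewrite big_split /= sumr_const card_ord => h1 h2; apply: (le_trans h1).
rewrite mulrDl; apply: lerD => //.
by rewrite mulrAC.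
Qed.
End Nikolskii.


(** * Series of homogeneous polynomials *)

Section SecondOrder.
Variables (R : realType) (psi : R[i] -> R[i]) (dl M : R) (d : R[i]).
Hypotheses (dl0 : 0 < dl) (psid : forall z, cabs z < dl -> exists d, cdiff psi z d).
Hypothesis psib : forall z, cabs z < dl -> cabs (psi z) <= M.
Hypothesis psi0 : cdiff psi 0 d.
Let c := tcoef psi (dl / 2).
Let r := dl / 2.

Let r0 : 0 < r. Proof. by rewrite divr_gt0. Qed.
Let r1 : r < dl. Proof. by rewrite ltr_pdivrMr// ltr_pMr// ltr1n. Qed.

Lemma second_order_coef j : cabs (c j) <= M * r^-1 ^+ j.
Proof.
have h := @tcoef_bound R psi dl psid r M j r0 r1 (fun z zr => psib (eq_ind_r (fun t => t < dl) r1 zr)).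
by rewrite exprVn ler_pdivlMr ?exprn_gt0.
Qed.

(** The Taylor tail from degree 2 on; as [cabs z] is at most half of the radius [r], the geometric
    factor is at most 2. *)
Lemma second_order_c1 z : cabs z <= dl / 4 -> cabs (psi z - psi 0 - c 1 * z) <= 8 * M / dl ^+ 2 * cabs z ^+ 2.
Proof.
move=> zd; have zdl : cabs z < dl by apply: (le_lt_trans zd); rewrite ltr_pdivrMr// ltr_pMr// ltr1n.
have M0 : 0 <= M by have := psib (z := 0); rewrite cabsR normr0 => /(_ dl0); apply: le_trans; exact: cabs_ge0.
pose x := cabs z / r.
have x0 : 0 <= x by rewrite divr_ge0 ?cabs_ge0// ltW.
have x12 : x <= 1 / 2 by rewrite /x ler_pdivrMr// /r; move: zd; lra.
have x1 : x < 1 by move: x12; lra.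
have hc j : cabs (c j * z ^+ j) <= M * x ^+ j := geo_term r0 (second_order_coef j) (lexx _).
have := gsumP 2 x0 x1 hc; rewrite -(taylor dl0 psid zdl) big_ord_recl big_ord1 /= mulr1 /c (tcoef0 dl0 psid) opprD addrA.
move=> /le_trans; apply; rewrite ler_pdivrMr ?subr_gt0//.
have -> : 8 * M / dl ^+ 2 * cabs z ^+ 2 = 2 * (M * x ^+ 2).
  by rewrite /x /r; field; rewrite gt_eqF.
have : 0 <= M * x ^+ 2 by rewrite mulr_ge0 ?exprn_ge0.
by move: (M * x ^+ 2) => m m0; move: x12; nra.
Qed.

(** Both numbers give a first-order approximation of [psi] at 0; comparing them at a small real [t]
    shows that they differ by at most any [e]. *)
Lemma second_order_d : c 1 = d.
Proof.
apply/eqP; rewrite -subr_eq0 -cabs_eq0 eq_le cabs_ge0 andbT; apply/ler_addgt0Pr => e e0; rewrite add0r.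
have e2 : 0 < e / 2 by rewrite divr_gt0.
have [rho rho0 H] := psi0 e2.
have M0 : 0 <= M by have := psib (z := 0); rewrite cabsR normr0 => /(_ dl0); apply: le_trans; exact: cabs_ge0.
pose C := 8 * M / dl ^+ 2; have C0 : 0 <= C by rewrite divr_ge0 ?mulr_ge0 ?exprn_ge0// ltW.
pose t := Num.min (Num.min rho (dl / 4)) (e / 2 / (C + 1)).
have C1 : 0 < C + 1 by rewrite ltr_wpDl.
have t0 : 0 < t by rewrite !lt_min rho0 !divr_gt0.
have ct : cabs t%:C = t by rewrite cabsR gtr0_norm.
have t1 : t <= rho by rewrite /t !ge_min lexx.
have t2 : t <= dl / 4 by rewrite /t !ge_min lexx orbT.
have t3 : C * t <= e / 2.
  apply: (@le_trans _ _ (C * (e / 2 / (C + 1)))); first by rewrite ler_wpM2l// /t ge_min lexx orbT.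
  by rewrite mulrCA ler_piMr// ?(ltW e2)// ler_pdivrMr// mul1r lerDl.
have h1 := H t%:C; rewrite add0r ct in h1; have {}h1 := h1 t1.
have h2 := @second_order_c1 t%:C; rewrite ct in h2; have {}h2 := h2 t2.
have E : (c 1 - d) * t%:C = (psi t%:C - psi 0 - d * t%:C) - (psi t%:C - psi 0 - c 1 * t%:C) by ring.
have : cabs ((c 1 - d) * t%:C) <= e * t.
  rewrite E; apply: (le_trans (cabsD _ _)); rewrite cabsN.
  have -> : e * t = e / 2 * t + e / 2 * t by field.
  apply: lerD => //; apply: (le_trans h2); rewrite -/C expr2 mulrA; apply: ler_wpM2r => //; exact: ltW.
by rewrite cabsM ct ler_pM2r.
Qed.

Lemma second_order z : cabs z <= dl / 4 -> cabs (psi z - psi 0 - d * z) <= 8 * M / dl ^+ 2 * cabs z ^+ 2.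
Proof. by rewrite -second_order_d; exact: second_order_c1. Qed.
Lemma first_order : cabs d <= 2 * M / dl.
Proof.
rewrite -second_order_d; apply: (le_trans (second_order_coef 1)); rewrite expr1 /r invf_div.
by rewrite mulrA (mulrC M).
Qed.
End SecondOrder.

Section SumMvdiff.
Variables (R : realType) (n : nat).
Implicit Types (z h : 'rV[R[i]]_n).

Lemma gsum_sum (I : eqType) (s : seq I) (u : I -> nat -> R[i]) (M : I -> R) (x : R) : 0 <= x -> x < 1 ->
  (forall i j, cabs (u i j) <= M i * x ^+ j) ->
  gsum (fun j => \sum_(i <- s) u i j) = \sum_(i <- s) gsum (u i) /\
  exists M', forall j, cabs (\sum_(i <- s) u i j) <= M' * x ^+ j.
Proof.
move=> x0 x1 hu; elim: s => [|i s [IH [M' HM']]].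
  split; last by exists 0 => j; rewrite big_nil mul0r cabsR normr0.
  rewrite big_nil (@gsum_fin _ _ 0) ?big_ord0// => j _; by rewrite big_nil.
split; last first.
  exists (M i + M') => j; rewrite big_cons mulrDl; apply: (le_trans (cabsD _ _)); exact: lerD.
rewrite big_cons -IH -(gsumD x0 x1 (hu i) HM'); apply: gsum_eq => j; exact: big_cons.
Qed.

(* Second-order Cauchy estimates on the complex lines through [z]. *)
Lemma sum_mvdiff (G : nat -> 'rV[R[i]]_n -> R[i]) z (dl M x : R) : 0 < dl -> 0 <= x -> x < 1 ->
  (forall j h, (forall i, cabs (h ord0 i) < dl) -> mvdiff (G j) (z + h)) ->
  (forall j h, (forall i, cabs (h ord0 i) < dl) -> cabs (G j (z + h)) <= M * x ^+ j) ->
  mvdiff (fun z => gsum (fun j => G j z)) z.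
Proof.
move=> dl0 x0 x1 Gd Gb.
have zero i : cabs ((0 : 'rV[R[i]]_n) ord0 i) < dl by rewrite mxE cabsR normr0.
have /choice[A hA] : forall j, exists A, mvgrad (G j) z A.
  by move=> j; have := Gd j 0 zero; rewrite addr0.
have line j (v : 'rV[R[i]]_n) : (forall i, cabs (v ord0 i) <= 1) ->
    let psi := fun t : R[i] => G j (z + t *: v) in
    [/\ forall t, cabs t < dl -> exists d, cdiff psi t d, forall t, cabs t < dl -> cabs (psi t) <= M * x ^+ j
      & cdiff psi 0 (\sum_i v ord0 i * A j i)].
  move=> hv psi; have hb t i : cabs t < dl -> cabs ((t *: v) ord0 i) < dl.
    by move=> td; rewrite mxE cabsM; apply: le_lt_trans td; rewrite ler_piMr// cabs_ge0.
  split.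
  - move=> t td; have [B HB] := Gd j (t *: v) (fun i => hb t i td).
    by exists (\sum_i v ord0 i * B i); exact: mvgrad_line.
  - by move=> t td; apply: Gb => i; exact: hb.
  - by apply: mvgrad_line; rewrite scale0r addr0.
have M0 : 0 <= M.
  have := Gb 0%N 0 zero; rewrite expr0 mulr1; apply: le_trans; exact: cabs_ge0.
have Ab i j : cabs (A j i) <= (2 * M / dl) * x ^+ j.
  pose v : 'rV[R[i]]_n := delta_mx ord0 i.
  have hv k : cabs (v ord0 k) <= 1 by rewrite mxE eqxx /=; case: (k == i); rewrite cabsR ?normr1 ?normr0.
  have [l1 l2 l3] := line j v hv; have := first_order dl0 l1 l2 l3.
  rewrite (bigD1 i)//= big1 ?addr0; last by move=> k ki; rewrite /v mxE eqxx /= (negbTE ki) mul0r.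
  by rewrite /v mxE !eqxx mul1r mulrA mulrAC.
exists (fun i => gsum (fun j => A j i)) => e e0.
pose C := 8 * M / dl ^+ 2 / (1 - x); have x2 : 0 < 1 - x by rewrite subr_gt0.
have C0 : 0 <= C by rewrite !mulr_ge0 ?invr_ge0 ?exprn_ge0// ltW.
have n0 : 0 < n.+1%:R :> R by rewrite ltr0n.
(* Division by [n.+1] makes the sum [s] of the moduli, and not only each coordinate, obey the two
   bounds. *)
pose rr := Num.min (dl / 4) (e / (C + 1)) / n.+1%:R.
have rr0 : 0 < rr by rewrite divr_gt0// lt_min !divr_gt0// ltr_wpDl.
exists rr => // h hh; pose s := \sum_i cabs (h ord0 i); rewrite -/s.
have s0 : 0 <= s by apply: sumr_ge0 => i _; exact: cabs_ge0.
have hs i : cabs (h ord0 i) <= s by rewrite /s (bigD1 i)//= lerDl; apply: sumr_ge0 => k _; exact: cabs_ge0.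
have srr : s <= Num.min (dl / 4) (e / (C + 1)).
  apply: (@le_trans _ _ (\sum_(i < n) rr)); first by apply: ler_sum => i _.
  rewrite sumr_const card_ord -[X in X <= _]mulr_natr /rr mulrAC ler_pdivrMr// ler_wpM2l ?ler_nat//.
  by rewrite le_min !divr_ge0// ?addr_ge0// ltW.
have s1 : s <= dl / 4 by move: srr; rewrite le_min => /andP[].
have s2 : s <= e / (C + 1) by move: srr; rewrite le_min => /andP[].
have sdl : s < dl by apply: (le_lt_trans s1); rewrite ltr_pdivrMr// ltr_pMr// ltr1n.
have key j : cabs (G j (z + h) - G j z - \sum_i h ord0 i * A j i) <= (8 * M / dl ^+ 2 * s ^+ 2) * x ^+ j.
  have [se|sn] := eqVneq s 0.
    have hz : h = 0.
      apply/rowP => i; rewrite mxE; apply/eqP; rewrite -cabs_eq0 eq_le cabs_ge0 andbT.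
      by have := hs i; rewrite se.
    rewrite hz addr0 subrr big1 ?subr0; last by move=> i _; rewrite mxE mul0r.
    by rewrite cabsR normr0 mulr_ge0 ?exprn_ge0// mulr_ge0 ?exprn_ge0// divr_ge0 ?mulr_ge0 ?exprn_ge0// ltW.
  have sp : 0 < s by rewrite lt_neqAle eq_sym sn.
  (* The increment is [s] times a direction with coordinates of modulus at most 1, so one estimate,
     uniform in the direction, covers all [h]. *)
  pose v := (s%:C)^-1 *: h.
  have sC : s%:C != 0 :> R[i] by rewrite -cabs_gt0 cabsR gtr0_norm.
  have hv : h = s%:C *: v by rewrite /v scalerA divff// scale1r.
  have v1 k : cabs (v ord0 k) <= 1.
    by rewrite mxE cabsM cabsV cabsR gtr0_norm// mulrC ler_pdivrMr// mul1r.
  have [l1 l2 l3] := line j v v1.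
  have cs : cabs s%:C = s by rewrite cabsR gtr0_norm.
  have := @second_order _ _ _ _ _ dl0 l1 l2 l3 s%:C; rewrite cs => /(_ s1).
  rewrite scale0r addr0 -hv.
  have -> : (\sum_i v ord0 i * A j i) * s%:C = \sum_i h ord0 i * A j i.
    rewrite mulr_suml; apply: eq_bigr => i _; have -> : h ord0 i = s%:C * v ord0 i by rewrite {1}hv mxE.
    ring.
  by move=> /le_trans; apply; rewrite le_eqVlt; apply/orP; left; apply/eqP; ring.
have g1 j : cabs (G j (z + h)) <= M * x ^+ j by apply: Gb => i; apply: le_lt_trans sdl.
have g2 j : cabs (G j z) <= M * x ^+ j by have := Gb j 0 zero; rewrite addr0.
have g3 i j : cabs (h ord0 i * A j i) <= (cabs (h ord0 i) * (2 * M / dl)) * x ^+ j.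
  by rewrite cabsM -mulrA ler_wpM2l ?cabs_ge0.
have [E [M' HM']] := gsum_sum (index_enum 'I_n) x0 x1 g3.
have E3 : \sum_i h ord0 i * gsum (fun j => A j i) = gsum (fun j => \sum_i h ord0 i * A j i).
  by rewrite E; apply: eq_bigr => i _; rewrite (gsumZ _ x0 x1 (Ab i)).
have g4 j : cabs (G j (z + h) - G j z) <= (M + M) * x ^+ j.
  by apply: (le_trans (cabsD _ _)); rewrite cabsN mulrDl lerD.
rewrite E3 -(gsumB x0 x1 g1 g2) -(gsumB x0 x1 g4 HM').
apply: (le_trans (gsum_le x0 x1 key)).
have -> : 8 * M / dl ^+ 2 * s ^+ 2 / (1 - x) = (C * s) * s by rewrite /C; ring.
apply: ler_wpM2r => //; apply: (@le_trans _ _ (C * (e / (C + 1)))); first exact: ler_wpM2l.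
have C1 : 0 < C + 1 by rewrite ltr_wpDl.
rewrite mulrCA; apply: ler_piMr; first exact: ltW.
by rewrite ler_pdivrMr// mul1r lerDl.
Qed.
End SumMvdiff.

Section MevalDiff.
Variables (K : numFieldType) (n : nat).
Lemma differentiable_prod (I : Type) (s : seq I) (F : I -> 'rV[K]_n -> K) z :
  (forall i, differentiable (F i : 'rV[K]_n -> K^o) z) ->
  differentiable ((fun v => \prod_(i <- s) F i v) : 'rV[K]_n -> K^o) z.
Proof.
move=> H; elim: s => [|i s IH].
  rewrite (_ : (fun v => _) = cst (1 : K^o)); first exact: differentiable_cst.
  by apply/funext => v; rewrite big_nil.
rewrite (_ : (fun v => _) = (F i : 'rV[K]_n -> K^o) * (fun v => \prod_(i <- s) F i v)); first exact: differentiableM.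
by apply/funext => v; rewrite big_cons.
Qed.
Lemma differentiable_bigsum (I : Type) (s : seq I) (F : I -> 'rV[K]_n -> K) z :
  (forall i, differentiable (F i : 'rV[K]_n -> K^o) z) ->
  differentiable ((fun v => \sum_(i <- s) F i v) : 'rV[K]_n -> K^o) z.
Proof.
move=> H; elim: s => [|i s IH].
  rewrite (_ : (fun v => _) = cst (0 : K^o)); first exact: differentiable_cst.
  by apply/funext => v; rewrite big_nil.
rewrite (_ : (fun v => _) = (F i : 'rV[K]_n -> K^o) + (fun v => \sum_(i <- s) F i v)); first exact: differentiableD.
by apply/funext => v; rewrite big_cons.
Qed.
Lemma differentiable_meval (P : mpoly n K) z :
  differentiable ((fun v => meval (fun i => v ord0 i) P) : 'rV[K]_n -> K^o) z.
Proof.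
have -> : (fun v : 'rV[K]_n => meval (fun i => v ord0 i) P) = (fun v : 'rV[K]_n => \sum_(m <- msupp P) mcoeff m P * \prod_i v ord0 i ^+ m i).
  by apply/funext => v; rewrite mevalE.
apply: (@differentiable_bigsum _ _ (fun m (v : 'rV[K]_n) => mcoeff m P * \prod_i v ord0 i ^+ m i)) => m.
apply: (@differentiableM K 'rV[K]_n (cst (mcoeff m P)) (fun v : 'rV[K]_n => \prod_i v ord0 i ^+ m i)); first exact: differentiable_cst.
apply: (@differentiable_prod _ _ (fun i (v : 'rV[K]_n) => v ord0 i ^+ m i)) => i.
elim: (m i) => [|k IH]; first exact: (differentiable_cst (1 : K^o)).
have -> : (fun v : 'rV[K]_n => v ord0 i ^+ k.+1) = (fun v : 'rV[K]_n => v ord0 i : K^o) * (fun v : 'rV[K]_n => v ord0 i ^+ k : K^o).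
  by apply/funext => v; rewrite exprS.
by apply: differentiableM => //; exact: differentiable_coord.
Qed.
End MevalDiff.


(** * The extension built from the coefficients *)

Section PolyGeo.
Variable R : realType.
(** Each of the [j.+1] terms of the geometric sum up to [y ^+ j] is at least [y ^+ j]. *)
Lemma lin_geo (y : R) j : 0 <= y -> y < 1 -> j.+1%:R * y ^+ j <= (1 - y)^-1.
Proof.
move=> y0 y1; have p : 0 < 1 - y by rewrite subr_gt0.
rewrite -[X in _ <= X]mul1r ler_pdivlMr//.
suff H : j.+1%:R * y ^+ j * (1 - y) <= 1 - y ^+ j.+1.
  by apply: (le_trans H); rewrite gerBl exprn_ge0.
elim: j => [|j IH]; first by rewrite expr0 expr1 !mul1r.
have e0 : 0 <= y ^+ j.+1 by exact: exprn_ge0.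
have e1 : y ^+ j.+1 <= 1 by apply: exprn_ile1 => //; exact: ltW.
have E : j.+2%:R * y ^+ j.+1 * (1 - y) = y * (j.+1%:R * y ^+ j * (1 - y)) + y ^+ j.+1 * (1 - y).
  rewrite -[j.+2]addn1 natrD [y ^+ j.+1]exprS; ring.
rewrite E (exprS y j.+1); move: (j.+1%:R * y ^+ j * (1 - y)) (y ^+ j.+1) IH e0 e1 => u v; nra.
Qed.
Lemma poly_geo D (x : R) : 0 <= x -> x < 1 -> exists M y : R, [/\ 0 <= M, 0 <= y, y < 1 & forall j, j.+1%:R ^+ D * x ^+ j <= M * y ^+ j].
Proof.
move=> x0 x1; elim: D => [|D [M [y [M0 y0 y1 H]]]]; first by exists 1, x; split => // j; rewrite expr0.
(* By the inequality of arithmetic and geometric means [y <= y' ^+ 2]; one [y'] absorbs the new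
   factor [j.+1], the other remains as the ratio. *)
pose y' := (1 + y) / 2.
have z0 : 0 <= y' by rewrite divr_ge0// addr_ge0.
have z1 : y' < 1 by rewrite ltr_pdivrMr// mul1r ltrD2l.
have yy : y <= y' * y' by rewrite /y'; nra.
exists (M * (1 - y')^-1), y'; split => //; first by rewrite mulr_ge0// invr_ge0 subr_ge0 ltW.
move=> j; rewrite exprS -mulrA; apply: (@le_trans _ _ (j.+1%:R * (M * y ^+ j))); first exact: ler_wpM2l.
have h : y ^+ j <= y' ^+ j * y' ^+ j.
  rewrite -exprMn; apply: lerXn2r; rewrite ?nnegrE; [exact: y0|exact: mulr_ge0|exact: yy].
apply: (@le_trans _ _ (j.+1%:R * (M * (y' ^+ j * y' ^+ j)))); first by apply: ler_wpM2l => //; exact: ler_wpM2l.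
have -> : j.+1%:R * (M * (y' ^+ j * y' ^+ j)) = M * (j.+1%:R * y' ^+ j) * y' ^+ j by move: (j.+1%:R : R) (y' ^+ j) => s t; ring.
by apply: ler_wpM2r; [exact: exprn_ge0|apply: ler_wpM2l => //; exact: lin_geo].
Qed.
End PolyGeo.

Section HolSum.
Variables (R : realType) (n : nat).
Let N := n.+2.
Implicit Types (z h : 'rV[R[i]]_N).

Lemma mvdiff_meval (P : mpoly N R[i]) z : mvdiff (fun v => meval (fun i => v ord0 i) P) z.
Proof.
apply: ((holomorphic_mvP setT (fun v : 'rV[R[i]]_N => meval (fun i => v ord0 i) P)).1 _ z I) => v _.
exact: differentiable_meval.
Qed.

Lemma lie_normE z : lie_norm z =
  Num.sqrt (\sum_i cabs (z ord0 i) ^+ 2 + Num.sqrt ((\sum_i cabs (z ord0 i) ^+ 2) ^+ 2 - cabs (\sum_i z ord0 i ^+ 2) ^+ 2)).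
Proof.
have h : hnorm z ^+ 2 = \sum_i cabs (z ord0 i) ^+ 2.
  by rewrite /hnorm sqr_sqrtr//; apply: sumr_ge0 => i _; exact: sqr_ge0.
have h4 : hnorm z ^+ 4 = (hnorm z ^+ 2) ^+ 2 by rewrite -exprM.
by rewrite /lie_norm h4 h.
Qed.

Lemma lie_ball_norm (r0 : R) z : 0 < r0 -> lie_ball N r0 z <-> lie_norm z < r0.
Proof.
move=> r00; rewrite /lie_ball /= /lie_norm.
set X := (X in X < r0 ^+ 2); have X0 : 0 <= X by rewrite addr_ge0 ?sqr_ge0 ?sqrtr_ge0.
by rewrite -[in X in X <-> _](sqr_sqrtr X0) ltr_pXn2r ?nnegrE ?sqrtr_ge0 ?(ltW r00).
Qed.

(** The Lie norm is a continuous function of the [N + N] real coordinates of the increment; the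
    radius is taken coordinatewise, in the form used by [sum_mvdiff]. *)
Lemma lie_norm_near z (sg : R) : lie_norm z < sg ->
  exists2 d : R, 0 < d & forall h, (forall i, cabs (h ord0 i) < d) -> lie_norm (z + h) < sg.
Proof.
move=> zs; pose phi (t : 'rV[R]_(N + N)) i := z ord0 i + (t ord0 (lshift N i) +i* t ord0 (rshift N i)).
pose L (t : 'rV[R]_(N + N)) := Num.sqrt (\sum_i cabs (phi t i) ^+ 2 + Num.sqrt ((\sum_i cabs (phi t i) ^+ 2) ^+ 2 - cabs (\sum_i phi t i ^+ 2) ^+ 2)).
have pc i : ccts (fun t => phi t i) 0.
  apply: cctsD; first exact: ccts_cst.
  by split; exact: cont_coord.
have Hc : {for 0, continuous (fun t : 'rV[R]_(N + N) => \sum_i cabs (phi t i) ^+ 2)}.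
  by apply: cont_sum => i; apply: contX; apply: ccts_cabs; exact: pc.
have Qc : {for 0, continuous (fun t : 'rV[R]_(N + N) => cabs (\sum_i phi t i ^+ 2))}.
  by apply: ccts_cabs; apply: ccts_sum => i; apply: cctsX; exact: pc.
have sc (u : 'rV[R]_(N + N) -> R) : {for 0, continuous u} -> {for 0, continuous (fun t => Num.sqrt (u t))}.
  move=> uc; apply: (@continuous_comp _ _ _ u (fun x => Num.sqrt x)) => //; exact: sqrt_continuous.
have Lc : {for 0, continuous L}.
  apply/sc/contD => //; apply/sc.
  rewrite (_ : (fun t => _) = (fun t : 'rV[R]_(N + N) => (\sum_i cabs (phi t i) ^+ 2) ^+ 2 + (-1) * cabs (\sum_i phi t i ^+ 2) ^+ 2)); last first.
    by apply/funext => t; rewrite mulN1r.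
  by apply: contD; [exact: contX|apply: contM; [exact: cont_cst|exact: contX]].
have L0 : L 0 = lie_norm z.
  have p0 i : phi 0 i = z ord0 i by rewrite /phi !mxE -[RHS]addr0; congr (_ + _).
  rewrite lie_normE /L; under eq_bigr do rewrite p0.
  by congr (Num.sqrt (_ + Num.sqrt (_ - cabs _ ^+ 2))); apply: eq_bigr => i _; rewrite p0.
have /cvgrPdistC_lt /(_ (sg - lie_norm z)) := Lc; rewrite subr_gt0 => /(_ zs) /rV_near [d [d0 [_ Hd]]].
exists d => // h hh; pose t : 'rV[R]_(N + N) := row_mx (\row_i complex.Re (h ord0 i)) (\row_i complex.Im (h ord0 i)).
have Lt : L t = lie_norm (z + h).
  have p0 i : phi t i = (z + h) ord0 i by rewrite /phi /t row_mxEl row_mxEr !mxE; congr (_ + _); case: (h ord0 i).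
  rewrite lie_normE /L; under eq_bigr do rewrite p0.
  by congr (Num.sqrt (_ + Num.sqrt (_ - cabs _ ^+ 2))); apply: eq_bigr => i _; rewrite p0.
have : `|L t - L 0| < sg - lie_norm z.
  apply: Hd => i; rewrite [X in _ - X]mxE subr0; case: (splitP i) => k ik.
    have -> : i = lshift N k by exact/val_inj.
    by rewrite row_mxEl mxE; apply: (le_trans (Re_le_cabs _)); exact: ltW.
  have -> : i = rshift N k by exact/val_inj.
  by rewrite row_mxEr mxE; apply: (le_trans (Im_le_cabs _)); exact: ltW.
by rewrite L0 Lt => /(le_lt_trans (ler_norm _)); rewrite ltrD2r.
Qed.

(** [lie_bound] raises the polynomial factor by one degree; the gap between [sg] and the
    intermediate radius [tau] absorbs it through [poly_geo]. *)
Lemma hom_sum_bound (G : nat -> mpoly N R[i]) (r0 sg : R) (E : nat) : (forall j, hom j (G j)) ->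
  (forall tau, 0 < tau -> tau < r0 -> exists2 M, 0 <= M & forall j w, sph w -> cabs (mpoly_at (G j) w) <= M * j.+1%:R ^+ E * tau^-1 ^+ j) ->
  0 <= sg -> sg < r0 -> exists (M y : R), [/\ 0 <= y, y < 1 &
    forall j z, lie_norm z <= sg -> cabs (meval (fun i => z ord0 i) (G j)) <= M * y ^+ j].
Proof.
move=> hG hB s0 s1; pose tau := (sg + r0) / 2.
have t1 : sg < tau by rewrite ltr_pdivlMr// mulr_natr mulr2n ltrD2l.
have t0 : 0 < tau := le_lt_trans s0 t1.
have t2 : tau < r0 by rewrite ltr_pdivrMr// mulr_natr mulr2n ltrD2r.
have [M M0 HM] := hB tau t0 t2.
have x0 : 0 <= sg / tau by rewrite divr_ge0// ltW.
have x1 : sg / tau < 1 by rewrite ltr_pdivrMr// mul1r.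
have [M' [y [M'0 y0 y1 H]]] := poly_geo E.+1 x0 x1.
exists (M * M'), y; split => // j z zs.
apply: (le_trans (lie_bound z (hG j) (HM j))).
have L0 : 0 <= lie_norm z by exact: sqrtr_ge0.
apply: (@le_trans _ _ (M * (j.+1%:R ^+ E.+1 * (sg / tau) ^+ j))); last by rewrite -mulrA; apply: ler_wpM2l.
have -> : M * (j.+1%:R ^+ E.+1 * (sg / tau) ^+ j) = j.+1%:R * (M * j.+1%:R ^+ E * tau^-1 ^+ j) * sg ^+ j.
  by rewrite exprMn exprS; move: (j.+1%:R : R) => J; ring.
apply: ler_wpM2l; first by rewrite !mulr_ge0 ?exprn_ge0 ?invr_ge0// ltW.
by apply: lerXn2r; rewrite ?nnegrE.
Qed.

Lemma hom_sum_mvdiff (G : nat -> mpoly N R[i]) (r0 : R) (E : nat) : (forall j, hom j (G j)) ->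
  (forall tau, 0 < tau -> tau < r0 -> exists2 M, 0 <= M & forall j w, sph w -> cabs (mpoly_at (G j) w) <= M * j.+1%:R ^+ E * tau^-1 ^+ j) ->
  forall z, lie_norm z < r0 -> mvdiff (fun z => gsum (fun j => meval (fun i => z ord0 i) (G j))) z.
Proof.
move=> hG hB z zr; pose sg := (lie_norm z + r0) / 2.
have t1 : lie_norm z < sg by rewrite ltr_pdivlMr// mulr_natr mulr2n ltrD2l.
have s0 : 0 <= sg by apply: ltW; apply: le_lt_trans t1; exact: sqrtr_ge0.
have t2 : sg < r0 by rewrite ltr_pdivrMr// mulr_natr mulr2n ltrD2r.
have [M [y [y0 y1 HM]]] := hom_sum_bound hG hB s0 t2.
have [d d0 Hd] := lie_norm_near t1.
apply: (@sum_mvdiff _ _ (fun j z => meval (fun i => z ord0 i) (G j)) z d M y) => //.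
- by move=> j h _; exact: mvdiff_meval.
- by move=> j h hh; apply: HM; apply: ltW; exact: Hd.
Qed.
End HolSum.

(** * Completeness of the spherical harmonics *)

Section Completeness.
Variables (R : realType) (n : nat).
Let N := n.+2.
Implicit Types (P Q : mpoly N R[i]).

Lemma r2_sph m (w : 'rV[R]_N) : sph w -> mpoly_at (r2 R n ^+ m) w = 1.
Proof.
move=> /sphE Hw; elim: m => [|m IH].
  by rewrite expr0 /mpoly_at meval1.
rewrite exprS mpoly_atM IH mulr1 /r2 mpoly_at_sum.
transitivity ((\sum_i w ord0 i ^+ 2)%:C : R[i]); last by rewrite Hw.
rewrite rmorph_sum; apply: eq_bigr => i _.
by rewrite expr2 mpoly_atM /mpoly_at /Xi mevalXU -expr2 rmorphXn.
Qed.

Lemma dot_ortho k k' P Q : harmonic_homog k P -> harmonic_homog k' Q -> k != k' -> sphere_dot P Q = 0.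
Proof.
move=> hP hQ kk; transitivity (pint (P * cpoly Q)).
  by apply: eq_sphere_intC => w _; rewrite mpoly_atM cpoly_at.
have hc := harmonic_cpoly hQ; case: (ltngtP k k') => h.
- by rewrite mulrC; apply: (pint_ortho hc hP.1); rewrite h.
- by apply: (pint_ortho hP hc.1); rewrite h.
- by rewrite h eqxx in kk.
Qed.

Variables (a : nat -> nat) (Y : forall k, 'I_(a k) -> mpoly N R[i]).
Arguments Y : clear implicits.
Hypothesis hY : forall k, orthonormal_harmonic_basis k (Y k).

Lemma basis_harmonic k l : harmonic_homog k (Y k l). Proof. by have [h _ _] := hY k. Qed.
Lemma basis_dot k l l' : sphere_dot (Y k l) (Y k l') = (l == l')%:R. Proof. by have [_ _ h] := hY k. Qed.

(** Every power of the peaking kernel is a polynomial. By [fischer], and as [r2] is 1 on the sphere,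
    its restriction is a combination of harmonic polynomials, to which [d] is orthogonal; so [cpeak]
    applies. *)
Lemma complete (d : 'rV[R]_N -> R[i]) : sccts d ->
  (forall k l, sphere_intC (fun w => d w * Num.conj (mpoly_at (Y k l) w)) = 0) -> forall th, sph th -> d th = 0.
Proof.
move=> ds H th Hth.
have cs P : sccts (fun w => Num.conj (mpoly_at P w)) by apply: scctsJ; exact: mpoly_at_sccts.
have s1 k P : harmonic_homog k P -> sphere_intC (fun w => d w * Num.conj (mpoly_at P w)) = 0.
  move=> hP; have [_ /(_ P hP) [c [Pc _]] _] := hY k.
  transitivity (sphere_intC (fun w => \sum_l Num.conj (c l) * (d w * Num.conj (mpoly_at (Y k l) w)))).
    apply: eq_sphere_intC => w _; rewrite Pc mpoly_at_sum rmorph_sum mulr_sumr; apply: eq_bigr => l _.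
    by rewrite mpoly_atZ rmorphM mulrCA.
  rewrite sphere_intC_sum; last by move=> l; apply: scctsZ; exact: scctsM.
  by apply: big1 => l _; rewrite sphere_intCZ ?H ?mulr0//; exact: scctsM.
have s2 j Q : hom j Q -> sphere_intC (fun w => d w * mpoly_at Q w) = 0.
  move=> hQ; have [Hs [hH E]] := fischer (hom_cpoly hQ).
  transitivity (sphere_intC (fun w => \sum_(i < j./2.+1) d w * Num.conj (mpoly_at (Hs i) w))).
    apply: eq_sphere_intC => w Hw; rewrite -mulr_sumr; congr (_ * _).
    rewrite -[LHS](conjcK) -[conjc (mpoly_at Q w)]cpoly_at E mpoly_at_sum.
    rewrite -[conjc _]/(Num.conj _) rmorph_sum; apply: eq_bigr => i _.
    by rewrite mpoly_atM r2_sph// mul1r.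
  rewrite sphere_intC_sum; last by move=> i; exact: scctsM.
  apply: big1 => i _; apply: (s1 (j - i.*2)%N); apply: hH.
  apply: (@leq_trans j./2.*2); first by rewrite leq_double -ltnS.
  by rewrite -[X in (_ <= X)%N]odd_double_half leq_addl.
apply: (cpeak ds Hth) => K.
(* The linear form given by the inner product with [th]; the kernel is affine in it, and its powers
   are expanded by the binomial theorem. *)
pose L : mpoly N R[i] := \sum_i (th ord0 i)%:C *: Xi R i.
have hL m : hom m (L ^+ m).
  elim: m => [|m IH]; first exact: dhomog1.
  rewrite exprS; apply: (@homM _ _ 1 m) => //; apply: hom_sum => i; apply: homZ; exact: hom_Xi.
have EL m (w : 'rV[R]_N) : mpoly_at (L ^+ m) w = (sdot w th)%:C ^+ m.
  elim: m => [|m IH]; first by rewrite !expr0 /mpoly_at meval1.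
  rewrite !exprS mpoly_atM IH; congr (_ * _); rewrite mpoly_at_sum rmorph_sum; apply: eq_bigr => i _.
  by rewrite mpoly_atZ /mpoly_at /Xi mevalXU rmorphM mulrC.
transitivity (sphere_intC (fun w => \sum_(i < K.+1) ((2^-1 ^+ K)%:C *+ 'C(K, i)) * (d w * mpoly_at (L ^+ i) w))).
  apply: eq_sphere_intC => w _.
  have -> : (((1 + sdot w th) / 2) ^+ K)%:C = \sum_(i < K.+1) ((2^-1 ^+ K)%:C *+ 'C(K, i)) * (sdot w th)%:C ^+ i.
    rewrite exprMn mulrC exprDn mulr_sumr rmorph_sum; apply: eq_bigr => i _.
    by rewrite expr1n mul1r rmorphM rmorphMn !rmorphXn mulrnAl mulrnAr.
  by rewrite mulr_sumr; apply: eq_bigr => i _; rewrite EL mulrCA.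
rewrite sphere_intC_sum; last by move=> i; apply: scctsZ; apply: scctsM => //; exact: mpoly_at_sccts.
apply: big1 => i _; rewrite sphere_intCZ ?(s2 i) ?mulr0//.
by apply: scctsM => //; exact: mpoly_at_sccts.
Qed.
End Completeness.

Section Backward.
Variables (R : realType) (n : nat).
Let N := n.+2.
Variables (r0 : R) (f : 'rV[R]_N -> R[i]).
Variables (a : nat -> nat) (Y : forall k, 'I_(a k) -> mpoly N R[i]) (g : forall k, 'I_(a k) -> R[i] -> R[i]).
Arguments Y : clear implicits.
Arguments g : clear implicits.
Hypotheses (r00 : 0 < r0) (hY : forall k, orthonormal_harmonic_basis k (Y k)) (hf : smooth_on (eball N r0) f).
Hypothesis hg : forall k l, coef_ext r0 (lf_coef f (Y k l)) (g k l).
Let gam k l j := tcoef (g k l) (r0 / 2) j.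
Arguments gam : clear implicits.
Hypothesis hgam : forall tau, 0 < tau -> tau < r0 -> exists2 C, 0 < C & forall k l j, cabs (gam k l j) <= C * tau^-1 ^+ j.

(* The homogeneous part of degree [j] of the extension. *)
Definition hpart j : mpoly N R[i] := \sum_(k < j.+1) \sum_l gam k l j *: (r2 R n ^+ (j - k)./2 * Y k l).

Lemma hom_hpart j : hom j (hpart j).
Proof.
apply: hom_sum => k; apply: hom_sum => l.
(* For odd [j + k] the halving in [hpart] rounds down and the degree would be wrong, but those
   coefficients vanish by [gam_parity]. *)
have [od|ev] := boolP (odd (j + k)).
  by rewrite /gam (gam_parity r00 hf (basis_harmonic hY l) (hg l)) ?od ?orbT// scale0r; exact: hom0.
apply: homZ; have kj : (k <= j)%N by rewrite -ltnS.
have e : ((j - k)./2.*2 + k)%N = j by rewrite even_halfK ?subnK// oddB// -oddD.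
have hYk : hom k (Y k l) by case: (basis_harmonic hY l).
by have := homM (hom_r2 R n (j - k)./2) hYk; rewrite e.
Qed.

Lemma hpart_sph j (w : 'rV[R]_N) : sph w -> mpoly_at (hpart j) w = \sum_(k < j.+1) \sum_l gam k l j * mpoly_at (Y k l) w.
Proof.
move=> Hw; rewrite mpoly_at_sum; apply: eq_bigr => k _; rewrite mpoly_at_sum; apply: eq_bigr => l _.
by rewrite mpoly_atZ mpoly_atM r2_sph// mul1r.
Qed.

(** [hgam] contributes constants uniform in [k] and [l], [orthonormal_bound] a power of [k.+1], and
    the sum over [k <= j] one further factor [j.+1]. *)
Lemma hpart_bound : exists E, forall tau, 0 < tau -> tau < r0 ->
  exists2 M, 0 <= M & forall j w, sph w -> cabs (mpoly_at (hpart j) w) <= M * j.+1%:R ^+ E * tau^-1 ^+ j.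
Proof.
have [A [E [A0 HA]]] := orthonormal_bound R n.
exists E.+1 => tau t0 t1; have [C C0 HC] := hgam t0 t1.
exists (C * A); first by rewrite mulr_ge0// ltW.
move=> j w Hw; rewrite hpart_sph//; apply: (le_trans (cabs_sum _ _ _)).
have q0 : 0 <= C * tau^-1 ^+ j by rewrite mulr_ge0 ?exprn_ge0 ?invr_ge0// ltW.
apply: (@le_trans _ _ (\sum_(k < j.+1) (C * tau^-1 ^+ j) * (A * j.+1%:R ^+ E))); last first.
  rewrite sumr_const card_ord -[X in X <= _]mulr_natr exprS le_eqVlt; apply/orP; left; apply/eqP.
  by move: (j.+1%:R : R) => J; ring.
apply: ler_sum => k _; apply: (le_trans (cabs_sum _ _ _)).
apply: (@le_trans _ _ (\sum_l (C * tau^-1 ^+ j) * cabs (mpoly_at (Y k l) w))).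
  by apply: ler_sum => l _; rewrite cabsM; apply: ler_wpM2r; [exact: cabs_ge0|exact: HC].
rewrite -mulr_sumr; apply: ler_wpM2l => //.
have hYk l : hom k (Y k l) by case: (basis_harmonic hY l).
apply: (le_trans (HA k (a k) (Y k) hYk (basis_dot hY (k := k)) w Hw)).
apply: ler_wpM2l; first exact: ltW.
by apply: lerXn2r; rewrite ?nnegrE// ler_nat.
Qed.

Lemma hpart_dot j k l : sphere_dot (hpart j) (Y k l) = gam k l j.
Proof.
have ss k' l' : sccts (fun w => mpoly_at (Y k' l') w * Num.conj (mpoly_at (Y k l) w)).
  by apply: scctsM; [exact: mpoly_at_sccts|apply: scctsJ; exact: mpoly_at_sccts].
transitivity (\sum_(k' < j.+1) \sum_l' gam k' l' j * sphere_dot (Y k' l') (Y k l)).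
  rewrite /sphere_dot (eq_sphere_intC (h2 := fun w => \sum_(k' < j.+1) \sum_l' gam k' l' j * (mpoly_at (Y k' l') w * Num.conj (mpoly_at (Y k l) w)))).
    rewrite sphere_intC_sum; last by move=> k'; apply: sccts_sum => l'; apply: scctsZ; exact: ss.
    apply: eq_bigr => k' _; rewrite sphere_intC_sum; last by move=> l'; apply: scctsZ; exact: ss.
    by apply: eq_bigr => l' _; rewrite sphere_intCZ//; exact: ss.
  move=> w Hw; rewrite hpart_sph// mulr_suml; apply: eq_bigr => k' _.
  by rewrite mulr_suml; apply: eq_bigr => l' _; rewrite mulrA.
have [kj|kj] := ltnP k j.+1.
  rewrite (bigD1 (Ordinal kj))//= [X in _ + X]big1 ?addr0; last first.
    move=> k' kk; apply: big1 => l' _; rewrite (dot_ortho (basis_harmonic hY l') (basis_harmonic hY l)) ?mulr0//.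
  rewrite (bigD1 l)//= big1 ?addr0; first by rewrite (basis_dot hY) eqxx mulr1.
  by move=> l' ll; rewrite (basis_dot hY) (negbTE ll) mulr0.
(* For [k > j] no [Y k l] occurs in [hpart j], and [gam k l j] vanishes as well by [gam_parity]. *)
rewrite big1; first by rewrite /gam (gam_parity r00 hf (basis_harmonic hY l) (hg l)) ?kj.
move=> k' _; apply: big1 => l' _; rewrite (dot_ortho (basis_harmonic hY l') (basis_harmonic hY l)) ?mulr0//.
by rewrite neq_ltn (leq_trans (ltn_ord k') kj).
Qed.

(** On the sphere of radius [enorm x], [f] and the series have the same integrals against each
    [Y k l], by [lf_ps] and [hpart_dot]; [complete] makes them equal there. *)
Lemma hpart_sum x : eball N r0 x -> gsum (fun j => meval (fun i => complexify x ord0 i) (hpart j)) = f x.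
Proof.
rewrite /eball /= => xr; have [th Hth xE] := enorm_polar x.
set r := enorm x in xr xE; have rp : 0 <= r by exact: enorm_ge0.
pose tau := (r + r0) / 2.
have t1 : r < tau by rewrite ltr_pdivlMr// mulr_natr mulr2n ltrD2l.
have t0 : 0 < tau := le_lt_trans rp t1.
have t2 : tau < r0 by rewrite ltr_pdivrMr// mulr_natr mulr2n ltrD2r.
have [E HE] := hpart_bound; have [M M0 HM] := HE tau t0 t2.
have x0 : 0 <= r / tau by rewrite divr_ge0// ltW.
have x1 : r / tau < 1 by rewrite ltr_pdivrMr// mul1r.
have [M' [y [M'0 y0 y1 H]]] := poly_geo E x0 x1.
pose u j (w : 'rV[R]_N) := r%:C ^+ j * mpoly_at (hpart j) w.
have us j : sccts (u j) by apply: scctsZ; exact: mpoly_at_sccts.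
have ub j w : sph w -> cabs (u j w) <= (M * M') * y ^+ j.
  move=> Hw; rewrite cabsM cabsX cabsR ger0_norm//.
  apply: (@le_trans _ _ (M * (j.+1%:R ^+ E * (r / tau) ^+ j))); last by rewrite -mulrA; apply: ler_wpM2l.
  have -> : M * (j.+1%:R ^+ E * (r / tau) ^+ j) = r ^+ j * (M * j.+1%:R ^+ E * tau^-1 ^+ j).
    by rewrite exprMn; move: (j.+1%:R : R) => J; ring.
  by apply: ler_wpM2l; [exact: exprn_ge0|exact: HM].
pose d (w : 'rV[R]_N) := f (r *: w) - gsum (fun j => u j (nrm w)).
have ds : sccts d.
  by apply: scctsD; [exact: (smooth_sccts hf rp xr)|apply: scctsN; exact: (sccts_gsum y0 y1 us ub)].
suff d0 : d th = 0.
  have -> : f x = gsum (fun j => u j th).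
    by rewrite xE; apply/eqP; rewrite -subr_eq0 -{2}(nrm_sph Hth) -/(d th) d0.
  apply: gsum_eq => j; rewrite /u -(mpoly_at_ray r th (hom_hpart j)) -xE.
  by apply: meval_eq => i; rewrite mxE.
apply: (complete hY ds) => // k l.
have Js : sccts (fun w => Num.conj (mpoly_at (Y k l) w)) by apply: scctsJ; exact: mpoly_at_sccts.
have Ys : scont (fun w : 'rV[R]_N => cabs (mpoly_at (Y k l) w)).
  by move=> w Hw; apply: ccts_cabs; exact: mpoly_at_sccts.
have [th2 Hth2 Hmax] := sph_max Ys; pose B := cabs (mpoly_at (Y k l) th2).
pose v j (w : 'rV[R]_N) := Num.conj (mpoly_at (Y k l) w) * u j w.
have vs j : sccts (v j) by exact: scctsM.
have vb j w : sph w -> cabs (v j w) <= (B * (M * M')) * y ^+ j.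
  move=> Hw; rewrite cabsM -mulrA; apply: ler_pM; rewrite ?cabs_ge0//; last exact: ub.
  by apply: le_trans (Hmax w Hw); rewrite -[Num.conj _]/(conjc _) cabsJ.
have E1 : sphere_intC (fun w => Num.conj (mpoly_at (Y k l) w) * gsum (fun j => u j (nrm w))) = lf_coef f (Y k l) r.
  rewrite (lf_ps r00 (hg l) rp xr).
  rewrite (eq_sphere_intC (h2 := fun w => gsum (fun j => v j w))); last first.
    move=> w Hw; rewrite /v (gsumZ _ y0 y1 (M := M * M')); first by rewrite nrm_sph.
    by move=> j; exact: ub.
  rewrite (sphere_intC_gsum y0 y1 vs vb); apply: gsum_eq => j.
  rewrite -/(gam k l j) -hpart_dot /sphere_dot mulrC -sphere_intCZ; last by apply: scctsM => //; exact: mpoly_at_sccts.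
  by apply: eq_sphere_intC => w _; rewrite /v /u mulrC -mulrA.
have us2 : sccts (fun w => gsum (fun j => u j (nrm w))) by exact: (sccts_gsum y0 y1 us ub).
transitivity (sphere_intC (fun w => f (r *: w) * Num.conj (mpoly_at (Y k l) w)) - sphere_intC (fun w => Num.conj (mpoly_at (Y k l) w) * gsum (fun j => u j (nrm w)))).
  have fs := smooth_sccts hf rp xr.
  rewrite -mulN1r -sphere_intCZ; last exact: scctsM.
  rewrite -sphere_intCD; first by apply: eq_sphere_intC => w _; rewrite /d mulN1r mulrBl (mulrC (gsum _)).
    exact: scctsM.
  by apply: scctsZ; exact: scctsM.
by rewrite E1 subrr.
Qed.

Lemma backward : has_holo_ext r0 f.
Proof.
have [E HE] := hpart_bound.
exists (fun z => gsum (fun j => meval (fun i => z ord0 i) (hpart j))); split; last exact: hpart_sum.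
apply/holomorphic_mvP => z /(lie_ball_norm z r00).
exact: (hom_sum_mvdiff hom_hpart HE).
Qed.
End Backward.

Theorem theorem1 (R : realType) (n : nat) (r0 : R)
    (a : nat -> nat) (Y : forall k : nat, 'I_(a k) -> mpoly.mpoly n R[i])
    (f : 'rV[R]_n -> R[i]) :
  (2 <= n)%N -> 0 < r0 ->
  (forall k : nat, orthonormal_harmonic_basis k (Y k)) ->
  smooth_on (eball n r0) f ->
  has_holo_ext r0 f <->
  (forall (k : nat) (l : 'I_(a k)),
     exists g : R[i] -> R[i], coef_ext r0 (lf_coef f (Y k l)) g) /\
  (forall tau rho : R, 0 < tau -> tau < rho -> rho < r0 ->
     exists C : R, 0 < C /\
     forall (k : nat) (l : 'I_(a k)) (p : R[i] -> R[i]),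
       radial_ext r0 k (lf_coef f (Y k l)) p ->
       forall zeta : R[i], cabs zeta <= tau ^+ 2 ->
         cabs (p zeta) <= C * (1 / rho ^+ k)).
Proof.
case: n Y f => [|[|n]] // Y f _ r00 hY hf.
split=> [[F [/holomorphic_mvP hF fF]]|[ha hb]].
  split=> [k l|tau rho t0 tr rr].
    by apply: (forward_coef r00 hF fF); rewrite (basis_dot hY) eqxx.
  have [C C0 HC] := forward_bound r00 hF fF hf t0 tr rr.
  exists C; split => // k l p hp; apply: (HC k (Y k l)) => //; first exact: basis_harmonic.
  by rewrite (basis_dot hY) eqxx.
pose g k l := sval (cid (ha k l)).
have hg k l : coef_ext r0 (lf_coef f (Y k l)) (g k l) by rewrite /g; case: cid.
(* A bound at the single radius [tau] is wanted, while (b) takes two; any [rho] between [tau] and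
   [r0] serves. *)
apply: (backward r00 hY hf hg) => tau t0 tr; pose rho := (tau + r0) / 2.
have t1 : tau < rho by rewrite ltr_pdivlMr// mulr_natr mulr2n ltrD2l.
have t2 : rho < r0 by rewrite ltr_pdivrMr// mulr_natr mulr2n ltrD2r.
have [C [C0 HC]] := hb tau rho t0 t1 t2; exists C => // k l j.
have hk := basis_harmonic hY l.
(* (b) bounds every radial extension but provides none; here one is built from the expansion of
   [g k l]. *)
have [p hp] := radial_ex r00 hf hk (hg k l).
exact: (radial_gam_bound r00 hf hk (hg k l) hp t0 t1 t2 C0 (HC k l p hp)).
Qed.
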